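(* Let $N$ be a positive integer, let $(F^{(s)}_{\rho_N+4,N})_{1\le s\le \delta_{\rho_N+4}(N)}$ be a unitary upper triangular basis of $S_{\rho_N+4}(\Gamma_0(N))$, and let $E_{2,N}^{(0)}\in M_2(\Gamma_0(N))$ be unitary of valuation $0$. Then for every integer $k\ge \frac{\rho_N}{2}+2$, $$S_{2k}(\Gamma_0(N)) = \Delta_N\cdot S_{2k-\rho_N}(\Gamma_0(N))\ \oplus\ \mathrm{Vect}\left(F_{\rho_N+4,N}^{(s)}\,[E_{2,N}^{(0)}]^{k-\frac{\rho_N}{2}-2}\ :\ 1\le s\le \nu(\Delta_N)\right).$$ Therefore, if $k\ge 2$ and $k=q\frac{\rho_N}{2}+r$ with integers $q\ge 0$ and $2\le r\le \frac{\rho_N}{2}+1$, then $$S_{2k}(\Gamma_0(N)) = \Delta_N^{q}\cdot S_{2r}(\Gamma_0(N))\ \oplus\ \bigoplus_{n=0}^{q-1}\Delta_N^n\cdot \mathrm{Vect}\left(F_{\rho_N+4,N}^{(s)}\,[E_{2,N}^{(0)}]^{k-(n+1)\frac{\rho_N}{2}-2}\ :\ 1\le s\le \nu(\Delta_N)\right).$$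
   Context: $M_{2k}(\Gamma_0(N))$ and $S_{2k}(\Gamma_0(N))$ are the complex vector spaces of modular forms and cusp forms of weight $2k$ for $\Gamma_0(N)$, and $\delta_{2k}(N)=\dim S_{2k}(\Gamma_0(N))$. For a nonzero form $f$ with expansion $f=\sum_{n\ge0} a_nq^n$ at the cusp $\infty$ ($q=e^{2i\pi\tau}$), the valuation $\nu(f)$ is the least $n$ with $a_n\ne0$; $f$ is unitary if $a_{\nu(f)}=1$. A basis $(f_i)$ is unitary upper triangular if every $f_i$ is unitary and the valuations $\nu(f_i)$ are strictly increasing in $i$. A strong modular form of level $N$ is a modular form for $\Gamma_0(N)$ of positive weight with no zero in the upper half-plane and no zero at any cusp of $\Gamma_0(N)$ other than $\infty$. $\Delta_N$ is the unitary strong modular form of level $N$ of minimal weight (it exists and is unique), and $\rho_N$ is its weight, an even integer; for example $\Delta_1=\Delta$ with $\rho_1=12$, and $\Delta_2(\tau)=\eta(2\tau)^{16}\eta(\tau)^{-8}$ with $\rho_2=4$. $\mathrm{Vect}$ denotes linear span over $\mathbb{C}$. *)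

(* Defs.v *)
From Stdlib Require Import Reals ZArith List Lia Lra Psatz.
From Coquelicot Require Import Coquelicot.

(* Stdlib real numbers and Coquelicot's complex numbers [C]. *)

Local Open Scope C_scope.

Record UHP : Type := mkUHP { uhp_val :> C; uhp_pos : (0 < Im uhp_val)%R }.

Record SL2Z : Type := mkSL2Z {
  sl_a : Z; sl_b : Z; sl_c : Z; sl_d : Z;
  sl_det : (sl_a * sl_d - sl_b * sl_c = 1)%Z }.

Definition in_Gamma0 (N : nat) (g : SL2Z) : Prop := (Z.of_nat N | sl_c g)%Z.

Definition ZtoC (z : Z) : C := RtoC (IZR z).

Definition moebius_num (g : SL2Z) (tau : C) : C :=
  ZtoC (sl_a g) * tau + ZtoC (sl_b g).

Definition moebius_den (g : SL2Z) (tau : C) : C :=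
  ZtoC (sl_c g) * tau + ZtoC (sl_d g).

Lemma moebius_den_norm_pos (g : SL2Z) (tau : UHP) :
  (0 < Re (moebius_den g tau) ^ 2 + Im (moebius_den g tau) ^ 2)%R.
Proof.
destruct g as [a b c d e]; destruct tau as [[x y] h].
unfold moebius_den, ZtoC; simpl in *.
assert (E : (IZR a * IZR d - IZR b * IZR c = 1)%R)
  by (rewrite <- !mult_IZR, <- minus_IZR, e; reflexivity).
destruct (Z.eq_dec c 0) as [->|nz].
- assert (IZR d <> 0)%R by (intros D; rewrite D in E; lra).
  match goal with |- (0 < ?X)%R => replace X with (IZR d * IZR d)%R by ring end.
  now apply Rsqr_pos_lt.
- assert (IZR c <> 0)%R by (now apply not_0_IZR).
  assert (0 < (IZR c * y) * (IZR c * y))%R.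
  { assert (IZR c * y <> 0)%R by (apply Rmult_integral_contrapositive; lra).
    now apply Rsqr_pos_lt. }
  match goal with |- (0 < ?X)%R => replace X with
    ((IZR c * x + IZR d) * (IZR c * x + IZR d)
     + (IZR c * y) * (IZR c * y))%R by ring end.
  apply Rplus_le_lt_0_compat; [apply Rle_0_sqr | assumption].
Qed.

Lemma moebius_pos (g : SL2Z) (tau : UHP) :
  (0 < Im (moebius_num g tau / moebius_den g tau))%R.
Proof.
assert (P := moebius_den_norm_pos g tau).
destruct g as [a b c d e]; destruct tau as [[x y] h].
unfold moebius_num, moebius_den, ZtoC in *; simpl in *.
assert (E : (IZR a * IZR d - IZR b * IZR c = 1)%R)
  by (rewrite <- !mult_IZR, <- minus_IZR, e; reflexivity).
match type of P with (0 < ?X)%R => set (n := X) in * end.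
match goal with |- (0 < ?X)%R => replace X with (y / n)%R end.
- apply Rdiv_lt_0_compat; assumption.
- replace y with (y * (IZR a * IZR d - IZR b * IZR c))%R at 1
    by (rewrite E; ring).
  unfold n in *; field; lra.
Qed.

Definition moebius (g : SL2Z) (tau : UHP) : UHP :=
  mkUHP (moebius_num g tau / moebius_den g tau) (moebius_pos g tau).

Definition slash (k : nat) (g : SL2Z) (f : UHP -> C) : UHP -> C :=
  fun tau => f (moebius g tau) / moebius_den g tau ^ k.

(* The value off the upper half-plane is irrelevant to [holomorphic], since
   the upper half-plane is open. *)
Definition extend (f : UHP -> C) (z : C) : C :=
  match Rlt_dec 0 (Im z) with
  | left h => f (mkUHP z h)
  | right _ => 0
  end.

Definition holomorphic (f : UHP -> C) : Prop :=
  forall tau : UHP, @ex_derive C_AbsRing C_NormedModule (extend f) (uhp_val tau).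

Definition Cexp (z : C) : C := RtoC (exp (Re z)) * (cos (Im z), sin (Im z)).

(* f(tau) = sum_{n >= 0} a_n exp (2 i pi n tau / h) on the upper half-plane *)
Definition has_qexp (h : nat) (f : UHP -> C) (a : nat -> C) : Prop :=
  forall tau : UHP,
    @is_series C_AbsRing C_NormedModule
      (fun n => a n * Cexp (RtoC (2 * PI * INR n / INR h) * Ci * tau))
      (f tau).

(* The expansion of a form f of level N at the cusp alpha(oo) is that of
   f|alpha in powers of exp (2 i pi tau / N): the subgroup Gamma(N) is normal
   in SL2(Z), hence f|alpha is N-periodic for every alpha. *)
Definition modular_form (N k : nat) (f : UHP -> C) : Prop :=
  holomorphic f /\
  (forall g : SL2Z, in_Gamma0 N g -> slash k g f = f) /\
  (forall alpha : SL2Z, exists a, has_qexp N (slash k alpha f) a).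

Definition zero_at_cusp (N k : nat) (f : UHP -> C) (alpha : SL2Z) : Prop :=
  exists a, has_qexp N (slash k alpha f) a /\ a 0%nat = 0.

Definition cusp_form (N k : nat) (f : UHP -> C) : Prop :=
  modular_form N k f /\ forall alpha : SL2Z, zero_at_cusp N k f alpha.

(* g(alpha(oo)) = oo for some g in Gamma0(N): the lower left entry of the
   product g alpha is zero. *)
Definition cusp_equiv_infty (N : nat) (alpha : SL2Z) : Prop :=
  exists g : SL2Z, in_Gamma0 N g /\
    (sl_c g * sl_a alpha + sl_d g * sl_c alpha = 0)%Z.

Definition first_nonzero (a : nat -> C) (n : nat) : Prop :=
  a n <> 0 /\ forall m : nat, (m < n)%nat -> a m = 0.

(* nu(f) = n *)
Definition is_valuation (f : UHP -> C) (n : nat) : Prop :=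
  exists a, has_qexp 1 f a /\ first_nonzero a n.

Definition unitary (f : UHP -> C) : Prop :=
  exists a n, has_qexp 1 f a /\ first_nonzero a n /\ a n = 1.

Definition strong_modular_form (N k : nat) (f : UHP -> C) : Prop :=
  (0 < k)%nat /\ modular_form N k f /\
  (forall tau : UHP, f tau <> 0) /\
  (forall alpha : SL2Z,
     ~ cusp_equiv_infty N alpha -> ~ zero_at_cusp N k f alpha).

(* f = Delta_N and rho = rho_N *)
Definition is_Delta (N rho : nat) (f : UHP -> C) : Prop :=
  strong_modular_form N rho f /\ unitary f /\
  forall k g, strong_modular_form N k g -> unitary g -> (rho <= k)%nat.

Definition fzero : UHP -> C := fun _ => 0.
Definition fadd (f g : UHP -> C) : UHP -> C := fun tau => f tau + g tau.
Definition fmul (f g : UHP -> C) : UHP -> C := fun tau => f tau * g tau.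
Definition fpow (f : UHP -> C) (n : nat) : UHP -> C := fun tau => f tau ^ n.

(* sum_{1 <= s <= d} c_s F_s *)
Definition lincomb (c : nat -> C) (F : nat -> UHP -> C) (d : nat) : UHP -> C :=
  fun tau => @sum_n_m C_AbelianMonoid (fun s => c s * F s tau) 1 d.

(* The span of F_1, ..., F_d *)
Definition Vect (F : nat -> UHP -> C) (d : nat) (f : UHP -> C) : Prop :=
  exists c, f = lincomb c F d.

(* f V = { f v : v in V } *)
Definition mul_space (f : UHP -> C) (V : (UHP -> C) -> Prop) (g : UHP -> C)
  : Prop := exists v, V v /\ g = fmul f v.

(* (F_1, ..., F_d) is a basis of V; in particular d = dim V, and the values
   F_s for s outside of {1, ..., d} are irrelevant. *)
Definition is_basis (V : (UHP -> C) -> Prop) (F : nat -> UHP -> C) (d : nat)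
  : Prop :=
  (forall s, (1 <= s <= d)%nat -> V (F s)) /\
  (forall f, V f -> Vect F d f) /\
  (forall c, lincomb c F d = fzero -> forall s, (1 <= s <= d)%nat -> c s = 0).

Definition unitary_upper_triangular (F : nat -> UHP -> C) (d : nat) : Prop :=
  (forall s, (1 <= s <= d)%nat -> unitary (F s)) /\
  (forall s t m n, (1 <= s)%nat -> (s < t)%nat -> (t <= d)%nat ->
     is_valuation (F s) m -> is_valuation (F t) n -> (m < n)%nat).

Definition decomposition (Ws : list ((UHP -> C) -> Prop)) (f : UHP -> C)
    (ws : list (UHP -> C)) : Prop :=
  Forall2 (fun W w => W w) Ws ws /\ f = fold_right fadd fzero ws.

(* V is the internal direct sum of the subspaces listed in Ws. *)
Definition is_direct_sum (V : (UHP -> C) -> Prop)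
    (Ws : list ((UHP -> C) -> Prop)) : Prop :=
  (forall f, V f -> exists! ws, decomposition Ws f ws) /\
  (forall f ws, decomposition Ws f ws -> V f).

(* Main.v *)
Require Import Defs.
From Stdlib Require Import Reals ZArith Arith List Lia Lra Psatz ProofIrrelevance
  FunctionalExtensionality PropExtensionality ClassicalEpsilon Classical Permutation.
From Coquelicot Require Import Coquelicot.

(** Division by Delta identifies the forms of S_2k vanishing to order more than
    nu = nu(Delta) at oo with S_(2k - rho), because Delta has no zero outside oo.
    The statement therefore says that the forms F_s E^j with s <= nu realise
    exactly the valuations 1, ..., nu, that is nu(F_s) = s for s <= nu.  As (F_s)
    is a triangular basis of S_(rho + 4), it is enough to find in that space one
    form of each valuation j with 1 <= j <= nu.  The product of Delta by the
    Poincare series of weight 4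
      P(tau) = sum_(c, d) (c tau + d)^-4 exp (-2 i pi (nu - j) gamma tau)
    over the coprime rows (c, d) with N | c is such a form: P converges absolutely
    (this is why the weight is rho + 4), it has a pole of order nu - j at oo and
    it vanishes at the other cusps.  So neither Riemann-Roch nor a dimension formula is needed.

    That the quotients and products above have q-expansions is the principle that
    an h-periodic holomorphic function with a limit at i oo is a power series in
    e = exp (2 i pi tau / h).  For a point w, the function
    k = (f - f(w)) / (e - e(w)) is holomorphic off w + h Z and continuous at w, so
    its Fourier coefficients c_n do not depend on the height; then
    h a_n = c_(n-1) - e(w) c_n + [n = 0] h f(w) with c_(-1) = 0, and
    sum_(n <= M) a_n e(w)^n telescopes to f(w) - c_M e(w)^(M+1) / h. *)

(** Moving a line of integration means differentiating under the integral sign, which needs a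
    continuous derivative, and complex differentiability alone does not provide one. The proof
    therefore works with the class [C11] of functions with a locally uniform quadratic Taylor
    remainder. Its derivatives are Lipschitz; it is stable under products, quotients by functions
    without zeros, composition and locally dominated limits; it contains every function with a
    q-expansion; and it makes horizontal integrals of periodic functions independent of the height
    by the Cauchy-Riemann equations, so that no contour other than a horizontal segment occurs. With
    the expansion principle, belonging to a space of forms becomes [C11], invariance and a limit at
    i oo of every slash. Products with Delta, quotients by Delta and Poincare series are then all
    treated by computing limits. Orders at oo are likewise handled as limits of f q^-n; the passage
    from f = o(q^n) to order n + 1 goes back to the coefficients. *)

(** * Bounds for the complex exponential *)

Section ComplexExponential.
Local Open Scope R_scope.
Local Open Scope C_scope.

Lemma C_ext (z w : C) : Re z = Re w -> Im z = Im w -> z = w.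
Proof. destruct z, w; simpl; intros -> ->; reflexivity. Qed.

Lemma Cmod_le_abs (z : C) : (Cmod z <= Rabs (Re z) + Rabs (Im z)).
Proof.
destruct z as [x y]; simpl.
replace ((x, y) : C) with (RtoC x + RtoC y * Ci)
  by (apply C_ext; simpl; ring).
eapply Rle_trans; [apply Cmod_triangle|].
rewrite Cmod_mult, Cmod_Ci, !Cmod_R; lra.
Qed.

Lemma Im_le_Cmod (z : C) : (Rabs (Im z) <= Cmod z).
Proof. apply Rle_trans with (2 := Rmax_Cmod z); apply Rmax_r. Qed.

Lemma Cmod_minus_sym (z w : C) : Cmod (z - w) = Cmod (w - z).
Proof. rewrite <- Cmod_opp; f_equal; ring. Qed.

Lemma Cmod_triangle_rev (z w : C) : (Cmod z - Cmod w <= Cmod (z - w)).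
Proof.
assert (H := Cmod_triangle (z - w) w).
replace (z - w + w) with z in H by ring; lra.
Qed.

Lemma Im_minus (z w : C) : Im (z - w) = (Im z - Im w)%R.
Proof. reflexivity. Qed.

Lemma Re_minus (z w : C) : Re (z - w) = (Re z - Re w)%R.
Proof. reflexivity. Qed.

Lemma Cexp_plus (z w : C) : Cexp (z + w) = Cexp z * Cexp w.
Proof.
destruct z as [a b], w as [c d]; unfold Cexp, Cmult, RtoC; simpl.
rewrite exp_plus, cos_plus, sin_plus; apply C_ext; simpl; ring.
Qed.

Lemma Cexp_0 : Cexp 0 = 1.
Proof. unfold Cexp; simpl; rewrite exp_0, cos_0, sin_0; apply C_ext; simpl; ring. Qed.

Lemma Cmod_Cexp (z : C) : Cmod (Cexp z) = exp (Re z).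
Proof.
unfold Cexp; rewrite Cmod_mult, Cmod_R, Rabs_pos_eq by (left; apply exp_pos).
assert (Cmod (cos (Im z), sin (Im z)) = 1)%R as ->; [|ring].
unfold Cmod; simpl.
replace (_ + _)%R with 1%R; [apply sqrt_1|].
assert (H := sin2_cos2 (Im z)); unfold Rsqr in H; lra.
Qed.

Lemma Cexp_neq_0 (z : C) : Cexp z <> 0.
Proof. apply Cmod_gt_0; rewrite Cmod_Cexp; apply exp_pos. Qed.

Lemma exp_sub_1_bound (x : R) : (Rabs (exp x - 1) <= Rabs x * exp (Rabs x)).
Proof.
assert (A := exp_ineq1_le x); assert (B := exp_ineq1_le (- x)).
assert (P := exp_pos x); assert (E : (exp x * exp (- x) = 1)%R)
  by (rewrite <- exp_plus, Rplus_opp_r; apply exp_0).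
destruct (Rle_dec 0 x).
- rewrite (Rabs_pos_eq x), Rabs_pos_eq by lra; nra.
- rewrite (Rabs_left x), Rabs_left1 by
    (try lra; assert (exp x < exp 0) by (apply exp_increasing; lra);
     rewrite exp_0 in *; lra).
  assert (1 <= exp (- x)) by lra; nra.
Qed.

Lemma exp_taylor1_bound (x : R) :
  Rabs (exp x - 1 - x) <= x * x * exp (Rabs x).
Proof.
assert (A := exp_ineq1_le x); assert (B := exp_ineq1_le (- x)).
assert (P := exp_pos x); assert (E : (exp x * exp (- x) = 1)%R)
  by (rewrite <- exp_plus, Rplus_opp_r; apply exp_0).
rewrite Rabs_pos_eq by lra.
assert (D : exp x - 1 <= x * exp x) by nra.
destruct (Rle_dec 0 x).
- rewrite (Rabs_pos_eq x) by lra; nra.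
- rewrite (Rabs_left x) by lra.
  assert (1 <= exp (- x)) by lra.
  assert (x * x * 1 <= x * x * exp (- x)) by nra. nra.
Qed.

Lemma Rabs_sin_le (x : R) : (Rabs (sin x) <= Rabs x).
Proof.
destruct (MVT_gen sin 0 x cos) as [c [_ E]].
- intros; apply is_derive_sin.
- intros; apply continuity_pt_filterlim, continuous_sin.
- rewrite sin_0, !Rminus_0_r in E; rewrite E, Rabs_mult.
  assert (Rabs (cos c) <= 1) by (apply Rabs_le; apply COS_bound).
  assert (P := Rabs_pos x); nra.
Qed.

Lemma one_sub_cos (x : R) : (1 - cos x = 2 * (sin (x / 2) * sin (x / 2)))%R.
Proof.
replace x with (2 * (x / 2))%R at 1 by field; rewrite cos_2a.
assert (H := sin2_cos2 (x / 2)); unfold Rsqr in H; lra.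
Qed.

Lemma one_sub_cos_bound (x : R) : (Rabs (cos x - 1) <= x * x).
Proof.
replace (cos x - 1)%R with (- (1 - cos x))%R by ring.
rewrite Rabs_Ropp, one_sub_cos.
assert (A := Rabs_sin_le (x / 2)); assert (P := Rabs_pos (sin (x / 2))).
assert (Q : (Rabs (x / 2) * Rabs (x / 2) = x * x / 4)%R)
  by (rewrite <- Rabs_mult, Rabs_pos_eq; nra).
rewrite !Rabs_mult, (Rabs_pos_eq 2) by lra; nra.
Qed.

Lemma sin_taylor1_bound (x : R) : (Rabs (sin x - x) <= x * x).
Proof.
destruct (MVT_gen (fun x => sin x - x)%R 0 x (fun t => cos t - 1)%R) as [c [I E]].
- intros; auto_derive; [trivial|ring].
- intros; apply continuity_pt_filterlim.
  apply (ex_derive_continuous (fun x => sin x - x)%R); auto_derive; trivial.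
- rewrite sin_0, !Rminus_0_r in E; rewrite E, Rabs_mult.
  assert (H : Rabs (cos c - 1) <= Rabs x).
  { replace (cos c - 1)%R with (- (1 - cos c))%R by ring.
    rewrite Rabs_Ropp, one_sub_cos, !Rabs_mult, (Rabs_pos_eq 2) by lra.
    assert (A := Rabs_sin_le (c / 2)); assert (P := Rabs_pos (sin (c / 2))).
    assert (B : Rabs (sin (c / 2)) <= 1) by (apply Rabs_le; apply SIN_bound).
    assert (Rabs (c / 2) = Rabs c / 2)%R as F
      by (unfold Rdiv; rewrite Rabs_mult, (Rabs_pos_eq (/ 2)); lra).
    assert (Rabs c <= Rabs x).
    { revert I; unfold Rmin, Rmax; destruct (Rle_dec 0 x); intros I.
      - rewrite !Rabs_pos_eq; lra.
      - rewrite !Rabs_left1; lra. }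
    nra. }
  assert (P := Rabs_pos x).
  replace (x * x)%R with (Rabs x * Rabs x)%R
    by (rewrite <- Rabs_mult, Rabs_pos_eq; nra).
  nra.
Qed.

(** With h = x + i y, the real part splits as (e^x - 1 - x) + e^x (cos y - 1) and the imaginary part
    as e^x (sin y - y) + (e^x - 1) y, each summand being quadratic. The pieces add up to (2 x^2 + 3
    y^2) exp |x|, rounded up to the constant 4. *)
Lemma Cexp_taylor1_bound (h : C) :
  Cmod (Cexp h - 1 - h) <= 4 * Cmod h ^ 2 * exp (Rabs (Re h)).
Proof.
eapply Rle_trans; [apply Cmod_le_abs|].
rewrite Cmod2_alt.
destruct h as [x y]; unfold Cexp, Cminus, Cplus, Copp, Cmult, RtoC; simpl.
set (e := exp (Rabs x)).
assert (E1 : 1 <= e).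
{ unfold e; rewrite <- exp_0; destruct (Rabs_pos x) as [L|L];
  [left; apply exp_increasing; exact L|rewrite <- L; lra]. }
assert (E2 : 0 < exp x <= e).
{ split; [apply exp_pos|]. unfold e; assert (L := Rle_abs x); destruct L as [L|L];
  [left; apply exp_increasing; exact L|rewrite <- L; lra]. }
assert (A := exp_taylor1_bound x); assert (B := exp_sub_1_bound x).
assert (D := one_sub_cos_bound y); assert (F := sin_taylor1_bound y).
fold e in A, B.
assert (Px := Rabs_pos x); assert (Py := Rabs_pos y).
assert (X2 : (x * x = Rabs x * Rabs x)%R)
  by (rewrite <- Rabs_mult, Rabs_pos_eq; nra).
assert (Y2 : (y * y = Rabs y * Rabs y)%R)
  by (rewrite <- Rabs_mult, Rabs_pos_eq; nra).
assert (H1 : Rabs (exp x * cos y - 0 * sin y + - (1) + - x)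
   <= (x * x + y * y) * e).
{ replace (exp x * cos y - 0 * sin y + - (1) + - x)%R
    with ((exp x - 1 - x) + exp x * (cos y - 1))%R by ring.
  eapply Rle_trans; [apply Rabs_triang|].
  rewrite Rabs_mult, (Rabs_pos_eq (exp x)) by lra.
  assert (exp x * Rabs (cos y - 1) <= e * (y * y))
    by (apply Rmult_le_compat; try lra; apply Rabs_pos).
  lra. }
assert (H2 : Rabs (exp x * sin y + 0 * cos y + - 0 + - y)
   <= (x * x + 2 * (y * y)) * e).
{ replace (exp x * sin y + 0 * cos y + - 0 + - y)%R
    with (exp x * (sin y - y) + (exp x - 1) * y)%R by ring.
  eapply Rle_trans; [apply Rabs_triang|].
  rewrite !Rabs_mult, (Rabs_pos_eq (exp x)) by lra.
  assert (exp x * Rabs (sin y - y) <= e * (y * y))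
    by (apply Rmult_le_compat; try lra; apply Rabs_pos).
  assert (Rabs (exp x - 1) * Rabs y <= (Rabs x * e) * Rabs y)
    by (apply Rmult_le_compat_r; lra).
  assert (Rabs x * Rabs y <= x * x + y * y) by nra.
  nra. }
assert (0 <= x * x) by nra. assert (0 <= y * y) by nra.
replace (x * (x * 1) + y * (y * 1))%R with (x * x + y * y)%R by ring.
nra.
Qed.

(** The frequency is an arbitrary real number, so that q^n, its roots q^(n/h) and the poles q^-n are
    values of one function. *)
Definition qe (s : R) (z : C) : C := Cexp (RtoC s * Ci * z).

Lemma Cmod_qe (s : R) (z : C) : Cmod (qe s z) = exp (- (s * Im z)).
Proof.
unfold qe; rewrite Cmod_Cexp; f_equal.
destruct z; unfold Cmult, RtoC, Ci; simpl; ring.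
Qed.

Lemma qe_neq_0 (s : R) (z : C) : qe s z <> 0.
Proof. apply Cexp_neq_0. Qed.

Lemma qe_plus (s t : R) (z : C) : qe (s + t) z = qe s z * qe t z.
Proof. unfold qe; rewrite <- Cexp_plus; f_equal; rewrite RtoC_plus; ring. Qed.

Lemma qe_0 (z : C) : qe 0 z = 1.
Proof. unfold qe; rewrite <- Cexp_0; f_equal; ring. Qed.

Lemma qe_freq_0 (s : R) (z : C) : qe (- (INR 0 * s)) z = 1.
Proof. simpl; rewrite Rmult_0_l, Ropp_0; apply qe_0. Qed.

Lemma qe_add (s : R) (z w : C) : qe s (z + w) = qe s z * qe s w.
Proof. unfold qe; rewrite <- Cexp_plus; f_equal; ring. Qed.

Lemma qe_opp (s : R) (z : C) : qe (- s) z * qe s z = 1.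
Proof. rewrite <- qe_plus, Rplus_opp_l; apply qe_0. Qed.

Lemma exp_le (x y : R) : x <= y -> exp x <= exp y.
Proof.
intros [L|L]; [left; apply exp_increasing; exact L|rewrite L; lra].
Qed.

End ComplexExponential.

(** * Functions with a quadratic Taylor remainder *)

Section Taylor.
Local Open Scope R_scope.
Local Open Scope C_scope.

(* First-order Taylor expansion with a remainder that is quadratic uniformly
   on S.  Unlike complex differentiability it passes to pointwise limits of f
   and f', and it makes f' Lipschitz. *)
Definition taylor1 (S : UHP -> Prop) (K : R) (f f' : UHP -> C) : Prop :=
  0 <= K /\ forall z, S z ->
    (Cmod (f z) <= K) /\ (Cmod (f' z) <= K) /\
    forall w, S w ->
      (Cmod (f w - f z - (w - z) * f' z) <= K * Cmod (w - z) ^ 2).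

Lemma taylor1_mono (S T : UHP -> Prop) (K L : R) (f f' : UHP -> C) :
  (forall z, T z -> S z) -> K <= L ->
  taylor1 S K f f' -> taylor1 T L f f'.
Proof.
intros ST KL [K0 H]; split; [lra|]; intros z Tz.
destruct (H z (ST z Tz)) as (A & B & D); split; [lra|split; [lra|]].
intros w Tw; assert (E := D w (ST w Tw)).
assert (0 <= Cmod (w - z) ^ 2) by (apply pow2_ge_0); nra.
Qed.

Lemma taylor1_ext (S : UHP -> Prop) (K : R) (f f' g g' : UHP -> C) :
  (forall z, f z = g z) -> (forall z, S z -> f' z = g' z) ->
  taylor1 S K f f' -> taylor1 S K g g'.
Proof.
intros E E' [K0 H]; split; [lra|]; intros z Sz.
destruct (H z Sz) as (A & B & D); rewrite E in A; rewrite E' in B by exact Sz.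
split; [lra|split; [lra|]].
intros w Sw; specialize (D w Sw); rewrite !E, E' in D by exact Sz; exact D.
Qed.

Lemma taylor1_lipschitz (S : UHP -> Prop) (K : R) (f f' : UHP -> C) (z w : UHP) :
  taylor1 S K f f' -> S z -> S w ->
  Cmod (f w - f z) <= K * (Cmod (w - z) + Cmod (w - z) ^ 2).
Proof.
intros [K0 H] Sz Sw; destruct (H z Sz) as (A & B & D); specialize (D w Sw).
replace (f w - f z) with ((w - z) * f' z + (f w - f z - (w - z) * f' z)) by ring.
eapply Rle_trans; [apply Cmod_triangle|]; rewrite Cmod_mult.
assert (P := Cmod_ge_0 (w - z)); nra.
Qed.

Lemma taylor1_const (S : UHP -> Prop) (c : C) :
  taylor1 S (Cmod c) (fun _ => c) (fun _ => 0).
Proof.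
split; [apply Cmod_ge_0|]; intros z _; rewrite Cmod_0.
split; [lra|split; [apply Cmod_ge_0|]]; intros w _.
replace (c - c - (w - z) * 0) with (RtoC 0) by ring; rewrite Cmod_0.
apply Rmult_le_pos; [apply Cmod_ge_0|apply pow2_ge_0].
Qed.

Lemma taylor1_plus (S : UHP -> Prop) (K L : R) (f f' g g' : UHP -> C) :
  taylor1 S K f f' -> taylor1 S L g g' ->
  taylor1 S (K + L) (fun z => f z + g z) (fun z => f' z + g' z).
Proof.
intros [K0 Hf] [L0 Hg]; split; [lra|]; intros z Sz.
destruct (Hf z Sz) as (A & B & D), (Hg z Sz) as (A' & B' & D').
split; [eapply Rle_trans; [apply Cmod_triangle|lra]|].
split; [eapply Rle_trans; [apply Cmod_triangle|lra]|].
intros w Sw; specialize (D w Sw); specialize (D' w Sw).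
replace (f w + g w - (f z + g z) - (w - z) * (f' z + g' z)) with
  ((f w - f z - (w - z) * f' z) + (g w - g z - (w - z) * g' z)) by ring.
eapply Rle_trans; [apply Cmod_triangle|lra].
Qed.

(** The 4 counts K L for each of the two remainders and 2 K L for the cross term (w - z) f'(z) (g w
    - g z), as d + d^2 <= 2 d when the diameter is at most 1. The constant is explicit and
    proportional to K L because the Poincare series needs a bound for (c z + d)^-4 proportional to
    |c z0 + d|^-4. *)
Lemma taylor1_mult (S : UHP -> Prop) (K L : R) (f f' g g' : UHP -> C) :
  (forall z w, S z -> S w -> (Cmod (w - z) <= 1)) ->
  taylor1 S K f f' -> taylor1 S L g g' ->
  taylor1 S (4 * (K * L)) (fun z => f z * g z)
    (fun z => f' z * g z + f z * g' z).
Proof.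
intros Sd Hf Hg; assert (LIP := fun z w => taylor1_lipschitz S L g g' z w Hg).
destruct Hf as [K0 Hf], Hg as [L0 Hg].
assert (KL0 : 0 <= K * L) by (apply Rmult_le_pos; lra).
split; [lra|]; intros z Sz.
destruct (Hf z Sz) as (A & B & D), (Hg z Sz) as (A' & B' & D').
assert (M : forall a b : C, Cmod a <= K -> Cmod b <= L ->
  (Cmod (a * b) <= K * L)).
{ intros; rewrite Cmod_mult; apply Rmult_le_compat; auto using Cmod_ge_0. }
split; [apply Rle_trans with (1 := M _ _ A A'); lra|].
split.
{ eapply Rle_trans; [apply Cmod_triangle|].
  assert (M1 := M _ _ B A'); assert (M2 := M _ _ A B'); lra. }
intros w Sw; destruct (Hg w Sw) as (A'' & _); specialize (D w Sw); specialize (D' w Sw).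
specialize (LIP z w Sz Sw); specialize (Sd z w Sz Sw).
replace (f w * g w - f z * g z - (w - z) * (f' z * g z + f z * g' z)) with
  ((f w - f z - (w - z) * f' z) * g w + f z * (g w - g z - (w - z) * g' z)
   + (w - z) * (f' z * (g w - g z))) by ring.
set (d := Cmod (w - z)) in *.
assert (d0 : 0 <= d) by apply Cmod_ge_0.
assert (d2 : 0 <= d ^ 2) by apply pow2_ge_0.
eapply Rle_trans; [apply Cmod_triangle|].
eapply Rle_trans; [apply Rplus_le_compat_r, Cmod_triangle|].
rewrite !Cmod_mult; fold d.
assert (T1 : Cmod (f w - f z - (w - z) * f' z) * Cmod (g w) <= K * d ^ 2 * L)
  by (apply Rmult_le_compat; auto using Cmod_ge_0).
assert (T2 : Cmod (f z) * Cmod (g w - g z - (w - z) * g' z) <= K * (L * d ^ 2))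
  by (apply Rmult_le_compat; auto using Cmod_ge_0).
assert (T3 : Cmod (f' z) * Cmod (g w - g z) <= K * (L * (2 * d))).
{ apply Rmult_le_compat; auto using Cmod_ge_0.
  apply Rle_trans with (1 := LIP). apply Rmult_le_compat_l; [lra|nra]. }
assert (T4 : d * (Cmod (f' z) * Cmod (g w - g z)) <= d * (K * (L * (2 * d))))
  by (apply Rmult_le_compat_l; lra).
nra.
Qed.

Lemma taylor1_inv (S : UHP -> Prop) (K m : R) (f f' : UHP -> C) :
  (forall z w, S z -> S w -> (Cmod (w - z) <= 1)) ->
  0 < m -> (forall z, S z -> (m <= Cmod (f z))) ->
  taylor1 S K f f' ->
  exists L, taylor1 S L (fun z => / f z) (fun z => - f' z / (f z * f z)).
Proof.
intros Sd m0 Hm Hf; assert (LIP := fun z w => taylor1_lipschitz S K f f' z w Hf).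
destruct Hf as [K0 Hf].
set (i := (/ m)%R); assert (i0 : 0 < i) by now apply Rinv_0_lt_compat.
(* The summands bound 1/f, its derivative and the remainder, in this order; [i] is 1/m. *)
exists (i + K * i * i + (K * i * i + 4 * K * K * i * i * i))%R.
assert (P1 : 0 <= K * i * i) by (repeat apply Rmult_le_pos; lra).
assert (P2 : 0 <= 4 * K * K * i * i * i) by (repeat apply Rmult_le_pos; lra).
split; [lra|]; intros z Sz; destruct (Hf z Sz) as (A & B & D).
assert (NZ : forall z, S z -> f z <> 0)
  by (intros v Sv; apply Cmod_gt_0; specialize (Hm v Sv); lra).
assert (IV : forall z, S z -> (Cmod (/ f z) <= i)).
{ intros v Sv; rewrite Cmod_inv by auto; apply Rinv_le_contravar; auto. }
assert (V := IV z Sz).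
split; [lra|split].
{ replace (- f' z / (f z * f z)) with (- (f' z * / f z * / f z)) by (field; auto).
  rewrite Cmod_opp, !Cmod_mult.
  assert (Cmod (f' z) * Cmod (/ f z) * Cmod (/ f z) <= K * i * i); [|lra].
  repeat apply Rmult_le_compat; auto using Cmod_ge_0, Rmult_le_pos. }
intros w Sw; assert (V' := IV w Sw); specialize (D w Sw); specialize (LIP z w Sz Sw).
specialize (Sd z w Sz Sw).
replace (/ f w - / f z - (w - z) * (- f' z / (f z * f z))) with
  (- ((f w - f z - (w - z) * f' z) * / f w * / f z)
   + (w - z) * f' z * (f w - f z) * / f w * / f z * / f z)
  by (field; auto).
set (d := Cmod (w - z)) in *.
assert (d0 : 0 <= d) by apply Cmod_ge_0.
assert (d2 : 0 <= d ^ 2) by apply pow2_ge_0.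
eapply Rle_trans; [apply Cmod_triangle|].
rewrite !Cmod_opp, !Cmod_mult; fold d.
assert (T1 : Cmod (f w - f z - (w - z) * f' z) * Cmod (/ f w) * Cmod (/ f z)
  <= K * d ^ 2 * i * i)
  by (repeat apply Rmult_le_compat; auto using Cmod_ge_0, Rmult_le_pos).
assert (T3 : d * Cmod (f' z) * Cmod (f w - f z) * Cmod (/ f w) * Cmod (/ f z)
   * Cmod (/ f z) <= d * K * (K * (2 * d)) * i * i * i).
{ repeat apply Rmult_le_compat;
    repeat (apply Rmult_le_pos; auto using Cmod_ge_0);
    auto using Cmod_ge_0; try lra.
  apply Rle_trans with (1 := LIP). apply Rmult_le_compat_l; [lra|nra]. }
assert (0 <= i * d ^ 2) by (apply Rmult_le_pos; lra).
assert (0 <= K * i * i * d ^ 2) by (apply Rmult_le_pos; lra).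
assert (0 <= 4 * K * K * i * i * i * d ^ 2) by (apply Rmult_le_pos; lra).
nra.
Qed.

(** The first term of the exponent is the logarithm of the modulus of [qe s z], the second is |Re h|
    for h = i s (w - z), which enters through the remainder of the exponential. Kept together, they
    still yield decay when s > 0, as termwise differentiation of q-expansions requires. *)
Lemma taylor1_qe (S : UHP -> Prop) (s L : R) :
  (forall z w : UHP, S z -> S w ->
     (- (s * Im z) + Rabs (s * (Im w - Im z)) <= L)) ->
  taylor1 S ((1 + Rabs s + 4 * s ^ 2) * exp L) (fun z => qe s z)
    (fun z => RtoC s * Ci * qe s z).
Proof.
intros HL; assert (P := exp_pos L); assert (Q := Rabs_pos s).
assert (s2 : 0 <= s ^ 2) by apply pow2_ge_0.
split; [apply Rmult_le_pos; lra|]; intros z Sz.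
assert (A : Cmod (qe s z) <= exp L).
{ rewrite Cmod_qe; apply exp_le; specialize (HL z z Sz Sz).
  rewrite Rminus_diag, Rmult_0_r, Rabs_R0 in HL; lra. }
split; [nra|split].
{ rewrite !Cmod_mult, Cmod_R, Cmod_Ci.
  assert (Rabs s * Cmod (qe s z) <= Rabs s * exp L)
    by (apply Rmult_le_compat_l; lra).
  nra. }
intros w Sw; specialize (HL z w Sz Sw).
set (h := RtoC s * Ci * (w - z)).
assert (E : qe s w - qe s z - (w - z) * (RtoC s * Ci * qe s z)
  = qe s z * (Cexp h - 1 - h)).
{ replace (uhp_val w) with (uhp_val z + (w - z)) at 1 by ring.
  rewrite qe_add; unfold h; fold (qe s (w - z)); ring. }
rewrite E, Cmod_mult, Cmod_qe.
assert (B := Cexp_taylor1_bound h).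
assert (Rh : Rabs (Re h) = Rabs (s * (Im w - Im z))).
{ rewrite <- (Rabs_Ropp (Re h)); f_equal; unfold h.
  destruct w as [[] ?], z as [[] ?]; simpl; ring. }
assert (Ch : Cmod h = (Rabs s * Cmod (w - z))%R)
  by (unfold h; rewrite !Cmod_mult, Cmod_R, Cmod_Ci; ring).
rewrite Rh, Ch, Rpow_mult_distr in B.
replace (Rabs s ^ 2)%R with (s ^ 2)%R in B by (rewrite <- !Rsqr_pow2; apply Rsqr_abs).
set (d := Cmod (w - z)) in *.
assert (d2 : 0 <= d ^ 2) by apply pow2_ge_0.
eapply Rle_trans; [apply Rmult_le_compat_l; [left; apply exp_pos|exact B]|].
replace (exp (- (s * Im z)) * (4 * (s ^ 2 * d ^ 2) * exp (Rabs (s * (Im w - Im z)))))%R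
  with (4 * s ^ 2 * d ^ 2 * exp (- (s * Im z) + Rabs (s * (Im w - Im z))))%R
  by (rewrite exp_plus; ring).
assert (F := exp_le _ _ HL).
assert (0 <= 4 * s ^ 2 * d ^ 2) by nra.
eapply Rle_trans; [apply Rmult_le_compat_l; [assumption|exact F]|].
assert (0 <= (1 + Rabs s) * exp L * d ^ 2)
  by (apply Rmult_le_pos; [apply Rmult_le_pos; lra|assumption]).
nra.
Qed.

Definition near (z0 : UHP) (r : R) (z : UHP) : Prop := Cmod (z - z0) < r.

Lemma near_refl (z : UHP) (r : R) : 0 < r -> near z r z.
Proof.
intros r0; unfold near; replace (z - z) with (RtoC 0) by ring; now rewrite Cmod_0.
Qed.

Lemma near_diam (z0 z w : UHP) (r : R) :
  r <= 1 / 2 -> near z0 r z -> near z0 r w -> Cmod (w - z) <= 1.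
Proof.
unfold near; intros hr hz hw.
replace (w - z) with ((w - z0) + (z0 - z)) by ring.
eapply Rle_trans; [apply Cmod_triangle|].
rewrite (Cmod_minus_sym z0 z); lra.
Qed.

Definition C11at (f f' : UHP -> C) (z0 : UHP) : Prop :=
  exists r K, 0 < r /\ taylor1 (near z0 r) K f f'.

Definition C11 (f : UHP -> C) : Prop :=
  exists f', forall z0, C11at f f' z0.

Lemma C11at_pair (f f' g g' : UHP -> C) (z0 : UHP) (m : R) :
  0 < m -> C11at f f' z0 -> C11at g g' z0 ->
  exists r K L, 0 < r <= m /\ taylor1 (near z0 r) K f f' /\
    taylor1 (near z0 r) L g g'.
Proof.
intros m0 (r & K & r0 & H) (s & L & s0 & G).
exists (Rmin (Rmin r s) m), K, L.
assert (A := Rmin_l r s); assert (B := Rmin_r r s).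
assert (D := Rmin_l (Rmin r s) m); assert (E := Rmin_r (Rmin r s) m).
split; [split; [repeat apply Rmin_glb_lt; lra|lra]|].
split; [apply (taylor1_mono (near z0 r) _ K) | apply (taylor1_mono (near z0 s) _ L)];
  try assumption; try lra; unfold near; intros; lra.
Qed.

Lemma C11at_plus (f f' g g' : UHP -> C) (z0 : UHP) :
  C11at f f' z0 -> C11at g g' z0 ->
  C11at (fun z => f z + g z) (fun z => f' z + g' z) z0.
Proof.
intros A B; destruct (C11at_pair f f' g g' z0 1 Rlt_0_1 A B) as (r & K & L & R0 & H & G).
exists r, (K + L)%R; split; [lra|now apply taylor1_plus].
Qed.

Lemma C11at_mult (f f' g g' : UHP -> C) (z0 : UHP) :
  C11at f f' z0 -> C11at g g' z0 ->
  C11at (fun z => f z * g z) (fun z => f' z * g z + f z * g' z) z0.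
Proof.
intros A B; destruct (C11at_pair f f' g g' z0 (1/2) ltac:(lra) A B)
  as (r & K & L & R0 & H & G).
exists r, (4 * (K * L))%R; split; [lra|apply taylor1_mult; auto].
intros z w; apply near_diam; lra.
Qed.

Lemma C11at_const (c : C) (z0 : UHP) : C11at (fun _ => c) (fun _ => 0) z0.
Proof. exists 1%R, (Cmod c); split; [lra|apply taylor1_const]. Qed.

Lemma near_Im (z0 z : UHP) (r : R) : near z0 r z -> Rabs (Im z - Im z0) < r.
Proof.
intros H; apply Rle_lt_trans with (2 := H).
apply (Im_le_Cmod (z - z0)).
Qed.

Lemma C11at_continuous (f f' : UHP -> C) (z0 : UHP) (eps : R) :
  C11at f f' z0 -> 0 < eps ->
  exists r, 0 < r /\ forall z, near z0 r z -> Cmod (f z - f z0) < eps.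
Proof.
intros (r & K & r0 & H) e0.
set (t := (eps / (2 * (K + 1)))%R).
assert (K0 := proj1 H).
assert (t0 : 0 < t) by (apply Rdiv_lt_0_compat; lra).
exists (Rmin (Rmin r t) 1).
assert (A := Rmin_l r t); assert (B := Rmin_r r t).
assert (D := Rmin_l (Rmin r t) 1); assert (E := Rmin_r (Rmin r t) 1).
split; [repeat apply Rmin_glb_lt; lra|].
unfold near; intros z Hz.
assert (C0 : near z0 r z0) by now apply near_refl.
assert (L := taylor1_lipschitz _ _ _ _ z0 z H C0 ltac:(unfold near; lra)).
set (d := Cmod (z - z0)) in *.
assert (d0 : 0 <= d) by apply Cmod_ge_0.
apply Rle_lt_trans with (1 := L).
apply Rle_lt_trans with ((K + 1) * (2 * d))%R.
- apply Rmult_le_compat; nra.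
- replace eps with ((K + 1) * (2 * t))%R by (unfold t; field; lra).
  apply Rmult_lt_compat_l; lra.
Qed.

Lemma C11at_inv (f f' : UHP -> C) (z0 : UHP) :
  f z0 <> 0 -> C11at f f' z0 ->
  C11at (fun z => / f z) (fun z => - f' z / (f z * f z)) z0.
Proof.
intros nz H.
assert (p := proj1 (Cmod_gt_0 _) nz).
destruct (C11at_continuous f f' z0 (Cmod (f z0) / 2) H ltac:(lra)) as (s & s0 & Hs).
destruct H as (r & K & r0 & H).
set (t := Rmin (Rmin r s) (1/2)).
assert (A := Rmin_l r s); assert (B := Rmin_r r s).
assert (D := Rmin_l (Rmin r s) (1/2)); assert (E := Rmin_r (Rmin r s) (1/2)).
destruct (taylor1_inv (near z0 t) K (Cmod (f z0) / 2) f f') as [L HL].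
- intros z w; apply near_diam; exact E.
- lra.
- unfold near, t; intros z Hz; assert (N : near z0 s z) by (unfold near; lra).
  specialize (Hs z N); rewrite Cmod_minus_sym in Hs.
  assert (T := Cmod_triangle_rev (f z0) (f z0 - f z)).
  replace (f z0 - (f z0 - f z)) with (f z) in T by ring; lra.
- apply (taylor1_mono (near z0 r) _ K); try assumption; try lra.
  unfold near, t; intros; lra.
- exists t, L; split; [unfold t; apply Rmin_glb_lt; [apply Rmin_glb_lt|]; lra|assumption].
Qed.

Lemma C11at_qe (s : R) (z0 : UHP) :
  C11at (fun z => qe s z) (fun z => RtoC s * Ci * qe s z) z0.
Proof.
eexists 1%R, _; split; [lra|].
apply (taylor1_qe _ s (- (s * Im z0) + 4 * Rabs s)).
intros z w hz hw; apply near_Im in hz, hw.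
replace (- (s * Im z))%R with (- (s * Im z0) + - (s * (Im z - Im z0)))%R by ring.
replace (Im w - Im z)%R with ((Im w - Im z0) + - (Im z - Im z0))%R by ring.
assert (- (s * (Im z - Im z0)) <= Rabs s).
{ apply Rle_trans with (1 := Rle_abs _); rewrite Rabs_Ropp, Rabs_mult.
  assert (P := Rabs_pos s); nra. }
assert (Rabs (s * (Im w - Im z0 + - (Im z - Im z0))) <= Rabs s * 2); [|assert (P := Rabs_pos s); lra].
rewrite Rabs_mult; apply Rmult_le_compat_l; [apply Rabs_pos|].
eapply Rle_trans; [apply Rabs_triang|]; rewrite Rabs_Ropp; lra.
Qed.

Lemma C11_plus (f g : UHP -> C) : C11 f -> C11 g -> C11 (fadd f g).
Proof.
intros [f' F] [g' G]; eexists; intros z0; apply C11at_plus; auto.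
Qed.

Lemma C11_mult (f g : UHP -> C) : C11 f -> C11 g -> C11 (fmul f g).
Proof.
intros [f' F] [g' G]; eexists; intros z0; apply C11at_mult; auto.
Qed.

Lemma C11_const (c : C) : C11 (fun _ => c).
Proof. eexists; intros z0; apply C11at_const. Qed.

Lemma C11_div (f g : UHP -> C) :
  (forall z, g z <> 0) -> C11 f -> C11 g -> C11 (fun z => f z / g z).
Proof.
intros nz [f' F] [g' G]; eexists; intros z0; unfold Cdiv.
apply C11at_mult; [apply F|apply C11at_inv; auto].
Qed.

End Taylor.

(** * Limits of complex functions along filters *)

Section FilterLimits.
Local Open Scope R_scope.
Local Open Scope C_scope.

(** One notion of limit serves the filters [eventually] (series), [nearby] (points of the
    half-plane), [Finf] (the cusp oo) and [finsets] (unordered sums). *)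
Definition climit {J : Type} (F : (J -> Prop) -> Prop) (u : J -> C) (l : C) : Prop :=
  forall eps, 0 < eps -> F (fun i => (Cmod (u i - l) < eps)).

Lemma climit_ext_ev {J : Type} (F : (J -> Prop) -> Prop) {FF : Filter F}
  (u v : J -> C) (l : C) :
  F (fun i => u i = v i) -> climit F u l -> climit F v l.
Proof.
intros E H eps e0; generalize (filter_and _ _ E (H eps e0)); apply filter_imp.
intros i [<- A]; exact A.
Qed.

Lemma climit_ext {J : Type} (F : (J -> Prop) -> Prop) {FF : Filter F}
  (u v : J -> C) (l : C) :
  (forall i, u i = v i) -> climit F u l -> climit F v l.
Proof. intros E; apply climit_ext_ev; [exact FF|]; now apply filter_forall. Qed.

Lemma climit_const {J : Type} (F : (J -> Prop) -> Prop) {FF : Filter F} (c : C) :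
  climit F (fun _ => c) c.
Proof.
intros eps e0; apply filter_forall; intros _.
replace (c - c) with (RtoC 0) by ring; now rewrite Cmod_0.
Qed.

Lemma climit_plus {J : Type} (F : (J -> Prop) -> Prop) {FF : Filter F}
  (u v : J -> C) (l m : C) :
  climit F u l -> climit F v m -> climit F (fun i => u i + v i) (l + m).
Proof.
intros A B eps e0.
assert (e2 : 0 < eps / 2) by lra.
generalize (filter_and _ _ (A _ e2) (B _ e2)).
apply filter_imp; intros i [P Q].
replace (u i + v i - (l + m)) with ((u i - l) + (v i - m)) by ring.
eapply Rle_lt_trans; [apply Cmod_triangle|lra].
Qed.

Lemma climit_mult {J : Type} (F : (J -> Prop) -> Prop) {FF : Filter F}
  (u v : J -> C) (l m : C) :
  climit F u l -> climit F v m -> climit F (fun i => u i * v i) (l * m).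
Proof.
intros A B eps e0.
set (M := (1 + Cmod l + Cmod m)%R).
assert (A0 := Cmod_ge_0 l); assert (B0 := Cmod_ge_0 m).
set (t := Rmin 1 (eps / (2 * M))).
assert (t1 := Rmin_l 1 (eps / (2 * M))); assert (t2 := Rmin_r 1 (eps / (2 * M))).
assert (t0 : 0 < t)
  by (apply Rmin_glb_lt; [lra|apply Rdiv_lt_0_compat; unfold M; lra]).
fold t in t1, t2.
generalize (filter_and _ _ (A t t0) (B t t0)); apply filter_imp; intros i [P Q].
replace (u i * v i - l * m) with
  ((u i - l) * (v i - m) + (l * (v i - m) + (u i - l) * m)) by ring.
eapply Rle_lt_trans; [apply Cmod_triangle|].
eapply Rle_lt_trans; [apply Rplus_le_compat_l, Cmod_triangle|].
rewrite !Cmod_mult.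
assert (P' := Cmod_ge_0 (u i - l)); assert (Q' := Cmod_ge_0 (v i - m)).
assert (Ht : t * (2 * M) <= eps).
{ replace eps with (eps / (2 * M) * (2 * M))%R at 1 by (field; unfold M; lra).
  apply Rmult_le_compat_r; [unfold M; lra|exact t2]. }
unfold M in Ht; nra.
Qed.

Lemma climit_scal {J : Type} (F : (J -> Prop) -> Prop) {FF : Filter F}
  (c : C) (u : J -> C) (l : C) :
  climit F u l -> climit F (fun i => c * u i) (c * l).
Proof. intros H; apply climit_mult; auto using climit_const. Qed.

Lemma climit_minus {J : Type} (F : (J -> Prop) -> Prop) {FF : Filter F}
  (u v : J -> C) (l m : C) :
  climit F u l -> climit F v m -> climit F (fun i => u i - v i) (l - m).
Proof.
intros A B; replace (l - m) with (l + (- (1)) * m) by ring.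
apply climit_ext with (fun i => u i + (- (1)) * v i); [exact FF|intros; ring|].
apply climit_plus; auto using climit_scal.
Qed.

Lemma climit_inv {J : Type} (F : (J -> Prop) -> Prop) {FF : Filter F}
  (u : J -> C) (l : C) :
  l <> 0 -> climit F u l -> climit F (fun i => / u i) (/ l).
Proof.
intros nz A eps e0.
assert (p := proj1 (Cmod_gt_0 _) nz).
set (t := (eps * (Cmod l * Cmod l) / 2)%R).
assert (t0 : 0 < t).
{ unfold t; apply Rdiv_lt_0_compat; [|lra].
  apply Rmult_lt_0_compat; [lra|]; apply Rmult_lt_0_compat; lra. }
assert (p2 : 0 < Cmod l / 2) by lra.
generalize (filter_and _ _ (A t t0) (A _ p2)).
apply filter_imp; intros i [P Q].
assert (L : Cmod l / 2 < Cmod (u i)).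
{ assert (T := Cmod_triangle_rev l (l - u i)).
  replace (l - (l - u i)) with (u i) in T by ring.
  rewrite Cmod_minus_sym in Q; lra. }
assert (nzu : u i <> 0) by (apply Cmod_gt_0; lra).
replace (/ u i - / l) with (- (u i - l) * / u i * / l) by (field; auto).
rewrite !Cmod_mult, Cmod_opp, !Cmod_inv by auto.
apply Rmult_lt_reg_r with (Cmod (u i) * Cmod l)%R;
  [apply Rmult_lt_0_compat; lra|].
replace (Cmod (u i - l) * / Cmod (u i) * / Cmod l * (Cmod (u i) * Cmod l))%R
  with (Cmod (u i - l)) by (field; lra).
apply Rlt_le_trans with (1 := P); unfold t.
assert (Cmod l * (Cmod l / 2) <= Cmod l * Cmod (u i))
  by (apply Rmult_le_compat_l; lra).
nra.
Qed.

Lemma climit_div {J : Type} (F : (J -> Prop) -> Prop) {FF : Filter F}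
  (u v : J -> C) (l m : C) :
  m <> 0 -> climit F u l -> climit F v m -> climit F (fun i => u i / v i) (l / m).
Proof. intros nz A B; apply climit_mult; auto; now apply climit_inv. Qed.

Lemma climit_pow {J : Type} (F : (J -> Prop) -> Prop) {FF : Filter F}
  (u : J -> C) (l : C) (n : nat) :
  climit F u l -> climit F (fun i => u i ^ n) (l ^ n).
Proof.
intros A; induction n as [|n IH]; simpl; [now apply climit_const|].
now apply climit_mult.
Qed.

Lemma climit_le {J : Type} (F : (J -> Prop) -> Prop) {FF : ProperFilter F}
  (u : J -> C) (l c : C) (M : R) :
  climit F u l -> F (fun i => (Cmod (u i - c) <= M)) -> Cmod (l - c) <= M.
Proof.
intros A B; apply Rnot_lt_le; intros L.
assert (p : 0 < Cmod (l - c) - M) by lra.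
destruct (filter_ex _ (filter_and _ _ B (A _ p))) as [i [P Q]].
assert (T := Cmod_triangle (l - u i) (u i - c)).
replace (l - u i + (u i - c)) with (l - c) in T by ring.
rewrite Cmod_minus_sym in Q; lra.
Qed.

Lemma climit_unique {J : Type} (F : (J -> Prop) -> Prop) {FF : ProperFilter F}
  (u : J -> C) (l m : C) : climit F u l -> climit F u m -> l = m.
Proof.
intros A B.
assert (H : Cmod (l - m) <= 0).
{ apply Rnot_lt_le; intros L.
  assert (X := climit_le F u l m (Cmod (l - m) / 2) A); lapply X; [lra|].
  assert (p : 0 < Cmod (l - m) / 2) by lra.
  generalize (B _ p); apply filter_imp; intros; lra. }
assert (l - m = 0) as E by (apply Cmod_eq_0; assert (P := Cmod_ge_0 (l - m)); lra).
replace l with (l - m + m) by ring; rewrite E; ring.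
Qed.

Lemma climit_filterlim {J : Type} (F : (J -> Prop) -> Prop) {FF : Filter F}
  (u : J -> C) (l : C) :
  climit F u l <-> filterlim u F (locally (T := C_NormedModule) l).
Proof.
split.
- intros H; apply (filterlim_locally_ball_norm (U := C_NormedModule)); intros eps.
  apply (H eps (cond_pos eps)).
- intros H eps e0.
  exact (proj1 (filterlim_locally_ball_norm (U := C_NormedModule) _ _) H
    (mkposreal _ e0)).
Qed.

End FilterLimits.

(** * Integrals along horizontal segments *)

Section Lines.
Local Open Scope R_scope.
Local Open Scope C_scope.

Lemma extend_val (f : UHP -> C) (tau : UHP) : extend f tau = f tau.
Proof.
unfold extend; destruct tau as [z p]; simpl.
destruct (Rlt_dec 0 (Im z)) as [q|q]; [|contradiction].
now rewrite (proof_irrelevance _ q p).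
Qed.

Definition upt (x y : R) (p : 0 < y) : UHP := mkUHP (x, y) p.

Definition at_xy (f : UHP -> C) (x y : R) : C := extend f (x, y).

Lemma at_xy_upt (f : UHP -> C) (x y : R) (p : 0 < y) :
  at_xy f x y = f (upt x y p).
Proof. apply (extend_val f (upt x y p)). Qed.

Lemma upt_dist (x y x' y' : R) (p : 0 < y) (p' : 0 < y') :
  Cmod (upt x' y' p' - upt x y p) <= Rabs (x' - x) + Rabs (y' - y).
Proof. apply (Cmod_le_abs ((x', y') - (x, y))). Qed.

Definition nearby (z0 : UHP) (P : UHP -> Prop) : Prop :=
  exists r, 0 < r /\ forall z, near z0 r z -> P z.

Global Instance nearby_filter (z0 : UHP) : Filter (nearby z0).
Proof.
split.
- exists 1%R; split; [lra|trivial].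
- intros P Q (r & r0 & HP) (s & s0 & HQ); exists (Rmin r s).
  assert (A := Rmin_l r s); assert (B := Rmin_r r s).
  split; [apply Rmin_glb_lt; lra|]; unfold near in *; intros z Hz.
  split; [apply HP|apply HQ]; lra.
- intros P Q PQ (r & r0 & HP); exists r; auto.
Qed.

Definition Ccont (f : UHP -> C) (z0 : UHP) : Prop := climit (nearby z0) f (f z0).

Lemma Ccont_mult (f g : UHP -> C) (z0 : UHP) :
  Ccont f z0 -> Ccont g z0 -> Ccont (fun z => f z * g z) z0.
Proof. intros F G; exact (climit_mult _ _ _ _ _ F G). Qed.

Lemma Ccont_plus (f g : UHP -> C) (z0 : UHP) :
  Ccont f z0 -> Ccont g z0 -> Ccont (fun z => f z + g z) z0.
Proof. intros F G; exact (climit_plus _ _ _ _ _ F G). Qed.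

Lemma Ccont_const (c : C) (z0 : UHP) : Ccont (fun _ => c) z0.
Proof. exact (climit_const _ c). Qed.

Lemma C11at_Ccont (f f' : UHP -> C) (z0 : UHP) : C11at f f' z0 -> Ccont f z0.
Proof. intros H eps e0; now apply C11at_continuous with f'. Qed.

(** Adding the expansion of f at z0 evaluated at z to the expansion at z evaluated at z0 cancels the
    values of f and leaves |z - z0| |f'(z) - f'(z0)| <= 2 K |z - z0|^2: the derivative is
    Lipschitz. *)
Lemma C11at_Ccont_deriv (f f' : UHP -> C) (z0 : UHP) : C11at f f' z0 -> Ccont f' z0.
Proof.
intros (r & K & r0 & [K0 H]) eps e0.
set (t := (eps / (2 * (K + 1)))%R).
assert (t0 : 0 < t) by (apply Rdiv_lt_0_compat; lra).
exists (Rmin r t); split; [apply Rmin_glb_lt; lra|].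
unfold near; intros z Hz.
assert (A := Rmin_l r t); assert (B := Rmin_r r t).
assert (N0 : near z0 r z0) by now apply near_refl.
assert (N : near z0 r z) by (unfold near; lra).
destruct (classic (uhp_val z = uhp_val z0)) as [E|E].
{ assert (z = z0) as ->.
  { destruct z, z0; simpl in *; subst; f_equal; apply proof_irrelevance. }
  replace (f' z0 - f' z0) with (RtoC 0) by ring; rewrite Cmod_0; lra. }
assert (D : 0 < Cmod (z - z0)).
{ apply Cmod_gt_0; intros Z; apply E.
  replace (uhp_val z) with (z - z0 + z0) by ring; rewrite Z; ring. }
destruct (H z N) as (_ & _ & H1); specialize (H1 z0 N0).
destruct (H z0 N0) as (_ & _ & H2); specialize (H2 z N).
rewrite (Cmod_minus_sym z0 z) in H1.
assert (L : Cmod (z - z0) * Cmod (f' z - f' z0) <= 2 * K * Cmod (z - z0) ^ 2).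
{ rewrite <- Cmod_mult.
  replace ((z - z0) * (f' z - f' z0)) with
    ((f z - f z0 - (z - z0) * f' z0) + (f z0 - f z - (z0 - z) * f' z)) by ring.
  eapply Rle_trans; [apply Cmod_triangle|lra]. }
assert (Cmod (f' z - f' z0) <= 2 * K * Cmod (z - z0)).
{ apply Rmult_le_reg_l with (1 := D); eapply Rle_trans; [exact L|].
  apply Req_le; ring. }
apply Rle_lt_trans with (2 * (K + 1) * Cmod (z - z0))%R.
- assert (P := Cmod_ge_0 (z - z0)); nra.
- replace eps with (2 * (K + 1) * t)%R by (unfold t; field; lra).
  apply Rmult_lt_compat_l; lra.
Qed.

Lemma Ccont_2d (f : UHP -> C) (x y : R) (p : 0 < y) :
  Ccont f (upt x y p) ->
  continuity_2d_pt (fun x y => Re (at_xy f x y)) x y.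
Proof.
intros H eps; destruct (H eps (cond_pos eps)) as (r & r0 & Hr).
assert (d0 : 0 < Rmin (r / 2) y) by (apply Rmin_glb_lt; lra).
exists (mkposreal _ d0); simpl; intros u v Hu Hv.
assert (A := Rmin_l (r / 2) y); assert (B := Rmin_r (r / 2) y).
assert (p' : 0 < v) by (apply Rabs_def2 in Hv; lra).
rewrite (at_xy_upt f u v p'), (at_xy_upt f x y p), <- Re_minus.
eapply Rle_lt_trans; [apply re_le_Cmod|]; apply Hr.
unfold near; eapply Rle_lt_trans; [apply upt_dist|lra].
Qed.

Lemma continuity_2d_fst (u : R -> R -> R) (x y : R) :
  continuity_2d_pt u x y -> continuous (fun x => u x y) x.
Proof.
intros H; apply continuity_pt_filterlim; intros eps e0.
destruct (H (mkposreal _ e0)) as [d Hd]; exists d; split; [apply d|].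
simpl; unfold R_dist; intros t [_ Ht]; apply Hd; [exact Ht|].
rewrite Rminus_diag, Rabs_R0; apply d.
Qed.

Lemma continuity_2d_swap (u : R -> R -> R) (x y : R) :
  continuity_2d_pt u x y -> continuity_2d_pt (fun y x => u x y) y x.
Proof. intros H eps; destruct (H eps) as [d Hd]; exists d; auto. Qed.

Lemma quadratic_is_derive (u : R -> R) (x l r K : R) :
  0 < r -> 0 <= K ->
  (forall t, (Rabs (t - x) < r) ->
     (Rabs (u t - u x - (t - x) * l) <= K * (t - x) ^ 2)) ->
  is_derive u x l.
Proof.
intros r0 K0 H; apply is_derive_Reals; intros eps e0.
assert (t0 : 0 < eps / (K + 1)) by (apply Rdiv_lt_0_compat; lra).
assert (d0 : 0 < Rmin r (eps / (K + 1))) by (apply Rmin_glb_lt; lra).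
exists (mkposreal _ d0); simpl; intros t tn Ht.
assert (A := Rmin_l r (eps / (K + 1))); assert (B := Rmin_r r (eps / (K + 1))).
specialize (H (x + t)%R); replace (x + t - x)%R with t in H by ring.
specialize (H ltac:(lra)).
assert (P := Rabs_pos_lt _ tn).
apply Rmult_lt_reg_r with (1 := P); rewrite <- Rabs_mult.
replace (((u (x + t) - u x) / t - l) * t)%R with (u (x + t) - u x - t * l)%R
  by (field; exact tn).
eapply Rle_lt_trans; [exact H|]; rewrite <- (pow2_abs t).
assert ((K + 1) * Rabs t < eps).
{ apply Rlt_le_trans with ((K + 1) * (eps / (K + 1)))%R; [|apply Req_le; field; lra].
  apply Rmult_lt_compat_l; lra. }
nra.
Qed.

Lemma C11at_upt (f f' : UHP -> C) (x y : R) (p : 0 < y) :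
  C11at f f' (upt x y p) ->
  exists r K, 0 < r <= y /\ 0 <= K /\
    forall u v, (Rabs (u - x) < r) -> Rabs (v - y) < r ->
    (Cmod (at_xy f u v - at_xy f x y - (u - x, v - y)%R * at_xy f' x y) <=
       K * Cmod (u - x, v - y)%R ^ 2).
Proof.
intros (r & K & r0 & [K0 H]).
exists (Rmin (r / 2) y), K; split; [split; [apply Rmin_glb_lt; lra|apply Rmin_r]|].
split; [exact K0|]; intros u v Hu Hv.
assert (A := Rmin_l (r / 2) y); assert (B := Rmin_r (r / 2) y).
assert (p' : 0 < v) by (apply Rabs_def2 in Hv; lra).
rewrite (at_xy_upt f u v p'), (at_xy_upt f x y p), (at_xy_upt f' x y p).
destruct (H (upt x y p)) as (_ & _ & E).
- unfold near; replace (upt x y p - upt x y p) with (RtoC 0) by ring.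
  rewrite Cmod_0; lra.
- apply (E (upt u v p')).
  unfold near; eapply Rle_lt_trans; [apply upt_dist|lra].
Qed.

Lemma C11at_derive_x (f f' : UHP -> C) (x y : R) (p : 0 < y) :
  C11at f f' (upt x y p) ->
  is_derive (fun x => Re (at_xy f x y)) x (Re (at_xy f' x y)).
Proof.
intros H; destruct (C11at_upt _ _ _ _ _ H) as (r & K & r0 & K0 & E).
apply (quadratic_is_derive _ x _ r K); [lra|exact K0|].
intros t Ht; specialize (E t y Ht); rewrite Rminus_diag, Rabs_R0 in E.
specialize (E (proj1 r0)).
replace (Re (at_xy f t y) - Re (at_xy f x y) - (t - x) * Re (at_xy f' x y))%R with
  (Re (at_xy f t y - at_xy f x y - ((t - x)%R, 0%R) * at_xy f' x y)).
- eapply Rle_trans; [apply re_le_Cmod|]; eapply Rle_trans; [exact E|].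
  apply Req_le; rewrite Cmod2_alt; simpl; ring.
- unfold Re, Im; simpl; ring.
Qed.

(** Cauchy-Riemann: df/dy = i f', whose real part is - Im f'. *)
Lemma C11at_derive_y (f f' : UHP -> C) (x y : R) (p : 0 < y) :
  C11at f f' (upt x y p) ->
  is_derive (fun y => Re (at_xy f x y)) y (- Im (at_xy f' x y))%R.
Proof.
intros H; destruct (C11at_upt _ _ _ _ _ H) as (r & K & r0 & K0 & E).
apply (quadratic_is_derive _ y _ r K); [lra|exact K0|].
intros t Ht; specialize (E x t); rewrite Rminus_diag, Rabs_R0 in E.
specialize (E (proj1 r0) Ht).
replace (Re (at_xy f x t) - Re (at_xy f x y) - (t - y) * - Im (at_xy f' x y))%R with
  (Re (at_xy f x t - at_xy f x y - (0%R, (t - y)%R) * at_xy f' x y)).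
- eapply Rle_trans; [apply re_le_Cmod|]; eapply Rle_trans; [exact E|].
  apply Req_le; rewrite Cmod2_alt; simpl; ring.
- unfold Re, Im; simpl; ring.
Qed.

(** As Re (- i f) = Im f, rotation by - i transfers the statements on real parts to imaginary
    parts. *)
Lemma C11at_rotate (f f' : UHP -> C) (z0 : UHP) :
  C11at f f' z0 -> C11at (fun z => - Ci * f z) (fun z => - Ci * f' z) z0.
Proof.
intros H; destruct (C11at_mult _ _ _ _ z0 (C11at_const (- Ci) z0) H) as (r & K & r0 & T).
exists r, K; split; [exact r0|]; revert T; apply taylor1_ext; intros; ring.
Qed.

Lemma Ccont_rotate (f : UHP -> C) (z0 : UHP) :
  Ccont f z0 -> Ccont (fun z => - Ci * f z) z0.
Proof. intros H; apply Ccont_mult; [apply Ccont_const|exact H]. Qed.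

Lemma at_xy_rotate (f : UHP -> C) (x y : R) :
  Re (at_xy (fun z => - Ci * f z) x y) = Im (at_xy f x y).
Proof.
unfold at_xy, extend; simpl; destruct (Rlt_dec 0 y); unfold Re, Im; simpl; ring.
Qed.

Definition lineint (f : UHP -> C) (a b y : R) : C :=
  (RInt (fun x => Re (at_xy f x y)) a b, RInt (fun x => Im (at_xy f x y)) a b).

Lemma Ccont_ex_RInt (f : UHP -> C) (a b y : R) (p : 0 < y) :
  (forall x, Rmin a b <= x <= Rmax a b -> Ccont f (upt x y p)) ->
  ex_RInt (fun x => Re (at_xy f x y)) a b.
Proof.
intros H; apply (ex_RInt_continuous (V := R_CompleteNormedModule)).
intros x Hx; apply continuity_2d_fst with (u := fun x y => Re (at_xy f x y)).
apply Ccont_2d with p; auto.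
Qed.

Lemma RInt_derive_periodic (f f' : UHP -> C) (a b y : R) (p : 0 < y) :
  (forall x, C11at f f' (upt x y p)) ->
  RInt (fun x => Re (at_xy f' x y)) a b = (Re (at_xy f b y) - Re (at_xy f a y))%R.
Proof.
intros H; apply is_RInt_unique.
apply (is_RInt_derive (V := R_CompleteNormedModule) (fun x => Re (at_xy f x y))).
- intros x _; apply C11at_derive_x with p; apply H.
- intros x _; apply continuity_2d_fst with (u := fun x y => Re (at_xy f' x y)).
  apply Ccont_2d with p; apply C11at_Ccont_deriv with f; apply H.
Qed.

(** By Cauchy-Riemann the y-derivative of the integral of Re f is minus the integral of Im f', that
    is - (Im f(b) - Im f(a)), which vanishes by periodicity. This takes the place of Cauchy's
    theorem on a rectangle. *)
Lemma Re_lineint_derive (f f' : UHP -> C) (a b y : R) :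
  0 < y ->
  (exists d, 0 < d /\
     forall v x (p : 0 < v), (Rabs (v - y) < d) -> C11at f f' (upt x v p)) ->
  (forall v, 0 < v -> at_xy f b v = at_xy f a v) ->
  is_derive (fun y => RInt (fun x => Re (at_xy f x y)) a b) y 0%R.
Proof.
intros p (d & d0 & H) per.
assert (e0 : 0 < Rmin d y) by (apply Rmin_glb_lt; lra).
assert (LOC : forall P : R -> Prop,
  (forall v (q : 0 < v), (Rabs (v - y) < d) -> P v) -> locally y P).
{ intros P HP; exists (mkposreal _ e0); simpl; intros v Hv.
  change (Rabs (v - y) < Rmin d y) in Hv.
  assert (A := Rmin_l d y); assert (B := Rmin_r d y).
  apply HP; [apply Rabs_def2 in Hv; lra|lra]. }
assert (D : forall v x (q : 0 < v), (Rabs (v - y) < d) ->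
  is_derive (fun y => Re (at_xy f x y)) v (- Im (at_xy f' x v))%R).
{ intros v x q Hv; apply C11at_derive_y with q; auto. }
assert (Hy : Rabs (y - y) < d) by (rewrite Rminus_diag, Rabs_R0; lra).
replace 0%R with
  (RInt (fun t => Derive (fun u => Re (at_xy f t u)) y) a b).
- apply (is_derive_RInt_param (fun y x => Re (at_xy f x y)) a b y).
  + apply LOC; intros v q Hv t _; eexists; apply (D v t q Hv).
  + intros t _.
    apply continuity_2d_pt_ext_loc with (fun v x => - Im (at_xy f' x v))%R.
    * exists (mkposreal _ e0); simpl; intros v x Hv _.
      assert (A := Rmin_l d y); assert (B := Rmin_r d y).
      assert (q : 0 < v) by (apply Rabs_def2 in Hv; lra).
      symmetry; apply is_derive_unique, D; [exact q|lra].
    * apply continuity_2d_pt_opp.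
      apply (continuity_2d_swap (fun x v => Im (at_xy f' x v))).
      apply continuity_2d_pt_ext with
        (fun x v => Re (at_xy (fun z => - Ci * f' z) x v)).
      { intros; apply at_xy_rotate. }
      apply Ccont_2d with p, Ccont_rotate, C11at_Ccont_deriv with f; auto.
  + apply LOC; intros v q Hv; apply Ccont_ex_RInt with q.
    intros; apply C11at_Ccont with f'; auto.
- rewrite (RInt_ext _ (fun x => - Re (at_xy (fun z => - Ci * f' z)%C x y))%R).
  + rewrite (RInt_opp (V := R_CompleteNormedModule)
      (fun x => Re (at_xy (fun z => - Ci * f' z) x y))).
    * rewrite (RInt_derive_periodic (fun z => - Ci * f z) _ a b y p)
        by (intros; apply C11at_rotate; auto).
      rewrite !at_xy_rotate, per by exact p.
      change (- (Im (at_xy f a y) - Im (at_xy f a y)) = 0)%R; ring.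
    * apply Ccont_ex_RInt with p; intros.
      apply Ccont_rotate, C11at_Ccont_deriv with f; auto.
  + intros x _; rewrite at_xy_rotate; apply is_derive_unique, D; auto.
Qed.

Lemma RInt_abs_bound (u : R -> R) (a b M : R) :
  a <= b -> ex_RInt u a b -> (forall x, a <= x <= b -> (Rabs (u x) <= M)) ->
  Rabs (RInt u a b) <= (b - a) * M.
Proof. intros; apply abs_RInt_le_const; auto. Qed.

(* The horizontal line through a removable singularity is crossed by
   continuity alone. *)
Lemma Re_lineint_const (f f' : UHP -> C) (a b yw : R) (pw : 0 < yw) :
  a <= b ->
  (forall tau : UHP, Im tau <> yw -> C11at f f' tau) ->
  (forall x, a <= x <= b -> Ccont f (upt x yw pw)) ->
  (forall v, 0 < v -> at_xy f b v = at_xy f a v) ->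
  forall y1 y2, 0 < y1 -> 0 < y2 ->
  RInt (fun x => Re (at_xy f x y1)) a b = RInt (fun x => Re (at_xy f x y2)) a b.
Proof.
intros ab H Hw per.
set (I := fun y => RInt (fun x => Re (at_xy f x y)) a b).
assert (DER : forall y, 0 < y -> y <> yw -> is_derive I y 0%R).
{ intros y p ne; apply Re_lineint_derive with f'; auto.
  exists (Rabs (y - yw)); split; [apply Rabs_pos_lt; lra|].
  intros v x q Hv; apply H; simpl; intros ->.
  rewrite (Rabs_minus_sym yw y) in Hv; lra. }
assert (SIDE : forall y1 y2, 0 < y1 < y2 -> y2 < yw \/ yw < y1 -> I y1 = I y2).
{ intros y1 y2 h1 h2; apply (eq_is_derive (V := R_NormedModule) I y1 y2); [|lra].
  intros t Ht; apply DER; lra. }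
assert (EX : forall y, 0 < y -> ex_RInt (fun x => Re (at_xy f x y)) a b).
{ intros y p; apply Ccont_ex_RInt with p; rewrite Rmin_left, Rmax_right by lra.
  intros x Hx; destruct (Req_dec y yw) as [->|ne].
  - rewrite (proof_irrelevance _ p pw); auto.
  - apply C11at_Ccont with f'; apply H; exact ne. }
(* Continuity of f on the compact segment at height [yw] is uniform in x, so that the integral is
   continuous at [yw]. *)
assert (CONT : forall eps, 0 < eps -> exists d, 0 < d /\
  forall y, 0 < y -> Rabs (y - yw) <= d -> (Rabs (I y - I yw) <= eps)).
{ intros eps e0.
  assert (q0 : 0 < eps / (b - a + 1)) by (apply Rdiv_lt_0_compat; lra).
  destruct (uniform_continuity_2d_1d (fun x y => Re (at_xy f x y)) a b yw) with
    (eps := mkposreal _ q0) as [d Hd].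
  { intros x Hx; apply Ccont_2d with pw; auto. }
  exists (pos d); split; [apply d|]; intros y p Hy.
  unfold I.
  rewrite <- (RInt_minus (V := R_CompleteNormedModule)
     (fun x => Re (at_xy f x y))) by auto.
  eapply Rle_trans; [apply RInt_abs_bound with (M := (eps / (b - a + 1))%R); [exact ab| |]|].
  - apply (ex_RInt_minus (V := R_NormedModule)); auto.
  - intros x Hx; left.
    apply Rabs_le_between in Hy.
    assert (d0 := cond_pos d).
    apply (Hd x yw x y); try lra.
    rewrite Rminus_diag, Rabs_R0; exact d0.
  - apply Rmult_le_reg_r with (b - a + 1)%R; [lra|].
    replace ((b - a) * (eps / (b - a + 1)) * (b - a + 1))%R with ((b - a) * eps)%R
      by (field; lra).
    nra. }
(* [I] is constant on either side of [yw], so [I y] is also its value at a height [v] within [m] of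
   [yw]; [m] is at most [yw / 2] to keep [v] positive. *)
assert (KEY : forall y, 0 < y -> I y = I yw).
{ intros y p; destruct (Req_dec y yw) as [->|ne]; [reflexivity|].
  apply cond_eq; intros eps e0.
  destruct (CONT (eps / 2)%R ltac:(lra)) as (d & d0 & Hd).
  assert (A := Rmin_l d (yw / 2)); assert (B := Rmin_r d (yw / 2)).
  assert (m0 : 0 < Rmin d (yw / 2)) by (apply Rmin_glb_lt; lra).
  set (m := Rmin d (yw / 2)) in *.
  apply Rle_lt_trans with (eps / 2)%R; [|lra].
  assert (NEAR : forall v, 0 < v -> (Rabs (v - yw) <= m) -> (Rabs (I v - I yw) <= eps / 2))
    by (intros; apply Hd; lra).
  destruct (Rdichotomy _ _ ne) as [L|L].
  - assert (a1 := Rmax_l y (yw - m)); assert (a2 := Rmax_r y (yw - m)).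
    set (v := Rmax y (yw - m)) in *.
    assert (v < yw) by (apply Rmax_lub_lt; lra).
    replace (I y) with (I v); [apply NEAR; [lra|apply Rabs_le; lra]|].
    destruct (Req_dec y v) as [<-|nv]; [reflexivity|symmetry; apply SIDE; lra].
  - assert (a1 := Rmin_l y (yw + m)); assert (a2 := Rmin_r y (yw + m)).
    set (v := Rmin y (yw + m)) in *.
    assert (yw < v) by (apply Rmin_glb_lt; lra).
    replace (I y) with (I v); [apply NEAR; [lra|apply Rabs_le; lra]|].
    destruct (Req_dec y v) as [<-|nv]; [reflexivity|apply SIDE; lra]. }
intros y1 y2 p1 p2; change (I y1 = I y2); now rewrite (KEY y1 p1), (KEY y2 p2).
Qed.

Lemma lineint_rotate (f : UHP -> C) (a b y : R) :
  RInt (fun x => Re (at_xy (fun z => - Ci * f z) x y)) a b =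
  RInt (fun x => Im (at_xy f x y)) a b.
Proof. apply RInt_ext; intros; apply at_xy_rotate. Qed.

Lemma lineint_const (f f' : UHP -> C) (a b yw : R) (pw : 0 < yw) :
  a <= b ->
  (forall tau : UHP, Im tau <> yw -> C11at f f' tau) ->
  (forall x, a <= x <= b -> Ccont f (upt x yw pw)) ->
  (forall v, 0 < v -> at_xy f b v = at_xy f a v) ->
  forall y1 y2, 0 < y1 -> 0 < y2 ->
  lineint f a b y1 = lineint f a b y2.
Proof.
intros ab H Hw per y1 y2 p1 p2; apply C_ext; simpl.
- apply Re_lineint_const with f' yw pw; auto.
- rewrite <- !lineint_rotate.
  apply Re_lineint_const with (fun z => - Ci * f' z) yw pw; auto.
  + intros; apply C11at_rotate; auto.
  + intros; apply Ccont_rotate; auto.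
  + intros v p; assert (E := per v p).
    rewrite !(at_xy_upt _ _ v p) in *; now rewrite E.
Qed.

Lemma lineint_deriv (f f' : UHP -> C) (a b y : R) (p : 0 < y) :
  (forall x, C11at f f' (upt x y p)) ->
  lineint f' a b y = at_xy f b y - at_xy f a y.
Proof.
intros H; apply C_ext; simpl.
- now apply RInt_derive_periodic with p.
- rewrite <- lineint_rotate, (RInt_derive_periodic (fun z => - Ci * f z) _ a b y p)
    by (intros; now apply C11at_rotate).
  now rewrite !at_xy_rotate.
Qed.

Definition line_cont (f : UHP -> C) (y : R) : Prop :=
  forall tau : UHP, Im tau = y -> Ccont f tau.

Lemma line_cont_ex_RInt (f : UHP -> C) (a b y : R) :
  0 < y -> line_cont f y ->
  ex_RInt (fun x => Re (at_xy f x y)) a b /\ ex_RInt (fun x => Im (at_xy f x y)) a b.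
Proof.
intros p H; split; [apply Ccont_ex_RInt with p; intros; now apply H|].
apply ex_RInt_ext with (fun x => Re (at_xy (fun z => - Ci * f z) x y)).
- intros; apply at_xy_rotate.
- apply Ccont_ex_RInt with p; intros; apply Ccont_rotate; now apply H.
Qed.

Lemma lineint_ext (f g : UHP -> C) (a b y : R) :
  0 < y -> (forall tau : UHP, Im tau = y -> f tau = g tau) ->
  lineint f a b y = lineint g a b y.
Proof.
intros p H; apply C_ext; simpl; apply RInt_ext; intros;
  rewrite !(at_xy_upt _ _ y p), H; reflexivity.
Qed.

Lemma lineint_plus (f g : UHP -> C) (a b y : R) :
  0 < y -> line_cont f y -> line_cont g y ->
  lineint (fun z => f z + g z) a b y = lineint f a b y + lineint g a b y.
Proof.
intros p Hf Hg; destruct (line_cont_ex_RInt f a b y p Hf) as [F1 F2],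
  (line_cont_ex_RInt g a b y p Hg) as [G1 G2].
apply C_ext; simpl.
- rewrite <- (RInt_plus (V := R_CompleteNormedModule) (fun x => Re (at_xy f x y))) by auto.
  apply RInt_ext; intros; now rewrite !(at_xy_upt _ _ y p).
- rewrite <- (RInt_plus (V := R_CompleteNormedModule) (fun x => Im (at_xy f x y))) by auto.
  apply RInt_ext; intros; now rewrite !(at_xy_upt _ _ y p).
Qed.

Lemma lineint_scal (c : C) (f : UHP -> C) (a b y : R) :
  0 < y -> line_cont f y ->
  lineint (fun z => c * f z) a b y = c * lineint f a b y.
Proof.
intros p Hf; destruct (line_cont_ex_RInt f a b y p Hf) as [F1 F2].
destruct c as [c d].
assert (L : forall (k l : R), RInt (fun x => k * Re (at_xy f x y) + l * Im (at_xy f x y))%R a b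
  = (k * RInt (fun x => Re (at_xy f x y)) a b + l * RInt (fun x => Im (at_xy f x y)) a b)%R).
{ intros k l.
  rewrite <- (RInt_scal (V := R_CompleteNormedModule) (fun x => Re (at_xy f x y))) by auto.
  rewrite <- (RInt_scal (V := R_CompleteNormedModule) (fun x => Im (at_xy f x y))) by auto.
  rewrite <- (RInt_plus (V := R_CompleteNormedModule)).
  - reflexivity.
  - apply (ex_RInt_scal (V := R_NormedModule)); auto.
  - apply (ex_RInt_scal (V := R_NormedModule)); auto. }
apply C_ext; simpl.
- replace (c * _ - d * _)%R with (c * RInt (fun x => Re (at_xy f x y)) a b +
    - d * RInt (fun x => Im (at_xy f x y)) a b)%R by ring.
  rewrite <- L; apply RInt_ext; intros; rewrite !(at_xy_upt _ _ y p); unfold Re, Im; simpl; ring.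
- replace (c * _ + d * _)%R with (d * RInt (fun x => Re (at_xy f x y)) a b +
    c * RInt (fun x => Im (at_xy f x y)) a b)%R by ring.
  rewrite <- L; apply RInt_ext; intros; rewrite !(at_xy_upt _ _ y p); unfold Re, Im; simpl; ring.
Qed.

Lemma lineint_bound (f : UHP -> C) (a b y M : R) :
  a <= b -> 0 < y -> line_cont f y ->
  (forall tau : UHP, a <= Re tau <= b -> Im tau = y -> (Cmod (f tau) <= M)) ->
  Cmod (lineint f a b y) <= 2 * (b - a) * M.
Proof.
intros ab p Hf HM; destruct (line_cont_ex_RInt f a b y p Hf) as [F1 F2].
eapply Rle_trans; [apply Cmod_le_abs|]; simpl.
assert (Rabs (RInt (fun x => Re (at_xy f x y)) a b) <= (b - a) * M).
{ apply RInt_abs_bound; auto; intros x Hx; rewrite (at_xy_upt _ _ y p).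
  eapply Rle_trans; [apply re_le_Cmod|apply HM; auto]. }
assert (Rabs (RInt (fun x => Im (at_xy f x y)) a b) <= (b - a) * M).
{ apply RInt_abs_bound; auto; intros x Hx; rewrite (at_xy_upt _ _ y p).
  eapply Rle_trans; [apply Im_le_Cmod|apply HM; auto]. }
lra.
Qed.

Lemma RInt_periodic_shift (u : R -> R) (a h : R) :
  (forall x, u (x + h)%R = u x) -> (forall c d, ex_RInt u c d) ->
  RInt u a (a + h) = RInt u 0 h.
Proof.
intros per EX.
rewrite <- (RInt_Chasles (V := R_CompleteNormedModule) u a 0 (a + h)) by auto.
rewrite <- (RInt_Chasles (V := R_CompleteNormedModule) u 0 h (a + h)) by auto.
assert (E : RInt u h (a + h) = RInt u 0 a).
{ replace h with (1 * 0 + h)%R at 1 by ring.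
  replace (a + h)%R with (1 * a + h)%R by ring.
  rewrite <- (RInt_comp_lin (V := R_CompleteNormedModule)) by auto.
  apply RInt_ext; intros x _.
  change (1 * u (1 * x + h) = u x)%R; rewrite Rmult_1_l, Rmult_1_l, per; reflexivity. }
rewrite E.
assert (F := RInt_Chasles (V := R_CompleteNormedModule) u a 0 a (EX _ _) (EX _ _)).
rewrite RInt_point in F.
change (RInt u a 0 + RInt u 0 a = 0)%R in F.
change (RInt u a 0 + (RInt u 0 h + RInt u 0 a) = RInt u 0 h)%R; lra.
Qed.

Lemma lineint_periodic_shift (f : UHP -> C) (a h y : R) :
  0 < y -> line_cont f y ->
  (forall x, at_xy f (x + h) y = at_xy f x y) ->
  lineint f a (a + h) y = lineint f 0 h y.
Proof.
intros p Hf per.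
assert (EX := fun c d => line_cont_ex_RInt f c d y p Hf).
apply C_ext; simpl; apply RInt_periodic_shift.
- intros; now rewrite per.
- intros c d; exact (proj1 (EX c d)).
- intros; now rewrite per.
- intros c d; exact (proj2 (EX c d)).
Qed.

Lemma line_bounded (f : UHP -> C) (a b y : R) :
  a <= b -> 0 < y -> line_cont f y ->
  exists B, 0 <= B /\
    forall tau : UHP, a <= Re tau <= b -> Im tau = y -> Cmod (f tau) <= B.
Proof.
intros ab p Hf.
assert (W : forall g, line_cont g y -> exists B, 0 <= B /\
   forall x, a <= x <= b -> (Rabs (Re (at_xy g x y)) <= B)).
{ intros g Hg.
  destruct (continuity_ab_maj (fun x => Rabs (Re (at_xy g x y))) a b ab) as [m [Hm _]].
  - intros x _; apply (continuity_pt_comp (fun x => Re (at_xy g x y)) Rabs).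
    + apply continuity_pt_filterlim.
      apply continuity_2d_fst with (u := fun x y => Re (at_xy g x y)).
      apply Ccont_2d with p; now apply Hg.
    + apply Rcontinuity_abs.
  - exists (Rabs (Re (at_xy g m y))); split; [apply Rabs_pos|auto]. }
destruct (W f Hf) as (B1 & P1 & H1).
destruct (W (fun z => - Ci * f z)) as (B2 & P2 & H2).
{ intros tau Ht; apply Ccont_rotate; auto. }
exists (B1 + B2)%R; split; [lra|]; intros [[x v] q] Hx Hv; simpl in Hx, Hv; subst v.
specialize (H1 x Hx); specialize (H2 x Hx); rewrite at_xy_rotate in H2.
rewrite !(at_xy_upt _ _ y q) in H1, H2.
eapply Rle_trans; [apply Cmod_le_abs|]; unfold upt in *; lra.
Qed.

End Lines.

(** * Limits at i oo and partial sums of series *)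

Section Limits.
Local Open Scope R_scope.
Local Open Scope C_scope.

(* The cusp oo is approached in vertical strips, without uniformity in Re. *)
Definition Finf (P : UHP -> Prop) : Prop :=
  forall X, exists Y, forall tau : UHP,
    (Rabs (Re tau) <= X) -> Y <= Im tau -> P tau.

Global Instance Finf_filter : ProperFilter Finf.
Proof.
split.
- intros P H; destruct (H 0%R) as [Y HY].
  assert (p : 0 < Rmax 1 Y) by (apply Rlt_le_trans with 1%R; [lra|apply Rmax_l]).
  exists (upt 0 (Rmax 1 Y) p); apply HY; simpl; [rewrite Rabs_R0; lra|apply Rmax_r].
- split.
  + intros X; exists 0%R; trivial.
  + intros P Q A B X; destruct (A X) as [Y HY], (B X) as [Z HZ].
    exists (Rmax Y Z); intros tau h1 h2; split.
    * apply HY; [exact h1|apply Rle_trans with (2 := h2), Rmax_l].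
    * apply HZ; [exact h1|apply Rle_trans with (2 := h2), Rmax_r].
  + intros P Q PQ A X; destruct (A X) as [Y HY]; exists Y; auto.
Qed.

Lemma Finf_above (Y : R) : Finf (fun tau => (Y <= Im tau)).
Proof. intros X; exists Y; auto. Qed.

Lemma exp_decay (c eps : R) : 0 < c -> 0 < eps ->
  exists Y, forall y, Y <= y -> exp (- (c * y)) < eps.
Proof.
intros c0 e0; exists ((1 / eps) / c)%R; intros y Hy.
assert (h : 1 / eps <= c * y).
{ apply Rmult_le_reg_r with (/ c)%R; [now apply Rinv_0_lt_compat|].
  replace (c * y * / c)%R with y by (field; lra); exact Hy. }
assert (A := exp_ineq1_le (c * y)); assert (P := exp_pos (c * y)).
rewrite exp_Ropp; apply Rmult_lt_reg_r with (1 := P).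
rewrite Rinv_l by lra.
apply Rlt_le_trans with (eps * (1 + 1 / eps))%R.
- replace (eps * (1 + 1 / eps))%R with (eps + 1)%R by (field; lra); lra.
- apply Rmult_le_compat_l; lra.
Qed.

Lemma tends_qe (s : R) : 0 < s -> climit Finf (fun z => qe s z) 0.
Proof.
intros s0 eps e0; destruct (exp_decay s eps s0 e0) as [Y HY].
generalize (Finf_above Y); apply filter_imp; intros z Hz.
replace (qe s z - 0) with (qe s z) by ring; rewrite Cmod_qe; auto.
Qed.

(** The argument is the number of terms, which gives inductions an empty sum to start from; partial
    sums up to the index n thus appear as [csum u (S n)]. *)
Fixpoint csum (u : nat -> C) (n : nat) : C :=
  match n with O => 0 | S n => csum u n + u n end.

Lemma csum_ext (u v : nat -> C) (n : nat) :
  (forall i, (i < n)%nat -> u i = v i) -> csum u n = csum v n.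
Proof. intros H; induction n as [|n IH]; simpl; [|rewrite IH, H by auto]; auto. Qed.

Lemma csum_mult (c : C) (u : nat -> C) (n : nat) :
  csum (fun i => c * u i) n = c * csum u n.
Proof. induction n as [|n IH]; simpl; [|rewrite IH]; ring. Qed.

Lemma sum_n_csum (u : nat -> C) (n : nat) :
  @sum_n C_AbelianMonoid u n = csum u (S n).
Proof.
induction n as [|n IH].
- rewrite sum_O; symmetry; apply Cplus_0_l.
- rewrite sum_Sn, IH; reflexivity.
Qed.

Lemma is_series_climit (u : nat -> C) (l : C) :
  @is_series C_AbsRing C_NormedModule u l <->
  climit eventually (fun n => csum u (S n)) l.
Proof.
assert (E : forall n, csum u (S n) = @sum_n C_AbelianMonoid u n)
  by (intros; now rewrite sum_n_csum).
split; intros H.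
- apply climit_ext with (@sum_n C_AbelianMonoid u); [typeclasses eauto|intros; now rewrite E|].
  apply climit_filterlim; [typeclasses eauto|exact H].
- apply (climit_ext eventually _ _ _ E) in H.
  apply climit_filterlim in H; [exact H|typeclasses eauto].
Qed.

Lemma csum_geometric (u : nat -> C) (D r : R) (n : nat) :
  0 <= D -> 0 <= r < 1 -> (forall i, (Cmod (u i) <= D * r ^ i)) ->
  Cmod (csum u n) <= D / (1 - r).
Proof.
intros D0 r01 H.
assert (W : Cmod (csum u n) <= D * (1 - r ^ n) / (1 - r)).
{ induction n as [|n IH].
  - simpl; rewrite Cmod_0; apply Req_le; field; lra.
  - simpl; eapply Rle_trans; [apply Cmod_triangle|].
    eapply Rle_trans; [apply Rplus_le_compat; [exact IH|apply H]|].
    apply Req_le; field; lra. }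
eapply Rle_trans; [exact W|].
assert (0 <= r ^ n) by (apply pow_le; lra).
apply Rmult_le_compat_r; [left; apply Rinv_0_lt_compat; lra|nra].
Qed.

Lemma taylor1_scal (S : UHP -> Prop) (K : R) (c : C) (f f' : UHP -> C) :
  taylor1 S K f f' -> taylor1 S (Cmod c * K) (fun z => c * f z) (fun z => c * f' z).
Proof.
intros [K0 H]; assert (c0 := Cmod_ge_0 c).
split; [now apply Rmult_le_pos|]; intros z Sz; destruct (H z Sz) as (A & B & D).
rewrite !Cmod_mult.
split; [now apply Rmult_le_compat_l|split; [now apply Rmult_le_compat_l|]].
intros w Sw.
replace (c * f w - c * f z - (w - z) * (c * f' z))
  with (c * (f w - f z - (w - z) * f' z)) by ring.
rewrite Cmod_mult, Rmult_assoc; apply Rmult_le_compat_l; auto.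
Qed.

Lemma taylor1_limit {J : Type} (F : (J -> Prop) -> Prop) {FF : ProperFilter F}
  (S : UHP -> Prop) (K : R) (u u' : J -> UHP -> C) (f f' : UHP -> C) :
  0 <= K -> F (fun i => taylor1 S K (u i) (u' i)) ->
  (forall z, S z -> climit F (fun i => u i z) (f z)) ->
  (forall z, S z -> climit F (fun i => u' i z) (f' z)) ->
  taylor1 S K f f'.
Proof.
intros K0 T Hf Hf'; split; [exact K0|]; intros z Sz.
assert (Z : forall c : C, c - 0 = c) by (intros; ring).
split; [rewrite <- (Z (f z)); apply (climit_le F _ _ _ _ (Hf z Sz))|].
{ revert T; apply filter_imp; intros i [_ H]; rewrite Z; now apply H. }
split; [rewrite <- (Z (f' z)); apply (climit_le F _ _ _ _ (Hf' z Sz))|].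
{ revert T; apply filter_imp; intros i [_ H]; rewrite Z; now apply H. }
intros w Sw; rewrite <- (Z (f w - f z - _)).
apply (climit_le F (fun i => u i w - u i z - (w - z) * u' i z)).
- apply climit_minus; [typeclasses eauto| |].
  + apply climit_minus; [typeclasses eauto| |]; auto.
  + apply climit_scal; [typeclasses eauto|auto].
- revert T; apply filter_imp; intros i [_ H]; rewrite Z; now apply H.
Qed.

End Limits.

(** * Regularity and leading terms of functions with a q-expansion *)

Section QExpansionSmooth.
Local Open Scope R_scope.
Local Open Scope C_scope.

Definition freq (h : nat) : R := (2 * PI / INR h)%R.

Lemma freq_pos (h : nat) : (1 <= h)%nat -> 0 < freq h.
Proof.
intros H; apply Rdiv_lt_0_compat; [assert (P := PI_RGT_0); lra|].
apply lt_0_INR; lia.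
Qed.

Lemma has_qexp_climit (h : nat) (f : UHP -> C) (a : nat -> C) (tau : UHP) :
  has_qexp h f a ->
  climit eventually (fun n => csum (fun i => a i * qe (INR i * freq h) tau) (S n)) (f tau).
Proof.
intros H; apply is_series_climit; specialize (H tau).
revert H; apply is_series_ext; intros n; unfold qe, freq.
now replace (2 * PI * INR n / INR h)%R with (INR n * (2 * PI / INR h))%R
  by (unfold Rdiv; ring).
Qed.

Lemma has_qexp_of_climit (h : nat) (f : UHP -> C) (a : nat -> C) :
  (forall tau : UHP, climit eventually
     (fun n => csum (fun i => a i * qe (INR i * freq h) tau) (S n)) (f tau)) ->
  has_qexp h f a.
Proof.
intros H tau; specialize (H tau); apply is_series_climit in H.
revert H; apply is_series_ext; intros n; unfold qe, freq.
now replace (2 * PI * INR n / INR h)%R with (INR n * (2 * PI / INR h))%R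
  by (unfold Rdiv; ring).
Qed.

Lemma bounded_of_eventually_bounded (u : nat -> R) (M : R) (N : nat) :
  (forall n, (N <= n)%nat -> (u n <= M)) -> exists B, forall n, (u n <= B).
Proof.
revert M; induction N as [|N IH]; intros M H; [exists M; intros; apply H; lia|].
apply (IH (Rmax M (u N))); intros n Hn.
destruct (Nat.eq_dec n N) as [->|ne]; [apply Rmax_r|].
apply Rle_trans with (2 := Rmax_l _ _); apply H; lia.
Qed.

(** The terms of the convergent series at i y are bounded. As y is arbitrary, the coefficients grow
    more slowly than every exponential. *)
Lemma has_qexp_coef_bound (h : nat) (f : UHP -> C) (a : nat -> C) (y : R) :
  0 < y -> has_qexp h f a ->
  exists B, 0 <= B /\ forall n, (Cmod (a n) <= B * exp (INR n * freq h * y)).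
Proof.
intros p H; set (tau := upt 0 y p).
assert (L := has_qexp_climit h f a tau H).
set (u := fun i => a i * qe (INR i * freq h) tau) in *.
destruct (L 1%R Rlt_0_1) as [N HN].
destruct (bounded_of_eventually_bounded (fun n => Cmod (u n)) 2 (S N)) as [B HB].
{ intros n Hn; destruct n as [|n]; [lia|].
  assert (A := HN (S n) ltac:(lia)); assert (A' := HN n ltac:(lia)).
  change (csum u (S (S n))) with (csum u (S n) + u (S n)) in A.
  replace (u (S n)) with ((csum u (S n) + u (S n) - f tau) - (csum u (S n) - f tau)) by ring.
  unfold Cminus at 1; eapply Rle_trans; [apply Cmod_triangle|]; rewrite Cmod_opp; lra. }
exists B; split; [apply Rle_trans with (2 := HB O), Cmod_ge_0|].
intros n; specialize (HB n); unfold u in HB; rewrite Cmod_mult, Cmod_qe in HB.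
simpl in HB; rewrite exp_Ropp in HB.
assert (P := exp_pos (INR n * freq h * y)).
apply Rmult_le_reg_r with (/ exp (INR n * freq h * y))%R;
  [now apply Rinv_0_lt_compat|].
replace (B * exp (INR n * freq h * y) * / exp (INR n * freq h * y))%R with B
  by (field; lra).
exact HB.
Qed.

Lemma exp_INR (n : nat) (x : R) : exp (INR n * x) = (exp x ^ n)%R.
Proof.
induction n as [|n IH]; [simpl; rewrite Rmult_0_l; apply exp_0|].
rewrite S_INR, Rmult_plus_distr_r, exp_plus, IH, Rmult_1_l; simpl; ring.
Qed.

(** From exp (s k) = exp (s k / 2)^2 >= (1 + s k / 2)^2. It absorbs the polynomial factor of
    [taylor1_qe] in an exponential of arbitrarily small rate k. *)
Lemma quadratic_le_exp (k s : R) : 0 < k -> 0 <= s ->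
  1 + s + 4 * s ^ 2 <= (1 + / k + 16 * (/ k) ^ 2) * exp (s * k).
Proof.
intros k0 s0.
assert (E : (exp (s * k) = exp (s * k / 2) * exp (s * k / 2))%R)
  by (rewrite <- exp_plus; f_equal; field).
assert (A := exp_ineq1_le (s * k / 2)).
assert (sk : 0 <= s * k) by (apply Rmult_le_pos; lra).
assert (B : 1 + s * k + (s * k) ^ 2 / 4 <= exp (s * k)) by (rewrite E; nra).
assert (i0 : 0 < / k) by now apply Rinv_0_lt_compat.
set (i := (/ k)%R) in *.
assert (ik : (i * k = 1)%R) by (unfold i; field; lra).
assert (T1 : (i * (s * k) = s)%R) by (transitivity (i * k * s)%R; [ring|rewrite ik; ring]).
assert (T2 : (i ^ 2 * (s * k) ^ 2 = s ^ 2)%R) by (rewrite <- Rpow_mult_distr, T1; ring).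
assert (0 <= i ^ 2) by apply pow2_ge_0.
assert (0 <= (s * k) ^ 2) by apply pow2_ge_0.
apply Rle_trans with ((1 + i + 16 * i ^ 2) * (1 + s * k + (s * k) ^ 2 / 4))%R.
- assert (0 <= i * (s * k) ^ 2) by (apply Rmult_le_pos; lra).
  assert (0 <= i ^ 2 * (s * k)) by (apply Rmult_le_pos; lra). nra.
- apply Rmult_le_compat_l; lra.
Qed.

Lemma taylor1_csum (S : UHP -> Prop) (K : nat -> R) (u u' : nat -> UHP -> C) (D r : R) (n : nat) :
  0 <= D -> 0 <= r < 1 -> (forall i, (K i <= D * r ^ i)) ->
  (forall i, taylor1 S (K i) (u i) (u' i)) ->
  taylor1 S (D / (1 - r)) (fun z => csum (fun i => u i z) n)
    (fun z => csum (fun i => u' i z) n).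
Proof.
intros D0 r01 HK H.
assert (W : taylor1 S (D * (1 - r ^ n) / (1 - r)) (fun z => csum (fun i => u i z) n)
    (fun z => csum (fun i => u' i z) n)).
{ induction n as [|n IH].
  - simpl; apply (taylor1_mono S S (Cmod 0)); auto.
    + rewrite Cmod_0; apply Req_le; field; lra.
    + apply taylor1_const.
  - simpl; apply (taylor1_mono S S (D * (1 - r ^ n) / (1 - r) + K n)); auto.
    + eapply Rle_trans; [apply Rplus_le_compat_l, HK|].
      apply Req_le; field; lra.
    + apply taylor1_plus; auto. }
revert W; apply taylor1_mono; auto.
assert (0 <= r ^ n) by (apply pow_le; lra).
apply Rmult_le_compat_r; [left; apply Rinv_0_lt_compat; lra|nra].
Qed.

(** Termwise differentiation: near each point the terms have summable [taylor1] constants, and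
    [taylor1] passes to the limit of the partial sums. The derivative is the sum of the series of
    derivatives. *)
Lemma has_qexp_C11 (h : nat) (f : UHP -> C) (a : nat -> C) :
  (1 <= h)%nat -> has_qexp h f a -> C11 f.
Proof.
intros h1 Hq; assert (s0 := freq_pos h h1); set (s := freq h) in *.
set (u := fun (i : nat) (z : UHP) => a i * qe (INR i * s) z).
set (u' := fun (i : nat) (z : UHP) => a i * (RtoC (INR i * s) * Ci * qe (INR i * s) z)).
assert (LOC : forall z0 : UHP, exists r D q, 0 < r /\ 0 <= D /\ 0 <= q < 1 /\
  exists K, (forall i, (K i <= D * q ^ i)) /\
   forall i, taylor1 (near z0 r) (K i) (u i) (u' i)).
{ intros z0; assert (y0 := uhp_pos z0); set (y := Im z0) in *.
  destruct (has_qexp_coef_bound h f a (y / 8) ltac:(lra) Hq) as (B & B0 & HB).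
  fold s in HB.
  (* On the disc of radius y/4 the exponent in [taylor1_qe] is at most - t y/4 for the frequency t
     (height at least 3y/4, variation at most y/2). The coefficients cost t y/8 and the polynomial
     factor t y/16, which leaves - t y/16 and hence the ratio exp (- s k). *)
  set (k := (y / 16)%R); assert (k0 : 0 < k) by (unfold k; lra).
  assert (i0 : 0 < / k) by now apply Rinv_0_lt_compat.
  assert (i2 : 0 <= (/ k) ^ 2) by apply pow2_ge_0.
  set (c := (1 + / k + 16 * (/ k) ^ 2)%R) in *.
  assert (c0 : 0 <= c) by (unfold c; lra).
  exists (y / 4)%R, (B * c)%R, (exp (- (s * k))).
  split; [lra|split; [apply Rmult_le_pos; lra|split]].
  { split; [left; apply exp_pos|]; rewrite <- exp_0; apply exp_increasing.
    assert (0 < s * k) by (apply Rmult_lt_0_compat; lra); lra. }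
  exists (fun i => Cmod (a i) * ((1 + Rabs (INR i * s) + 4 * (INR i * s) ^ 2)
     * exp (- (INR i * s * (y / 4)))))%R.
  assert (si : forall i, (0 <= INR i * s))
    by (intros; apply Rmult_le_pos; [apply pos_INR|lra]).
  split.
  - intros i; specialize (HB i); specialize (si i).
    rewrite Rabs_pos_eq by lra.
    set (t := (INR i * s)%R) in *.
    assert (Q := quadratic_le_exp k t k0 si); fold c in Q.
    replace (exp (- (s * k)) ^ i)%R with (exp (- (t * k)))
      by (rewrite <- exp_INR; f_equal; unfold t; ring).
    replace (B * c * exp (- (t * k)))%R with
      ((B * exp (t * (y / 8))) * (c * exp (t * k) * exp (- (t * (y / 4)))))%R.
    + apply Rmult_le_compat; [apply Cmod_ge_0| |exact HB|].
      * apply Rmult_le_pos; [|left; apply exp_pos].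
        assert (0 <= t ^ 2) by apply pow2_ge_0; lra.
      * apply Rmult_le_compat_r; [left; apply exp_pos|exact Q].
    + replace (exp (- (t * k))) with (exp (t * (y / 8)) * exp (t * k) * exp (- (t * (y / 4))))%R.
      * ring.
      * rewrite <- !exp_plus; f_equal; unfold k; field.
  - intros i; apply taylor1_scal, taylor1_qe.
    intros z w hz hw; specialize (si i); set (t := (INR i * s)%R) in *.
    apply near_Im, Rabs_def2 in hz; apply near_Im, Rabs_def2 in hw.
    fold y in hz, hw.
    assert (D : Rabs (Im w - Im z) <= y / 2) by (apply Rabs_le; lra).
    rewrite Rabs_mult, (Rabs_pos_eq t) by lra; nra. }
assert (EX : forall z, exists l, climit eventually (fun n => csum (fun i => u' i z) (S n)) l).
{ intros z; destruct (LOC z) as (r & D & q & r0 & D0 & q1 & K & HK & T).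
  destruct (ex_series_le (V := C_CompleteNormedModule) (fun i => u' i z) (fun i => D * q ^ i)%R)
    as [l Hl].
  - intros i; destruct (T i) as [_ T'].
    assert (N : near z r z) by now apply near_refl.
    destruct (T' z N) as (_ & X & _).
    apply Rle_trans with (2 := HK i); exact X.
  - apply (ex_series_scal (V := R_NormedModule) D (fun i => q ^ i)%R).
    apply ex_series_geom; rewrite Rabs_pos_eq; lra.
  - exists l; apply is_series_climit; exact Hl. }
set (f' := fun z => proj1_sig (constructive_indefinite_description _ (EX z))).
assert (Hf' : forall z, climit eventually (fun n => csum (fun i => u' i z) (S n)) (f' z))
  by (intros z; apply (proj2_sig (constructive_indefinite_description _ (EX z)))).
exists f'; intros z0; destruct (LOC z0) as (r & D & q & r0 & D0 & q1 & K & HK & T).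
exists r, (D / (1 - q))%R; split; [exact r0|].
apply (taylor1_limit eventually) with
  (u := fun n z => csum (fun i => u i z) (S n)) (u' := fun n z => csum (fun i => u' i z) (S n)).
- apply Rmult_le_pos; [exact D0|left; apply Rinv_0_lt_compat; lra].
- apply filter_forall; intros n; apply (taylor1_csum (near z0 r) K); auto.
- intros z _; now apply has_qexp_climit.
- intros z _; apply Hf'.
Qed.

Lemma has_qexp_leading (h : nat) (f : UHP -> C) (a : nat -> C) (n : nat) :
  (1 <= h)%nat -> has_qexp h f a -> (forall m, (m < n)%nat -> a m = 0) ->
  climit Finf (fun z => f z * qe (- (INR n * freq h)) z) (a n).
Proof.
intros h1 Hq Ha; assert (s0 := freq_pos h h1).
destruct (has_qexp_coef_bound h f a (1/2) ltac:(lra) Hq) as (B & B0 & HB).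
set (s := freq h) in *.
set (q := exp (- (s / 2))).
assert (q1 : 0 <= q < 1).
{ split; [left; apply exp_pos|]; rewrite <- exp_0; apply exp_increasing; lra. }
set (D := (B * exp (INR n * s))%R).
assert (D0 : 0 <= D) by (apply Rmult_le_pos; [lra|left; apply exp_pos]).
(* The tail runs over m > n. Its terms are at most B exp (m s / 2) exp (- (m - n) s Im z), and (m -
   n - 1) (Im z - 1) >= 0 turns this into D exp (- s (Im z - 1)) times the m-th power of [q]. *)
assert (KEY : forall z : UHP, 1 <= Im z ->
  (Cmod (f z * qe (- (INR n * s)) z - a n) <= D * exp (- (s * (Im z - 1))) / (1 - q))).
{ intros z Hz.
  set (v := fun m => a m * qe (INR m * s) z * qe (- (INR n * s)) z).
  set (w := fun m => if Nat.eq_dec m n then RtoC 0 else v m).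
  assert (vn : v n = a n).
  { unfold v; rewrite <- Cmult_assoc, <- qe_plus.
    replace (INR n * s + - (INR n * s))%R with 0%R by ring; rewrite qe_0; ring. }
  assert (L : climit eventually (fun M => csum w (S M)) (f z * qe (- (INR n * s)) z - a n)).
  { apply (climit_ext_ev eventually) with
      (fun M => csum (fun i => a i * qe (INR i * s) z) (S M) * qe (- (INR n * s)) z - a n).
    - exists n; intros M HM.
      rewrite Cmult_comm, <- csum_mult.
      (* Removing the n-th term changes the sum of the first M terms exactly when M > n. *)
      assert (G : forall M, csum v M - (if le_lt_dec M n then RtoC 0 else a n) = csum w M).
      { clear M HM; intros M; induction M as [|M IH].
        - destruct (le_lt_dec 0 n); [simpl; ring|lia].
        - change (csum v (S M)) with (csum v M + v M).
          change (csum w (S M)) with (csum w M + w M).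
          rewrite <- IH; unfold w; destruct (Nat.eq_dec M n) as [->|ne].
          + rewrite vn; destruct (le_lt_dec n n), (le_lt_dec (S n) n); try lia; ring.
          + destruct (le_lt_dec M n), (le_lt_dec (S M) n); try lia; ring. }
      rewrite <- (G (S M)); destruct (le_lt_dec (S M) n); [lia|].
      f_equal; apply csum_ext; intros; unfold v; ring.
    - apply climit_minus; [typeclasses eauto| |apply climit_const; typeclasses eauto].
      apply climit_mult; [typeclasses eauto| |apply climit_const; typeclasses eauto].
      now apply has_qexp_climit. }
  replace (f z * qe (- (INR n * s)) z - a n)
    with (f z * qe (- (INR n * s)) z - a n - 0) by ring.
  apply (climit_le eventually _ _ _ _ L), filter_forall; intros M.
  replace (csum w (S M) - 0) with (csum w (S M)) by ring.
  apply csum_geometric; [apply Rmult_le_pos; [exact D0|left; apply exp_pos]|exact q1|].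
  intros m; unfold w; destruct (Nat.eq_dec m n) as [->|ne].
  { rewrite Cmod_0; repeat apply Rmult_le_pos; try (left; apply exp_pos); try exact B0.
    apply pow_le; lra. }
  unfold v; destruct (lt_dec m n) as [lt|ge].
  { rewrite Ha by exact lt; rewrite !Cmult_0_l, Cmod_0.
    repeat apply Rmult_le_pos; try (left; apply exp_pos); try exact B0.
    apply pow_le; lra. }
  rewrite <- Cmult_assoc, <- qe_plus, Cmod_mult, Cmod_qe.
  replace (q ^ m)%R with (exp (- (INR m * (s / 2))))
    by (unfold q; rewrite <- exp_INR; f_equal; ring).
  unfold D; eapply Rle_trans; [apply Rmult_le_compat_r; [left; apply exp_pos|apply HB]|].
  rewrite !Rmult_assoc; apply Rmult_le_compat_l; [exact B0|].
  rewrite <- !exp_plus; apply exp_le.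
  assert (INR n + 1 <= INR m) by (rewrite <- S_INR; apply le_INR; lia).
  assert (Z : 0 <= s * ((INR m - INR n - 1) * (Im z - 1)))
    by (apply Rmult_le_pos; [lra|apply Rmult_le_pos; lra]).
  lra. }
intros eps e0.
assert (d0 : 0 <= D / (1 - q))
  by (apply Rmult_le_pos; [exact D0|left; apply Rinv_0_lt_compat; lra]).
set (d := (D / (1 - q))%R) in *.
destruct (exp_decay s (eps / (d + 1)) s0) as [Y HY]; [apply Rdiv_lt_0_compat; lra|].
generalize (filter_and _ _ (Finf_above 1) (Finf_above (Y + 1)%R)).
apply filter_imp; intros z [H1 H2].
eapply Rle_lt_trans; [apply KEY, H1|].
specialize (HY (Im z - 1)%R ltac:(lra)).
set (e := exp (- (s * (Im z - 1)))) in *.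
assert (P : 0 < e) by apply exp_pos.
replace (D * e / (1 - q))%R with (d * e)%R by (unfold d; field; lra).
apply Rlt_le_trans with ((d + 1) * (eps / (d + 1)))%R.
- nra.
- apply Req_le; field; lra.
Qed.

End QExpansionSmooth.

(** * Fourier expansion of periodic functions with a limit at i oo *)

Section QExpansionPrinciple.
Local Open Scope R_scope.
Local Open Scope C_scope.

Lemma UHP_ext (z w : UHP) : uhp_val z = uhp_val w -> z = w.
Proof. destruct z, w; simpl; intros ->; f_equal; apply proof_irrelevance. Qed.

Definition periodic (h : nat) (f : UHP -> C) : Prop :=
  forall z z' : UHP, uhp_val z' = z + RtoC (INR h) -> f z' = f z.

Lemma qe_real (s x : R) : qe s (RtoC x) = (cos (s * x), sin (s * x)).
Proof.
unfold qe.
replace (RtoC s * Ci * RtoC x) with ((0%R, (s * x)%R) : C)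
  by (apply C_ext; unfold Re, Im; simpl; ring).
unfold Cexp; simpl; rewrite exp_0; apply C_ext; unfold Re, Im; simpl; ring.
Qed.

Lemma qe_period_pos (h n : nat) :
  (1 <= h)%nat -> qe (INR n * freq h) (RtoC (INR h)) = 1.
Proof.
intros h1; rewrite qe_real.
assert (h0 : 0 < INR h) by (apply lt_0_INR; lia).
replace (INR n * freq h * INR h)%R with (0 + 2 * INR n * PI)%R
  by (unfold freq; field; lra).
rewrite cos_period, sin_period, cos_0, sin_0; reflexivity.
Qed.

Lemma qe_period_neg (h n : nat) :
  (1 <= h)%nat -> qe (- (INR n * freq h)) (RtoC (INR h)) = 1.
Proof.
intros h1; assert (E := qe_opp (INR n * freq h) (RtoC (INR h))).
rewrite qe_period_pos in E by exact h1; rewrite <- E; ring.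
Qed.

Lemma periodic_qe_neg (h n : nat) :
  (1 <= h)%nat -> periodic h (fun z => qe (- (INR n * freq h)) z).
Proof. intros h1 z z' E; rewrite E, qe_add, qe_period_neg by exact h1; ring. Qed.

Lemma periodic_qe1 (h : nat) : (1 <= h)%nat -> periodic h (fun z => qe (freq h) z).
Proof.
intros h1 z z' E; assert (P := qe_period_pos h 1 h1).
rewrite Rmult_1_l in P; rewrite E, qe_add, P; ring.
Qed.

Lemma periodic_mult (h : nat) (f g : UHP -> C) :
  periodic h f -> periodic h g -> periodic h (fun z => f z * g z).
Proof. intros F G z z' E; now rewrite (F z z' E), (G z z' E). Qed.

Lemma periodic_at (h : nat) (f : UHP -> C) (x y : R) :
  0 < y -> periodic h f -> at_xy f (x + INR h) y = at_xy f x y.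
Proof.
intros p H; rewrite !(at_xy_upt _ _ y p); apply H.
apply C_ext; unfold Re, Im; simpl; ring.
Qed.

Lemma lineint_qe_neg (h n : nat) (a y : R) :
  (1 <= h)%nat -> 0 < y ->
  lineint (fun z => qe (- (INR n * freq h)) z) a (a + INR h) y =
  if Nat.eq_dec n 0 then RtoC (INR h) else RtoC 0.
Proof.
intros h1 p; destruct (Nat.eq_dec n 0) as [->|ne].
- rewrite (lineint_ext _ (fun _ => 1) _ _ _ p).
  + apply C_ext; simpl.
    * rewrite (RInt_ext _ (fun _ => 1%R)).
      -- rewrite RInt_const; change ((a + INR h - a) * 1 = INR h)%R; ring.
      -- intros; now rewrite (at_xy_upt _ _ y p).
    * rewrite (RInt_ext _ (fun _ => 0%R)).
      -- rewrite RInt_const; change ((a + INR h - a) * 0 = 0)%R; ring.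
      -- intros; now rewrite (at_xy_upt _ _ y p).
  + intros; simpl; rewrite Rmult_0_l, Ropp_0; apply qe_0.
- set (t := (- (INR n * freq h))%R).
  assert (t0 : t <> 0%R).
  { assert (f0 := freq_pos h h1); assert (0 < INR n) by (apply lt_0_INR; lia).
    assert (0 < INR n * freq h) by (now apply Rmult_lt_0_compat); unfold t; lra. }
  assert (D := lineint_deriv (fun z => qe t z) (fun z => RtoC t * Ci * qe t z)
    a (a + INR h) y p (fun x => C11at_qe t _)).
  rewrite lineint_scal in D;
    [|exact p|intros tau _; apply (C11at_Ccont _ _ _ (C11at_qe t tau))].
  rewrite periodic_at in D by (auto; now apply periodic_qe_neg).
  set (L := lineint _ _ _ _) in *.
  assert (N : RtoC t * Ci <> 0).
  { apply Cmult_neq_0; [intros Z; apply t0; now apply RtoC_inj|].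
    intros Z; apply (f_equal Im) in Z; simpl in Z; lra. }
  replace L with (/ (RtoC t * Ci) * (RtoC t * Ci * L)).
  + rewrite D; ring.
  + field; split; [intros Z; apply N; rewrite Z; ring|].
    intros Z; apply N; rewrite Z; ring.
Qed.

(* Where e = exp (2 i pi z / h) takes the value e(w) the quotient is given its
   limit at w, so that it is continuous at w. *)
Definition dquot (h : nat) (f f' : UHP -> C) (w z : UHP) : C :=
  if excluded_middle_informative (qe (freq h) z = qe (freq h) w)
  then f' w / (RtoC (freq h) * Ci * qe (freq h) w)
  else (f z - f w) / (qe (freq h) z - qe (freq h) w).

Definition dquot' (h : nat) (f f' : UHP -> C) (w z : UHP) : C :=
  let g := qe (freq h) z - qe (freq h) w in
  f' z * / g + (f z - f w) * (- (RtoC (freq h) * Ci * qe (freq h) z) / (g * g)).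

Lemma C11at_ext_near (f g f' : UHP -> C) (z0 : UHP) (r : R) :
  0 < r -> (forall z, near z0 r z -> f z = g z) ->
  C11at f f' z0 -> C11at g f' z0.
Proof.
intros r0 E (s & K & s0 & H).
assert (A := Rmin_l r s); assert (B := Rmin_r r s).
exists (Rmin r s), K; split; [apply Rmin_glb_lt; lra|].
apply (taylor1_mono _ (near z0 (Rmin r s)) _ K) in H; [|unfold near; intros; lra|lra].
destruct H as [K0 H]; split; [exact K0|]; intros z Hz.
assert (E' : forall z, near z0 (Rmin r s) z -> g z = f z).
{ intros v Hv; symmetry; apply E; unfold near in *; lra. }
destruct (H z Hz) as (P & Q & T); rewrite (E' z Hz); split; [exact P|split; [exact Q|]].
intros w Hw; rewrite (E' w Hw); auto.
Qed.

Lemma Csub_neq_0 (a b : C) : a <> b -> a - b <> 0.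
Proof. intros ne Z; apply ne; replace a with (a - b + b) by ring; rewrite Z; ring. Qed.

Lemma C11at_sub_const (f f' : UHP -> C) (c : C) (z0 : UHP) :
  C11at f f' z0 -> C11at (fun z => f z - c) f' z0.
Proof.
intros H; destruct (C11at_plus _ _ _ _ z0 H (C11at_const (- c) z0)) as (r & K & r0 & T).
exists r, K; split; [exact r0|]; revert T; apply taylor1_ext; intros; ring.
Qed.

Lemma C11at_dquot (h : nat) (f f' : UHP -> C) (w z0 : UHP) :
  C11at f f' z0 -> qe (freq h) z0 <> qe (freq h) w ->
  C11at (dquot h f f' w) (dquot' h f f' w) z0.
Proof.
intros Hf ne; set (g := fun z : UHP => qe (freq h) z - qe (freq h) w).
assert (Hg : C11at g (fun z => RtoC (freq h) * Ci * qe (freq h) z) z0)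
  by apply C11at_sub_const, C11at_qe.
assert (g0 : g z0 <> 0) by now apply Csub_neq_0.
destruct (C11at_continuous _ _ z0 (Cmod (g z0)) Hg (proj1 (Cmod_gt_0 _) g0))
  as (r & r0 & Hr).
apply (C11at_ext_near (fun z => (f z - f w) * / g z)) with r; [exact r0| |].
- intros z Hz; unfold dquot.
  destruct (excluded_middle_informative _) as [E|E]; [|reflexivity].
  exfalso; specialize (Hr z Hz).
  replace (g z - g z0) with (- g z0) in Hr by (unfold g; rewrite E; ring).
  rewrite Cmod_opp in Hr; lra.
- exact (C11at_mult _ _ _ _ z0 (C11at_sub_const _ _ (f w) z0 Hf)
    (C11at_inv _ _ z0 g0 Hg)).
Qed.

Lemma climit_diff_quotient (f f' : UHP -> C) (w : UHP) : C11at f f' w ->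
  climit (nearby w) (fun z => if excluded_middle_informative (z = w) then f' w
    else (f z - f w) / (z - w)) (f' w).
Proof.
intros (r & K & r0 & [K0 T]) eps e0.
assert (t0 : 0 < eps / (K + 1)) by (apply Rdiv_lt_0_compat; lra).
assert (A := Rmin_l r (eps / (K + 1))); assert (B := Rmin_r r (eps / (K + 1))).
exists (Rmin r (eps / (K + 1))); split; [apply Rmin_glb_lt; lra|]; unfold near; intros z Hz.
destruct (excluded_middle_informative _) as [E|E].
{ replace (f' w - f' w) with (RtoC 0) by ring; rewrite Cmod_0; exact e0. }
assert (zw : z - w <> 0).
{ intros Z; apply E, UHP_ext; replace (uhp_val z) with (z - w + w) by ring; rewrite Z; ring. }
assert (d0 := proj1 (Cmod_gt_0 _) zw).
destruct (T w (near_refl w r r0)) as (_ & _ & D).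
specialize (D z ltac:(unfold near; lra)).
replace ((f z - f w) / (z - w) - f' w)
  with ((f z - f w - (z - w) * f' w) / (z - w)) by (field; exact zw).
rewrite Cmod_div by exact zw; set (d := Cmod (z - w)) in *.
apply Rle_lt_trans with (K * d)%R.
- apply Rmult_le_reg_r with (1 := d0); unfold Rdiv; rewrite Rmult_assoc, Rinv_l by lra; lra.
- replace eps with ((K + 1) * (eps / (K + 1)))%R by (field; lra); nra.
Qed.

(** Near w this is the quotient of the difference quotients of f and e, whose limit is f'(w) / e'(w)
    as e'(w) <> 0. There e(z) = e(w) forces z = w, since otherwise the difference quotient of e
    would be 0, at distance |e'(w)| from its limit. *)
Lemma Ccont_dquot (h : nat) (f f' : UHP -> C) (w : UHP) :
  (1 <= h)%nat -> C11at f f' w -> Ccont (dquot h f f' w) w.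
Proof.
intros h1 Hf; set (s := freq h); assert (s0 : 0 < s) by now apply freq_pos.
set (e' := fun z : UHP => RtoC s * Ci * qe s z).
assert (e'0 : e' w <> 0).
{ apply Cmult_neq_0; [|apply qe_neq_0].
  apply Cmult_neq_0; intros Z; [apply RtoC_inj in Z; lra|].
  apply (f_equal Im) in Z; simpl in Z; lra. }
assert (LE := climit_diff_quotient _ _ w (C11at_qe s w)).
assert (L := climit_div _ _ _ _ _ e'0 (climit_diff_quotient _ _ w Hf) LE).
unfold Ccont; replace (dquot h f f' w w) with (f' w / e' w)
  by (unfold dquot; destruct (excluded_middle_informative _) as [_|X]; [reflexivity|now elim X]).
revert L; apply climit_ext_ev; [typeclasses eauto|].
generalize (LE _ (proj1 (Cmod_gt_0 _) e'0)); apply filter_imp; intros z.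
unfold dquot; fold s; destruct (excluded_middle_informative (z = w)) as [->|zw]; intros H.
{ destruct (excluded_middle_informative _) as [_|X]; [reflexivity|now elim X]. }
assert (zw' : z - w <> 0) by (intros Z; apply zw, UHP_ext, Ceq_minus, Z).
destruct (excluded_middle_informative _) as [X|X].
{ exfalso; rewrite X in H.
  replace ((qe s w - qe s w) / (z - w) - RtoC s * Ci * qe s w) with (- e' w) in H
    by (unfold e'; field; exact zw').
  rewrite Cmod_opp in H; lra. }
field; split; [now apply Csub_neq_0|exact zw'].
Qed.

Lemma periodic_dquot (h : nat) (f f' : UHP -> C) (w : UHP) :
  (1 <= h)%nat -> periodic h f -> periodic h (dquot h f f' w).
Proof.
intros h1 H z z' E; unfold dquot.
rewrite (H z z' E), (periodic_qe1 h h1 z z' E); reflexivity.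
Qed.

(** The window is centred at w so that w is its only point, ends included, where e - e(w) vanishes:
    cos (2 pi t / h) = 1 means sin (pi t / h) = 0, and |t / h| <= 1/2 leaves t = 0. *)
Lemma qe_inj_window (h : nat) (w : UHP) (x : R) (p : 0 < Im w) :
  (1 <= h)%nat -> Re w - INR h / 2 <= x <= Re w + INR h / 2 -> x <> Re w ->
  qe (freq h) (upt x (Im w) p) <> qe (freq h) w.
Proof.
intros h1 Hx ne E.
assert (h0 : 0 < INR h) by (apply lt_0_INR; lia).
set (t := (x - Re w)%R).
assert (E1 : qe (freq h) (RtoC t) = 1).
{ replace (uhp_val (upt x (Im w) p)) with (w + RtoC t) in E
    by (destruct w as [[u v] pw]; apply C_ext; unfold t, Re, Im; simpl; ring).
  rewrite qe_add in E.
  replace (qe (freq h) (RtoC t)) with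
    (/ qe (freq h) w * (qe (freq h) w * qe (freq h) (RtoC t))) by (field; apply qe_neq_0).
  rewrite E; field; apply qe_neq_0. }
rewrite qe_real in E1; apply (f_equal Re) in E1; simpl in E1.
assert (S := one_sub_cos (freq h * t)); rewrite E1 in S.
assert (Z : sin (freq h * t / 2) = 0%R) by nra.
assert (B : (freq h * t / 2 = PI * (t / INR h))%R) by (unfold freq; field; lra).
rewrite B in Z.
assert (P := PI_RGT_0).
assert (T : (t / INR h * INR h = t)%R) by (field; lra).
assert (u : - (1/2) <= t / INR h <= 1/2).
{ assert (tb : - (INR h / 2) <= t <= INR h / 2) by (unfold t; lra).
  split; apply Rmult_le_reg_r with (1 := h0); lra. }
assert (n0 : (t / INR h <> 0)%R).
{ intros Y; apply ne.
  assert (t = t / INR h * INR h)%R by (field; lra).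
  rewrite Y in H; unfold t in H; lra. }
destruct (Rdichotomy _ _ n0) as [L|L].
- assert (X := sin_gt_0 (- (PI * (t / INR h)))); rewrite sin_neg in X.
  assert (0 < - (PI * (t / INR h))) by nra.
  assert (- (PI * (t / INR h)) < PI) by nra. lra.
- assert (X := sin_gt_0 (PI * (t / INR h))).
  assert (0 < (PI * (t / INR h))) by nra.
  assert ((PI * (t / INR h)) < PI) by nra. lra.
Qed.

Lemma qe_neq_Im (h : nat) (z w : UHP) :
  (1 <= h)%nat -> Im z <> Im w -> qe (freq h) z <> qe (freq h) w.
Proof.
intros h1 ne E; apply (f_equal Cmod) in E; rewrite !Cmod_qe in E.
apply exp_inv in E; assert (s0 := freq_pos h h1).
apply ne, Rmult_eq_reg_l with (freq h); lra.
Qed.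

Lemma dquot_line_const (h : nat) (f f' g g' : UHP -> C) (w : UHP) :
  (1 <= h)%nat -> (forall z, C11at f f' z) -> (forall z, C11at g g' z) ->
  periodic h f -> periodic h g ->
  let a := (Re w - INR h / 2)%R in
  forall y1 y2, 0 < y1 -> 0 < y2 ->
  lineint (fun z => dquot h f f' w z * g z) a (a + INR h) y1 =
  lineint (fun z => dquot h f f' w z * g z) a (a + INR h) y2.
Proof.
intros h1 Hf Hg pf pg a y1 y2 p1 p2.
assert (h0 : 0 < INR h) by (apply lt_0_INR; lia).
apply (lineint_const _ (fun z => dquot' h f f' w z * g z + dquot h f f' w z * g' z)
  _ _ (Im w) (uhp_pos w)); auto.
- lra.
- intros tau ne; apply C11at_mult; [apply C11at_dquot; auto|apply Hg].
  now apply qe_neq_Im.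
- intros x Hx; apply Ccont_mult; [|apply C11at_Ccont with g'; apply Hg].
  destruct (Req_dec x (Re w)) as [->|ne].
  + replace (upt (Re w) (Im w) (uhp_pos w)) with w
      by (apply UHP_ext; destruct w as [[] ?]; reflexivity).
    now apply Ccont_dquot.
  + apply C11at_Ccont with (dquot' h f f' w), C11at_dquot; [apply Hf|].
    apply qe_inj_window; auto; unfold a in Hx; lra.
- intros v pv; apply (periodic_at h); auto.
  apply periodic_mult; auto; now apply periodic_dquot.
Qed.

Lemma qexpansion_partial_sum (h : nat) (f f' : UHP -> C) (c0 : C) (w : UHP) :
  (1 <= h)%nat -> (forall z, C11at f f' z) -> periodic h f -> climit Finf f c0 ->
  let A := fun n => lineint (fun z => f z * qe (- (INR n * freq h)) z) 0 (INR h) 1 in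
  exists c : nat -> C,
    (exists B, 0 <= B /\
      forall n, (Cmod (c n) <= B * exp (INR n * freq h * (Im w / 2)))) /\
    forall M, csum (fun n => A n * qe (INR n * freq h) w) (S M) =
      RtoC (INR h) * f w - c M * qe (INR (S M) * freq h) w.
Proof.
intros h1 Hf pf Lf A.
assert (h0 : 0 < INR h) by (apply lt_0_INR; lia).
assert (w0 := uhp_pos w).
set (s := freq h) in *; assert (s0 : 0 < s) by now apply freq_pos.
set (a := (Re w - INR h / 2)%R); set (b := (a + INR h)%R).
set (k := dquot h f f' w).
set (e := fun (n : nat) (z : UHP) => qe (- (INR n * s)) z).
set (e1 := fun z : UHP => qe s z).
(* Below w, so that [c n], at most of size exp (n s y), is outweighed by e(w)^(n+1), of size exp (-
   2 (n + 1) s y). *)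
set (y := (Im w / 2)%R); assert (y0 : 0 < y) by (unfold y; lra).
set (c := fun n => lineint (fun z => k z * e n z) a b y).
set (cm := lineint (fun z => k z * e1 z) a b y).
assert (Le : forall n, line_cont (e n) y).
{ intros n z _; apply (C11at_Ccont _ _ _ (C11at_qe _ z)). }
assert (Lk : line_cont k y).
{ intros z Hz; apply C11at_Ccont with (dquot' h f f' w), C11at_dquot; auto.
  apply qe_neq_Im; auto; rewrite Hz; unfold y; lra. }
assert (Lff : line_cont f y) by (intros z _; apply C11at_Ccont with f'; apply Hf).
assert (LM : forall u v, line_cont u y -> line_cont v y -> line_cont (fun z => u z * v z) y).
{ intros u v Hu Hv z Hz; apply Ccont_mult; auto. }
assert (Le1 : line_cont e1 y) by (intros z _; apply (C11at_Ccont _ _ _ (C11at_qe _ z))).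
assert (LC : forall d : C, line_cont (fun _ => d) y) by (intros d z _; apply Ccont_const).
(* The coefficients [A] must not depend on w; their integrals are moved here from [0, h] at height 1
   to the window around w at height [y]. *)
assert (AE : forall n, A n = lineint (fun z => f z * e n z) a b y).
{ intros n; unfold A, b; symmetry.
  rewrite lineint_periodic_shift; [|exact y0|auto|].
  - apply (lineint_const _ (fun z => f' z * e n z + f z * (RtoC (- (INR n * s)) * Ci * e n z))
      0 (INR h) 1 Rlt_0_1); auto; try lra.
    + intros; apply C11at_mult; [apply Hf|apply C11at_qe].
    + intros; apply Ccont_mult; [apply C11at_Ccont with f'; apply Hf|].
      apply (C11at_Ccont _ _ _ (C11at_qe _ _)).
    + intros v pv; replace (INR h) with (0 + INR h)%R by ring.
      apply periodic_at; [exact pv|].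
      apply periodic_mult; [exact pf|now apply periodic_qe_neg].
  - intros x; apply periodic_at; [exact y0|].
    apply periodic_mult; [exact pf|now apply periodic_qe_neg]. }
assert (REL : forall z : UHP, Im z = y -> f z = f w + (qe s z - qe s w) * k z).
{ intros z Hz; assert (N : qe s z <> qe s w)
    by (apply qe_neq_Im; auto; rewrite Hz; unfold y; lra).
  unfold k, dquot; fold s; destruct (excluded_middle_informative _) as [X|_]; [contradiction|].
  field; now apply Csub_neq_0. }
assert (LP : forall u v, line_cont u y -> line_cont v y -> line_cont (fun z => u z + v z) y).
{ intros u v Hu Hv z Hz; apply Ccont_plus; auto. }
(* The function [g] stands for e times e^-n: it is e itself when n = 0 and e^-(n-1) otherwise, which
   gives the two cases of the recursion. *)
assert (SPLIT : forall n g, line_cont g y -> (forall z : UHP, qe s z * e n z = g z) ->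
  A n = f w * lineint (e n) a b y +
        (lineint (fun z => k z * g z) a b y + - qe s w * c n)).
{ intros n g Lg Hg; rewrite AE; unfold c.
  rewrite <- (lineint_scal (f w)), <- (lineint_scal (- qe s w)) by auto.
  rewrite <- (lineint_plus (fun z => k z * g z)) by auto.
  rewrite <- (lineint_plus (fun z => f w * e n z)) by auto.
  apply lineint_ext; [exact y0|]; intros z Hz; rewrite (REL z Hz), <- Hg; ring. }
assert (A0 : A O = RtoC (INR h) * f w + cm - qe s w * c O).
{ rewrite (SPLIT O e1 Le1).
  - fold cm; unfold e, b; unfold s; rewrite lineint_qe_neg by auto; simpl; ring.
  - intros z; unfold e, e1; rewrite qe_freq_0; ring. }
assert (AS : forall n, A (S n) = c n - qe s w * c (S n)).
{ intros n; rewrite (SPLIT (S n) (e n) (Le n)).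
  - fold (c n); unfold e, b; unfold s; rewrite lineint_qe_neg by auto; simpl; ring.
  - intros z; unfold e; rewrite <- qe_plus; f_equal; rewrite S_INR; ring. }
(* [cm] is the coefficient c_(-1). The limit of f at i oo enters here: k e tends to 0, so the
   integral, being independent of the height, is bounded by half its own modulus. *)
assert (CM : cm = 0).
{ apply Cmod_eq_0, Rle_antisym; [|apply Cmod_ge_0].
  apply Rnot_lt_le; intros POS.
  assert (T : climit Finf (fun z => k z * e1 z) 0).
  { assert (E0 : 0 - qe s w <> 0) by (apply Csub_neq_0; intros Z; apply (qe_neq_0 s w); now rewrite Z).
    replace (RtoC 0) with ((c0 - f w) / (0 - qe s w) * 0) by ring.
    apply climit_mult; [typeclasses eauto| |now apply tends_qe].
    apply (climit_ext_ev Finf (fun z => (f z - f w) / (qe s z - qe s w))).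
    - generalize (Finf_above (Im w + 1)); apply filter_imp; intros z Hz.
      unfold k, dquot; fold s; destruct (excluded_middle_informative _) as [X|_]; [|reflexivity].
      exfalso; revert X; apply qe_neq_Im; auto; lra.
    - apply climit_div; [typeclasses eauto|exact E0| |];
        (apply climit_minus; [typeclasses eauto| |apply climit_const; typeclasses eauto]).
      + exact Lf. + now apply tends_qe. }
  assert (t0 : 0 < Cmod cm / (4 * INR h)) by (apply Rdiv_lt_0_compat; lra).
  destruct (T _ t0 (Rabs (Re w) + INR h)%R) as [Y HY].
  assert (v1 := Rmax_l (Im w + 1) Y); assert (v2 := Rmax_r (Im w + 1) Y).
  set (v := Rmax (Im w + 1) Y) in *.
  assert (CV : cm = lineint (fun z => k z * e1 z) a b v).
  { unfold cm, b, a, k; apply dquot_line_const with (fun z => RtoC s * Ci * qe s z);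
      auto; try lra.
    - intros; apply C11at_qe. - now apply periodic_qe1. }
  assert (BD : Cmod cm <= 2 * (b - a) * (Cmod cm / (4 * INR h))).
  { rewrite CV at 1; apply lineint_bound; [unfold b; lra|lra| |].
    - intros z Hz; apply Ccont_mult; [|apply (C11at_Ccont _ _ _ (C11at_qe _ z))].
      apply C11at_Ccont with (dquot' h f f' w), C11at_dquot; auto.
      apply qe_neq_Im; auto; rewrite Hz; lra.
    - intros z Rz Hz; left; replace (k z * e1 z) with (k z * e1 z - 0) by ring.
      apply HY; [|rewrite Hz; lra].
      unfold b, a in Rz; apply Rabs_le.
      assert (V1 := Rle_abs (Re w)); assert (V2 := Rle_abs (- Re w)).
      rewrite Rabs_Ropp in V2; lra. }
  replace (2 * (b - a) * (Cmod cm / (4 * INR h)))%R with (Cmod cm / 2)%R in BD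
    by (unfold b; field; lra).
  lra. }
exists c; split.
- destruct (line_bounded k a b y ltac:(unfold b; lra) y0 Lk) as (B & B0 & HB).
  exists (2 * (b - a) * B)%R; split.
  { repeat apply Rmult_le_pos; try lra; unfold b; lra. }
  intros n; unfold c; rewrite (Rmult_assoc (2 * (b - a))).
  apply (lineint_bound (fun z => k z * e n z) a b y); [unfold b; lra|exact y0|auto|].
  intros z Rz Hz; rewrite Cmod_mult; unfold e; rewrite Cmod_qe.
  apply Rmult_le_compat; auto using Cmod_ge_0.
  + left; apply exp_pos.
  + apply exp_le; rewrite Hz; apply Req_le; unfold y; ring.
- intros M; induction M as [|M IH].
  + simpl; rewrite A0, CM, Rmult_0_l, Rmult_1_l, qe_0; ring.
  + change (csum ?u (S (S M))) with (csum u (S M) + u (S M)).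
    rewrite IH; cbv beta; rewrite AS.
    replace (INR (S (S M)) * s)%R with (s + INR (S M) * s)%R
      by (rewrite (S_INR (S M)); ring).
    rewrite qe_plus; ring.
Qed.

Lemma qexpansion (h : nat) (f : UHP -> C) (c : C) :
  (1 <= h)%nat -> C11 f -> periodic h f -> climit Finf f c ->
  exists a, has_qexp h f a /\ a O = c.
Proof.
intros h1 [f' Hf] pf Lf.
assert (h0 : 0 < INR h) by (apply lt_0_INR; lia).
assert (hC : RtoC (INR h) <> 0) by (intros Z; apply RtoC_inj in Z; lra).
set (A := fun n => lineint (fun z => f z * qe (- (INR n * freq h)) z) 0 (INR h) 1).
assert (s0 := freq_pos h h1).
assert (Q : has_qexp h f (fun n => / RtoC (INR h) * A n)).
{ apply has_qexp_of_climit; intros w eps e0.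
  destruct (qexpansion_partial_sum h f f' c w h1 Hf pf Lf) as (d & (B & B0 & HB) & HS).
  fold A in HS.
  assert (w0 := uhp_pos w).
  set (t := (freq h * (Im w / 2))%R).
  assert (t0 : 0 < t) by (apply Rmult_lt_0_compat; lra).
  assert (q0 : 0 < eps * INR h / (B + 1))
    by (apply Rdiv_lt_0_compat; [apply Rmult_lt_0_compat|]; lra).
  destruct (exp_decay t _ t0 q0) as [Y HY].
  destruct (INR_unbounded Y) as [N HN].
  exists N; intros n Hn.
  rewrite (csum_ext _ (fun i => / RtoC (INR h) * (A i * qe (INR i * freq h) w)))
    by (intros; ring).
  rewrite csum_mult, HS.
  replace (/ RtoC (INR h) * (RtoC (INR h) * f w - d n * qe (INR (S n) * freq h) w) - f w)
    with (- (/ RtoC (INR h) * (d n * qe (INR (S n) * freq h) w))) by (field; exact hC).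
  rewrite Cmod_opp, !Cmod_mult, Cmod_inv, Cmod_R, Rabs_pos_eq, Cmod_qe by (lra || exact hC).
  apply Rmult_lt_reg_l with (1 := h0); rewrite <- Rmult_assoc, Rinv_r, Rmult_1_l by lra.
  assert (n1 : Y <= INR n) by (apply le_INR in Hn; lra).
  specialize (HY _ n1); specialize (HB n).
  assert (P := exp_pos (- (INR (S n) * freq h * Im w))).
  apply Rle_lt_trans with (B * exp (INR n * freq h * (Im w / 2)) *
    exp (- (INR (S n) * freq h * Im w)))%R.
  { apply Rmult_le_compat_r; lra. }
  rewrite Rmult_assoc, <- exp_plus.
  apply Rle_lt_trans with (B * exp (- (t * INR n)))%R.
  { apply Rmult_le_compat_l; [exact B0|]; apply exp_le; unfold t; rewrite S_INR.
    assert (0 <= freq h * Im w) by (apply Rmult_le_pos; lra). lra. }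
  apply Rle_lt_trans with ((B + 1) * exp (- (t * INR n)))%R.
  { apply Rmult_le_compat_r; [left; apply exp_pos|lra]. }
  replace (INR h * eps)%R with ((B + 1) * (eps * INR h / (B + 1)))%R by (field; lra).
  apply Rmult_lt_compat_l; lra. }
eexists; split; [exact Q|].
apply (climit_unique Finf f); [|exact Lf].
assert (L := has_qexp_leading h f _ 0 h1 Q ltac:(intros; lia)).
revert L; apply climit_ext; [typeclasses eauto|]; intros z.
rewrite qe_freq_0; ring.
Qed.

End QExpansionPrinciple.

(** * The action of SL2(Z) and the slash operator *)

Section Slash.
Local Open Scope R_scope.
Local Open Scope C_scope.

Lemma Cpow_S (x : C) (n : nat) : x ^ S n = x * x ^ n.
Proof. reflexivity. Qed.

Lemma Cpow_mult_distr (x y : C) (n : nat) : (x * y) ^ n = x ^ n * y ^ n.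
Proof. induction n as [|n IH]; [simpl; ring|rewrite !Cpow_S, IH; ring]. Qed.

Lemma Cpow_add (x : C) (m n : nat) : x ^ (m + n) = x ^ m * x ^ n.
Proof. induction m as [|m IH]; [simpl; ring|simpl Nat.add; rewrite !Cpow_S, IH; ring]. Qed.

Lemma Cpow_neq_0 (x : C) (n : nat) : x <> 0 -> x ^ n <> 0.
Proof.
intros nz; induction n as [|n IH]; [simpl; intros Z; apply RtoC_inj in Z; lra|].
rewrite Cpow_S; now apply Cmult_neq_0.
Qed.

Lemma ZtoC_plus (a b : Z) : ZtoC (a + b) = ZtoC a + ZtoC b.
Proof. unfold ZtoC; now rewrite plus_IZR, RtoC_plus. Qed.

Lemma ZtoC_mult (a b : Z) : ZtoC (a * b) = ZtoC a * ZtoC b.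
Proof. unfold ZtoC; now rewrite mult_IZR, RtoC_mult. Qed.

Lemma ZtoC_opp (a : Z) : ZtoC (- a) = - ZtoC a.
Proof. unfold ZtoC; now rewrite opp_IZR, RtoC_opp. Qed.

Lemma SL2Z_det_C (g : SL2Z) :
  ZtoC (sl_a g) * ZtoC (sl_d g) - ZtoC (sl_b g) * ZtoC (sl_c g) = 1.
Proof.
replace (ZtoC (sl_a g) * ZtoC (sl_d g) - ZtoC (sl_b g) * ZtoC (sl_c g))
  with (ZtoC (sl_a g * sl_d g + - (sl_b g * sl_c g)))
  by (rewrite ZtoC_plus, ZtoC_opp, !ZtoC_mult; ring).
replace (sl_a g * sl_d g + - (sl_b g * sl_c g))%Z with 1%Z
  by (rewrite <- (sl_det g); ring).
reflexivity.
Qed.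

Lemma SL2Z_ext (g h : SL2Z) :
  sl_a g = sl_a h -> sl_b g = sl_b h -> sl_c g = sl_c h -> sl_d g = sl_d h -> g = h.
Proof.
destruct g, h; simpl; intros; subst; f_equal; apply proof_irrelevance.
Qed.

Lemma sl_mul_det (g h : SL2Z) :
  ((sl_a g * sl_a h + sl_b g * sl_c h) * (sl_c g * sl_b h + sl_d g * sl_d h)
   - (sl_a g * sl_b h + sl_b g * sl_d h) * (sl_c g * sl_a h + sl_d g * sl_c h) = 1)%Z.
Proof.
transitivity ((sl_a g * sl_d g - sl_b g * sl_c g) * (sl_a h * sl_d h - sl_b h * sl_c h))%Z;
  [ring|rewrite !sl_det; reflexivity].
Qed.

Definition sl_mul (g h : SL2Z) : SL2Z := mkSL2Z _ _ _ _ (sl_mul_det g h).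

Lemma sl_inv_det (g : SL2Z) : (sl_d g * sl_a g - - sl_b g * - sl_c g = 1)%Z.
Proof. rewrite <- (sl_det g); ring. Qed.

Definition sl_inv (g : SL2Z) : SL2Z := mkSL2Z _ _ _ _ (sl_inv_det g).

Lemma sl_T_det (n : Z) : (1 * 1 - n * 0 = 1)%Z.
Proof. ring. Qed.

(** [sl_T 0] serves as the identity matrix. *)
Definition sl_T (n : Z) : SL2Z := mkSL2Z 1 n 0 1 (sl_T_det n).

Lemma sl_mul_assoc (g h k : SL2Z) : sl_mul g (sl_mul h k) = sl_mul (sl_mul g h) k.
Proof. apply SL2Z_ext; simpl; ring. Qed.

Lemma sl_mul_inv_l (g : SL2Z) : sl_mul (sl_inv g) g = sl_T 0.
Proof. apply SL2Z_ext; simpl; rewrite <- ?(sl_det g); ring. Qed.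

Lemma sl_mul_1_r (g : SL2Z) : sl_mul g (sl_T 0) = g.
Proof. apply SL2Z_ext; simpl; ring. Qed.

Lemma moebius_den_neq_0 (g : SL2Z) (tau : UHP) : moebius_den g tau <> 0.
Proof.
intros Z; assert (P := moebius_den_norm_pos g tau); rewrite Z in P; simpl in P; lra.
Qed.

Lemma moebius_val (g : SL2Z) (tau : UHP) :
  uhp_val (moebius g tau) = moebius_num g tau / moebius_den g tau.
Proof. reflexivity. Qed.

Lemma moebius_den_mul (g h : SL2Z) (tau : UHP) :
  moebius_den (sl_mul g h) tau = moebius_den g (moebius h tau) * moebius_den h tau.
Proof.
assert (N := moebius_den_neq_0 h tau).
unfold moebius_den at 1 2; rewrite moebius_val.
replace ((ZtoC (sl_c g) * (moebius_num h tau / moebius_den h tau) + ZtoC (sl_d g))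
   * moebius_den h tau)
  with (ZtoC (sl_c g) * moebius_num h tau + ZtoC (sl_d g) * moebius_den h tau)
  by (field; exact N).
unfold moebius_num, moebius_den; simpl; rewrite !ZtoC_plus, !ZtoC_mult; ring.
Qed.

Lemma moebius_num_mul (g h : SL2Z) (tau : UHP) :
  moebius_num (sl_mul g h) tau = moebius_num g (moebius h tau) * moebius_den h tau.
Proof.
assert (N := moebius_den_neq_0 h tau).
unfold moebius_num at 1 2; rewrite moebius_val.
replace ((ZtoC (sl_a g) * (moebius_num h tau / moebius_den h tau) + ZtoC (sl_b g))
   * moebius_den h tau)
  with (ZtoC (sl_a g) * moebius_num h tau + ZtoC (sl_b g) * moebius_den h tau)
  by (field; exact N).
unfold moebius_num, moebius_den; simpl; rewrite !ZtoC_plus, !ZtoC_mult; ring.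
Qed.

Lemma moebius_mul (g h : SL2Z) (tau : UHP) :
  moebius (sl_mul g h) tau = moebius g (moebius h tau).
Proof.
apply UHP_ext; rewrite (moebius_val g), (moebius_val (sl_mul g h)).
rewrite moebius_num_mul, moebius_den_mul.
assert (N := moebius_den_neq_0 h tau); assert (M := moebius_den_neq_0 g (moebius h tau)).
field; auto.
Qed.

Lemma slash_mul (k : nat) (g h : SL2Z) (f : UHP -> C) :
  slash k g (slash k h f) = slash k (sl_mul h g) f.
Proof.
apply functional_extensionality; intros tau; unfold slash.
rewrite moebius_mul, moebius_den_mul, Cpow_mult_distr.
assert (N := moebius_den_neq_0 g tau); assert (M := moebius_den_neq_0 h (moebius g tau)).
field; split; apply Cpow_neq_0; auto.
Qed.

Lemma moebius_den_T (n : Z) (tau : UHP) : moebius_den (sl_T n) tau = 1.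
Proof.
unfold moebius_den, ZtoC; cbn [sl_T sl_c sl_d].
change (IZR 0) with 0%R; change (IZR 1) with 1%R; ring.
Qed.

Lemma moebius_T (n : Z) (tau : UHP) : uhp_val (moebius (sl_T n) tau) = tau + ZtoC n.
Proof.
rewrite moebius_val, moebius_den_T; unfold moebius_num; cbn [sl_T sl_a sl_b].
change (ZtoC 1) with (RtoC 1); field.
Qed.

Lemma Cpow_1_l (n : nat) : RtoC 1 ^ n = 1.
Proof. induction n as [|n IH]; [reflexivity|rewrite Cpow_S, IH; ring]. Qed.

Lemma slash_T (k : nat) (n : Z) (f : UHP -> C) (tau : UHP) :
  slash k (sl_T n) f tau = f (moebius (sl_T n) tau).
Proof. unfold slash; rewrite moebius_den_T, Cpow_1_l; field. 
Qed.

Lemma slash_1 (k : nat) (f : UHP -> C) : slash k (sl_T 0) f = f.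
Proof.
apply functional_extensionality; intros tau; rewrite slash_T; f_equal.
apply UHP_ext; rewrite moebius_T; unfold ZtoC; ring.
Qed.

Lemma sl_neg1_det : (-1 * -1 - 0 * 0 = 1)%Z.
Proof. reflexivity. Qed.

(** It acts trivially on the half-plane, but yields the parity of the weight and the second row (0,
    -1) in the principal part of the Poincare series. *)
Definition sl_neg1 : SL2Z := mkSL2Z (-1) 0 0 (-1) sl_neg1_det.

Lemma ZtoC_m1 : ZtoC (-1) = - (1).
Proof. exact (ZtoC_opp 1). Qed.

Lemma moebius_den_neg1 (z : UHP) : moebius_den sl_neg1 z = - (1).
Proof.
unfold moebius_den, sl_neg1; cbn [sl_c sl_d]; rewrite ZtoC_m1.
change (ZtoC 0) with (RtoC 0); ring.
Qed.

Lemma moebius_neg1 (z : UHP) : moebius sl_neg1 z = z.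
Proof.
apply UHP_ext; rewrite moebius_val, moebius_den_neg1; unfold moebius_num, sl_neg1.
cbn [sl_a sl_b]; rewrite ZtoC_m1; change (ZtoC 0) with (RtoC 0); field.
Qed.

Lemma slash_fmul (k l : nat) (g : SL2Z) (f1 f2 : UHP -> C) :
  slash (k + l) g (fmul f1 f2) = fmul (slash k g f1) (slash l g f2).
Proof.
apply functional_extensionality; intros tau; unfold slash, fmul.
assert (N := moebius_den_neq_0 g tau); rewrite Cpow_add.
field; split; apply Cpow_neq_0; auto.
Qed.

Lemma slash_fadd (k : nat) (g : SL2Z) (f1 f2 : UHP -> C) :
  slash k g (fadd f1 f2) = fadd (slash k g f1) (slash k g f2).
Proof.
apply functional_extensionality; intros tau; unfold slash, fadd, Cdiv; ring.
Qed.

Lemma slash_scal (k : nat) (g : SL2Z) (c : C) (f : UHP -> C) :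
  slash k g (fun z => c * f z) = fun z => c * slash k g f z.
Proof.
apply functional_extensionality; intros tau; unfold slash, Cdiv; ring.
Qed.

Lemma slash_div (k l : nat) (g : SL2Z) (f1 f2 : UHP -> C) :
  (forall z, f2 z <> 0) ->
  slash k g (fun z => f1 z / f2 z) = fun z => slash (l + k) g f1 z / slash l g f2 z.
Proof.
intros nz; apply functional_extensionality; intros tau; unfold slash.
assert (N := moebius_den_neq_0 g tau); rewrite Cpow_add.
field; repeat split; try apply Cpow_neq_0; auto.
Qed.

(** Bounds are asked of mu' and of the remainder of mu, not of mu itself as in [taylor1]: for mu =
    gamma in SL2(Z) they hold uniformly in gamma, while the values gamma z are unbounded. The 4 L^2
    comes from |mu w - mu z| <= 2 L |w - z|. *)
Lemma taylor1_comp (S T : UHP -> Prop) (K L : R) (f f' mu' : UHP -> C) (mu : UHP -> UHP) :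
  0 <= L ->
  (forall z w, S z -> S w -> (Cmod (w - z) <= 1)) ->
  (forall z, S z -> T (mu z)) ->
  (forall z w, S z -> S w -> (Cmod (mu' z) <= L) /\
     (Cmod (mu w - mu z - (w - z) * mu' z) <= L * Cmod (w - z) ^ 2)) ->
  taylor1 T K f f' ->
  taylor1 S (K * (1 + L + 4 * L ^ 2)) (fun z => f (mu z)) (fun z => f' (mu z) * mu' z).
Proof.
intros L0 Sd ST Hmu [K0 H].
assert (L2 : 0 <= L ^ 2) by apply pow2_ge_0.
assert (KL : 0 <= K * L) by now apply Rmult_le_pos.
assert (KL2 : 0 <= K * L ^ 2) by now apply Rmult_le_pos.
split; [apply Rmult_le_pos; lra|]; intros z Sz.
destruct (H (mu z) (ST z Sz)) as (A & B & D).
split; [nra|split].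
{ rewrite Cmod_mult; apply Rle_trans with (K * L)%R; [|nra].
  apply Rmult_le_compat; auto using Cmod_ge_0; now apply (Hmu z z). }
intros w Sw; specialize (D (mu w) (ST w Sw)).
destruct (Hmu z w Sz Sw) as [M1 M2]; specialize (Sd z w Sz Sw).
set (d := Cmod (w - z)) in *; assert (d0 : 0 <= d) by apply Cmod_ge_0.
assert (LIP : Cmod (mu w - mu z) <= 2 * L * d).
{ replace (mu w - mu z) with ((mu w - mu z - (w - z) * mu' z) + (w - z) * mu' z) by ring.
  eapply Rle_trans; [apply Cmod_triangle|]; rewrite Cmod_mult; fold d.
  assert (L * d ^ 2 <= L * d) by (apply Rmult_le_compat_l; nra).
  assert (d * Cmod (mu' z) <= d * L) by (apply Rmult_le_compat_l; lra). lra. }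
replace (f (mu w) - f (mu z) - (w - z) * (f' (mu z) * mu' z)) with
  ((f (mu w) - f (mu z) - (mu w - mu z) * f' (mu z))
   + f' (mu z) * (mu w - mu z - (w - z) * mu' z)) by ring.
eapply Rle_trans; [apply Cmod_triangle|]; rewrite Cmod_mult.
assert (T1 : Cmod (f' (mu z)) * Cmod (mu w - mu z - (w - z) * mu' z) <= K * (L * d ^ 2))
  by (apply Rmult_le_compat; auto using Cmod_ge_0).
assert (T2 : Cmod (mu w - mu z) ^ 2 <= 4 * L ^ 2 * d ^ 2).
{ replace (4 * L ^ 2 * d ^ 2)%R with ((2 * L * d) ^ 2)%R by ring.
  apply pow_incr; split; [apply Cmod_ge_0|exact LIP]. }
assert (K * Cmod (mu w - mu z) ^ 2 <= K * (4 * L ^ 2 * d ^ 2))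
  by (apply Rmult_le_compat_l; lra).
assert (0 <= K * d ^ 2) by (apply Rmult_le_pos; [lra|apply pow2_ge_0]).
nra.
Qed.

Lemma C11_affine (a b : C) : C11 (fun z => a * z + b).
Proof.
exists (fun _ => a); intros z0.
assert (P := Cmod_ge_0 (a * z0 + b)); assert (Q := Cmod_ge_0 a).
exists 1%R, (Cmod (a * z0 + b) + Cmod a)%R; split; [lra|].
split; [lra|]; intros z Hz; unfold near in Hz; split; [|split; [lra|]].
- replace (a * z + b) with (a * z0 + b + a * (z - z0)) by ring.
  eapply Rle_trans; [apply Cmod_triangle|]; rewrite Cmod_mult; nra.
- intros w _; replace (a * w + b - (a * z + b) - (w - z) * a) with (RtoC 0) by ring.
  rewrite Cmod_0; apply Rmult_le_pos; [lra|apply pow2_ge_0].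
Qed.

Lemma C11_comp (f : UHP -> C) (mu : UHP -> UHP) :
  C11 f -> C11 (fun z => mu z) -> C11 (fun z => f (mu z)).
Proof.
intros [f' Hf] [mu' Hm]; exists (fun z => f' (mu z) * mu' z); intros z0.
destruct (Hf (mu z0)) as (r & K & r0 & H).
destruct (C11at_continuous _ _ z0 r (Hm z0) r0) as (t & t0 & Ht).
destruct (Hm z0) as (s & L & s0 & [L0 HL]).
assert (m1 := Rmin_l s t); assert (m2 := Rmin_r s t).
assert (m3 := Rmin_l (Rmin s t) (1/2)); assert (m4 := Rmin_r (Rmin s t) (1/2)).
set (m := Rmin (Rmin s t) (1/2)) in *.
exists m, (K * (1 + L + 4 * L ^ 2))%R; split.
{ unfold m; apply Rmin_glb_lt; [apply Rmin_glb_lt|]; lra. }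
apply taylor1_comp with (near (mu z0) r); auto.
- intros z w; apply near_diam; lra.
- intros z Hz; apply Ht; unfold near in *; lra.
- intros z w Hz Hw; destruct (HL z) as (_ & A & B); [unfold near in *; lra|].
  split; [exact A|apply B; unfold near in *; lra].
Qed.

Lemma C11_slash (k : nat) (g : SL2Z) (f : UHP -> C) : C11 f -> C11 (slash k g f).
Proof.
intros Hf; assert (J : C11 (fun z => moebius_den g z)) by apply C11_affine.
apply C11_div; [intros; now apply Cpow_neq_0, moebius_den_neq_0| |].
- apply C11_comp; [exact Hf|].
  apply (C11_div (fun z => moebius_num g z)); [apply moebius_den_neq_0|apply C11_affine|exact J].
- induction k as [|k IH]; [exact (C11_const 1)|exact (C11_mult _ _ J IH)].
Qed.

End Slash.

(** * Modular forms through limits at the cusps, and orders at oo *)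

Section ModularForms.
Local Open Scope R_scope.
Local Open Scope C_scope.

Lemma C11_holomorphic (f : UHP -> C) : C11 f -> holomorphic f.
Proof.
intros [f' H] tau; destruct (H tau) as (r & K & r0 & [K0 T]).
assert (N0 : near tau r tau) by now apply near_refl.
destruct (T tau N0) as (_ & _ & D).
exists (f' tau); split; [apply is_linear_scal_l|].
intros z Hz; apply (is_filter_lim_locally_unique (V := AbsRing_NormedModule C_AbsRing)) in Hz; subst z.
intros eps; assert (e0 := cond_pos eps).
assert (p := uhp_pos tau).
assert (t0 : 0 < eps / (K + 1)) by (apply Rdiv_lt_0_compat; lra).
assert (d0 : 0 < Rmin (Rmin r (Im tau)) (eps / (K + 1)))
  by (repeat apply Rmin_glb_lt; lra).
exists (mkposreal _ d0); intros w Hw.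
change (Cmod (w - tau) < Rmin (Rmin r (Im tau)) (eps / (K + 1))) in Hw.
change (Cmod (extend f w - extend f tau - (w - tau) * f' tau) <= eps * Cmod (w - tau)).
assert (A := Rmin_l (Rmin r (Im tau)) (eps / (K + 1))).
assert (B := Rmin_r (Rmin r (Im tau)) (eps / (K + 1))).
assert (A' := Rmin_l r (Im tau)); assert (B' := Rmin_r r (Im tau)).
assert (pw : 0 < Im w).
{ assert (L := Im_le_Cmod (w - tau)); rewrite Im_minus in L.
  assert (L' : Rabs (Im w - Im tau) < Im tau) by lra.
  apply Rabs_def2 in L'; lra. }
rewrite extend_val.
replace (extend f w) with (f (mkUHP w pw)) by (symmetry; apply (extend_val f (mkUHP w pw))).
specialize (D (mkUHP w pw) ltac:(unfold near; simpl; lra)); simpl in D.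
eapply Rle_trans; [exact D|].
assert (P := Cmod_ge_0 (w - tau)).
assert ((K + 1) * Cmod (w - tau) <= eps).
{ apply Rle_trans with ((K + 1) * (eps / (K + 1)))%R; [|apply Req_le; field; lra].
  apply Rmult_le_compat_l; lra. }
nra.
Qed.

Lemma has_qexp_limit (h : nat) (f : UHP -> C) (a : nat -> C) :
  (1 <= h)%nat -> has_qexp h f a -> climit Finf f (a O).
Proof.
intros h1 Q; assert (L := has_qexp_leading h f a 0 h1 Q ltac:(intros; lia)).
revert L; apply climit_ext; [typeclasses eauto|]; intros z.
rewrite qe_freq_0; ring.
Qed.

Definition Gamma0_inv (N k : nat) (f : UHP -> C) : Prop :=
  forall g : SL2Z, in_Gamma0 N g -> slash k g f = f.

(* Gamma(N) is normal: alpha T^N alpha^-1 lies in Gamma0(N). *)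
Lemma slash_periodic (N k : nat) (f : UHP -> C) (alpha : SL2Z) :
  Gamma0_inv N k f -> periodic N (slash k alpha f).
Proof.
intros inv z z' E.
assert (Ez : z' = moebius (sl_T (Z.of_nat N)) z).
{ apply UHP_ext; rewrite moebius_T, E; unfold ZtoC; now rewrite INR_IZR_INZ. }
rewrite Ez, <- (slash_T k), slash_mul.
set (g := sl_mul (sl_mul alpha (sl_T (Z.of_nat N))) (sl_inv alpha)).
replace (sl_mul alpha (sl_T (Z.of_nat N))) with (sl_mul g alpha).
- rewrite <- slash_mul, inv; [reflexivity|].
  exists (- (sl_c alpha * sl_c alpha))%Z; unfold g; simpl; ring.
- unfold g; now rewrite <- sl_mul_assoc, sl_mul_inv_l, sl_mul_1_r.
Qed.

(** One direction is the regularity of q-expansions and their constant term, the other the expansion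
    principle for the N-periodic slashes. Unlike expansions, limits pass to products and quotients
    at once. *)
Lemma modular_form_iff (N k : nat) (f : UHP -> C) : (1 <= N)%nat ->
  modular_form N k f <->
  (C11 f /\ Gamma0_inv N k f /\ forall alpha, exists c, climit Finf (slash k alpha f) c).
Proof.
intros N1; split.
- intros (_ & inv & Q); split; [|split; [exact inv|]].
  + destruct (Q (sl_T 0)) as [a Ha]; rewrite slash_1 in Ha; now apply has_qexp_C11 with N a.
  + intros alpha; destruct (Q alpha) as [a Ha]; exists (a O); now apply has_qexp_limit with N.
- intros (H & inv & L); split; [now apply C11_holomorphic|split; [exact inv|]].
  intros alpha; destruct (L alpha) as [c Hc].
  destruct (qexpansion N (slash k alpha f) c N1) as (a & Ha & _); eauto.
  + now apply C11_slash.
  + now apply slash_periodic.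
Qed.

Lemma zero_at_cusp_iff (N k : nat) (f : UHP -> C) (alpha : SL2Z) : (1 <= N)%nat ->
  modular_form N k f ->
  (zero_at_cusp N k f alpha <-> climit Finf (slash k alpha f) 0).
Proof.
intros N1 M; split.
- intros (a & Ha & <-); now apply has_qexp_limit with N.
- intros L; apply (modular_form_iff N k f N1) in M; destruct M as (H & inv & _).
  destruct (qexpansion N (slash k alpha f) 0 N1) as (a & Ha & A0); auto.
  + now apply C11_slash.
  + now apply slash_periodic.
  + now exists a.
Qed.

Lemma cusp_form_iff (N k : nat) (f : UHP -> C) : (1 <= N)%nat ->
  cusp_form N k f <->
  (C11 f /\ Gamma0_inv N k f /\ forall alpha, climit Finf (slash k alpha f) 0).
Proof.
intros N1; split.
- intros (M & Z).
  assert (M' := M); apply (modular_form_iff N k f N1) in M'; destruct M' as (H & inv & _).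
  split; [exact H|split; [exact inv|]]; intros alpha.
  now apply (zero_at_cusp_iff N k f alpha N1 M).
- intros (H & inv & Z).
  assert (M : modular_form N k f) by (apply modular_form_iff; eauto).
  split; [exact M|]; intros alpha; now apply zero_at_cusp_iff.
Qed.

(** The translation T lies in Gamma0(N), so the form is 1-periodic and expands in q itself, and not
    only in q^(1/N); valuations refer to this expansion. *)
Lemma modular_qexp1 (N k : nat) (f : UHP -> C) : (1 <= N)%nat ->
  modular_form N k f -> exists a, has_qexp 1 f a /\ climit Finf f (a O).
Proof.
intros N1 M; apply (modular_form_iff N k f N1) in M; destruct M as (H & inv & L).
destruct (L (sl_T 0)) as [c Hc]; rewrite slash_1 in Hc.
destruct (qexpansion 1 f c (le_n 1) H) as (a & Ha & A0); auto.
- intros z z' E.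
  assert (Ez : z' = moebius (sl_T 1) z).
  { apply UHP_ext; rewrite moebius_T, E; reflexivity. }
  rewrite Ez, <- (slash_T k), inv; [reflexivity|]; apply Z.divide_0_r.
- exists a; rewrite A0; auto.
Qed.

Lemma modular_form_fmul (N k l : nat) (f g : UHP -> C) : (1 <= N)%nat ->
  modular_form N k f -> modular_form N l g -> modular_form N (k + l) (fmul f g).
Proof.
intros N1 F G; apply modular_form_iff; [exact N1|].
apply modular_form_iff in F; [|exact N1]; apply modular_form_iff in G; [|exact N1].
destruct F as (F1 & F2 & F3), G as (G1 & G2 & G3).
split; [now apply C11_mult|split].
- intros a Ha; now rewrite slash_fmul, F2, G2.
- intros a; rewrite slash_fmul; destruct (F3 a) as [c Hc], (G3 a) as [d Hd].
  exists (c * d); now apply climit_mult; [typeclasses eauto| |].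
Qed.

Lemma cusp_form_fmul (N k l : nat) (f g : UHP -> C) : (1 <= N)%nat ->
  cusp_form N k f -> modular_form N l g -> cusp_form N (k + l) (fmul f g).
Proof.
intros N1 F G; apply cusp_form_iff; [exact N1|].
apply cusp_form_iff in F; [|exact N1]; apply modular_form_iff in G; [|exact N1].
destruct F as (F1 & F2 & F3), G as (G1 & G2 & G3).
split; [now apply C11_mult|split].
- intros a Ha; now rewrite slash_fmul, F2, G2.
- intros a; rewrite slash_fmul; destruct (G3 a) as [d Hd].
  replace (RtoC 0) with (0 * d) by ring.
  now apply climit_mult; [typeclasses eauto| |].
Qed.

Lemma cusp_form_fadd (N k : nat) (f g : UHP -> C) : (1 <= N)%nat ->
  cusp_form N k f -> cusp_form N k g -> cusp_form N k (fadd f g).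
Proof.
intros N1 F G; apply cusp_form_iff; [exact N1|].
apply cusp_form_iff in F; [|exact N1]; apply cusp_form_iff in G; [|exact N1].
destruct F as (F1 & F2 & F3), G as (G1 & G2 & G3).
split; [now apply C11_plus|split].
- intros a Ha; now rewrite slash_fadd, F2, G2.
- intros a; rewrite slash_fadd.
  replace (RtoC 0) with (0 + 0) by ring.
  now apply climit_plus; [typeclasses eauto| |].
Qed.

Lemma cusp_form_scal (N k : nat) (c : C) (f : UHP -> C) : (1 <= N)%nat ->
  cusp_form N k f -> cusp_form N k (fun z => c * f z).
Proof.
intros N1 F; apply cusp_form_iff; [exact N1|].
apply cusp_form_iff in F; [|exact N1]; destruct F as (F1 & F2 & F3).
split; [apply (C11_mult (fun _ => c) f); auto using C11_const|split].
- intros a Ha; now rewrite slash_scal, F2.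
- intros a; rewrite slash_scal; replace (RtoC 0) with (c * 0) by ring.
  now apply climit_scal; [typeclasses eauto|].
Qed.

Lemma cusp_form_zero (N k : nat) : (1 <= N)%nat -> cusp_form N k fzero.
Proof.
intros N1; apply cusp_form_iff; [exact N1|].
assert (S0 : forall a, slash k a fzero = fzero).
{ intros a; apply functional_extensionality; intros tau; unfold slash, fzero, Cdiv; ring. }
split; [apply C11_const|split].
- intros a _; apply S0.
- intros a; rewrite S0; apply climit_const; typeclasses eauto.
Qed.

Lemma modular_form_fpow (N k n : nat) (f : UHP -> C) : (1 <= N)%nat ->
  modular_form N k f -> modular_form N (n * k) (fpow f n).
Proof.
intros N1 F; induction n as [|n IH].
- apply modular_form_iff; [exact N1|].
  assert (S1 : forall a, slash (0 * k) a (fpow f 0) = fpow f 0).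
  { intros a; apply functional_extensionality; intros tau; unfold slash, fpow; simpl.
    field. }
  split; [apply (C11_const 1)|split].
  + intros a _; apply S1.
  + intros a; rewrite S1; exists 1; apply climit_const; typeclasses eauto.
- change (fpow f (S n)) with (fmul f (fpow f n)).
  now apply modular_form_fmul.
Qed.

(* f = (c + o(1)) q^n at oo.  As c = 0 is allowed, this bounds the valuation of
   f from below only. *)
Definition leading (f : UHP -> C) (n : nat) (c : C) : Prop :=
  climit Finf (fun z => f z * qe (- (INR n * freq 1)) z) c.

Lemma leading_of_valuation (f : UHP -> C) (n : nat) :
  is_valuation f n -> exists c : C, c <> 0 /\ leading f n c.
Proof.
intros (a & Ha & nz & lt); exists (a n); split; [exact nz|].
now apply has_qexp_leading.
Qed.

Lemma unitary_valuation (f : UHP -> C) : unitary f -> exists n, is_valuation f n.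
Proof. intros (a & n & Ha & F & _); exists n, a; auto. Qed.

Lemma leading_fmul (f g : UHP -> C) (m n : nat) (c d : C) :
  leading f m c -> leading g n d -> leading (fmul f g) (m + n) (c * d).
Proof.
intros F G; unfold leading, fmul.
apply (climit_ext Finf (fun z => (f z * qe (- (INR m * freq 1)) z)
   * (g z * qe (- (INR n * freq 1)) z))); [ |].
- intros z; replace (- (INR (m + n) * freq 1))%R
    with (- (INR m * freq 1) + - (INR n * freq 1))%R by (rewrite plus_INR; ring).
  rewrite qe_plus; ring.
- now apply climit_mult; [typeclasses eauto| |].
Qed.

Lemma leading_fpow0 (f : UHP -> C) (c : C) (n : nat) :
  leading f 0 c -> leading (fpow f n) 0 (c ^ n).
Proof.
intros F; unfold leading, fpow.
apply (climit_ext Finf (fun z => (f z * qe (- (INR 0 * freq 1)) z) ^ n));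
  [ |].
- intros z; rewrite qe_freq_0, Cmult_1_r; ring.
- now apply climit_pow; [typeclasses eauto|].
Qed.

Lemma leading_unique (f : UHP -> C) (n : nat) (c d : C) :
  leading f n c -> leading f n d -> c = d.
Proof. apply climit_unique; typeclasses eauto. Qed.

Lemma leading_lt (f : UHP -> C) (m n : nat) (c : C) :
  (m < n)%nat -> leading f n c -> leading f m 0.
Proof.
intros mn F; unfold leading in *.
assert (s0 := freq_pos 1 (le_n 1)).
apply (climit_ext Finf (fun z => (f z * qe (- (INR n * freq 1)) z)
  * qe ((INR n - INR m) * freq 1) z)); [ |].
- intros z; rewrite <- Cmult_assoc, <- qe_plus; do 2 f_equal; ring.
- replace (RtoC 0) with (c * 0) by ring.
  apply climit_mult; [typeclasses eauto|exact F|].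
  apply tends_qe, Rmult_lt_0_compat; [|exact s0].
  apply lt_INR in mn; lra.
Qed.

Lemma leading_plus (f g : UHP -> C) (n : nat) (c d : C) :
  leading f n c -> leading g n d -> leading (fadd f g) n (c + d).
Proof.
intros F G; unfold leading, fadd.
apply (climit_ext Finf (fun z => f z * qe (- (INR n * freq 1)) z
   + g z * qe (- (INR n * freq 1)) z)); [intros; ring|].
now apply climit_plus; [typeclasses eauto| |].
Qed.

Lemma leading_scal (f : UHP -> C) (n : nat) (c d : C) :
  leading f n c -> leading (fun z => d * f z) n (d * c).
Proof.
intros F; unfold leading.
apply (climit_ext Finf (fun z => d * (f z * qe (- (INR n * freq 1)) z)));
  [intros; ring|].
now apply climit_scal; [typeclasses eauto|].
Qed.

(** Limits alone would allow f to be of order q^(n + 1/2). The coefficients a_0, ..., a_n vanish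
    successively, and the integrality of the exponents then gives the order n + 1. *)
Lemma leading_step (N k : nat) (f : UHP -> C) (n : nat) : (1 <= N)%nat ->
  modular_form N k f -> leading f n 0 -> exists c, leading f (S n) c.
Proof.
intros N1 M L; destruct (modular_qexp1 N k f N1 M) as (a & Ha & _).
assert (Z : forall m, (m <= n)%nat -> a m = 0).
{ intros m; induction m as [m IH] using lt_wf_ind; intros mn.
  apply (leading_unique f m).
  - apply has_qexp_leading; auto; intros i im; apply IH; lia.
  - destruct (Nat.eq_dec m n) as [->|ne]; [exact L|].
    apply leading_lt with n (RtoC 0); [lia|exact L]. }
exists (a (S n)); apply has_qexp_leading; auto.
intros m mn; apply Z; lia.
Qed.

Lemma cusp_form_leading0 (N k : nat) (f : UHP -> C) : (1 <= N)%nat ->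
  cusp_form N k f -> leading f 0 0.
Proof.
intros N1 H; apply cusp_form_iff in H; [|exact N1]; destruct H as (_ & _ & L).
specialize (L (sl_T 0)); rewrite slash_1 in L.
revert L; apply climit_ext; [typeclasses eauto|]; intros z.
rewrite qe_freq_0; ring.
Qed.

(* A matrix alpha with alpha(oo) equivalent to oo is g^-1 (+-T^b). *)
Lemma slash_cusp_infty (N k : nat) (f : UHP -> C) (alpha : SL2Z) :
  Gamma0_inv N k f -> cusp_equiv_infty N alpha ->
  climit Finf f 0 -> climit Finf (slash k alpha f) 0.
Proof.
intros inv (g & Hg & E) L.
assert (R : slash k alpha f = slash k (sl_mul g alpha) f)
  by (rewrite <- slash_mul, (inv g Hg); reflexivity).
rewrite R; set (h := sl_mul g alpha).
assert (hc : sl_c h = 0%Z) by exact E.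
assert (D := sl_det h); rewrite hc, Z.mul_0_r, Z.sub_0_r in D.
assert (AD : (sl_a h = 1 /\ sl_d h = 1)%Z \/ (sl_a h = -1 /\ sl_d h = -1)%Z).
{ destruct (Z.mul_eq_1 _ _ D) as [A|A]; rewrite A in D; lia. }
assert (X : exists b : Z, forall z, uhp_val (moebius h z) = z + ZtoC b /\
  Cmod (moebius_den h z) = 1%R).
{ destruct AD as [[A A']|[A A']].
  - exists (sl_b h); intros z; rewrite moebius_val; unfold moebius_num, moebius_den.
    rewrite A, A', hc; change (ZtoC 0) with (RtoC 0); change (ZtoC 1) with (RtoC 1).
    split; [field|].
    replace (0 * z + 1) with (RtoC 1) by ring; apply Cmod_1.
  - exists (- sl_b h)%Z; intros z; rewrite moebius_val, ZtoC_opp; unfold moebius_num, moebius_den.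
    rewrite A, A', hc; change (ZtoC 0) with (RtoC 0); change (-1)%Z with (- (1))%Z.
    rewrite (ZtoC_opp 1); change (ZtoC 1) with (RtoC 1).
    split; [field|].
    replace (0 * z + - (1)) with (- RtoC 1) by ring; rewrite Cmod_opp; apply Cmod_1. }
destruct X as [b X].
(* The translation by b moves the strip |Re| <= B into this wider one. *)
intros eps e0 B; destruct (L eps e0 (B + Rabs (IZR b))%R) as [Y HY].
exists Y; intros tau h1 h2.
destruct (X tau) as [X1 X2].
replace (slash k h f tau - 0) with (slash k h f tau) by ring.
assert (X3 : Cmod (moebius_den h tau ^ k) = 1%R) by (rewrite Cmod_pow, X2, pow1; reflexivity).
unfold slash; rewrite Cmod_div, X3 by (apply Cpow_neq_0, moebius_den_neq_0).
unfold Rdiv; rewrite Rinv_1, Rmult_1_r.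
replace (f (moebius h tau)) with (f (moebius h tau) - 0) by ring.
apply HY; rewrite X1; simpl.
- eapply Rle_trans; [apply Rabs_triang|]; simpl in *; unfold Re in *; lra.
- rewrite Rplus_0_r; exact h2.
Qed.

Lemma leading_climit0 (f : UHP -> C) (n : nat) (c : C) :
  (0 < n)%nat -> leading f n c -> climit Finf f 0.
Proof.
intros n0 L; apply (leading_lt f 0 n c n0) in L.
revert L; apply climit_ext; [typeclasses eauto|]; intros z.
rewrite qe_freq_0; ring.
Qed.

(* All the zeros of Delta are at oo, so that division by Delta only costs
   the vanishing at oo. *)
Lemma cusp_form_div (N rho k : nat) (Delta f : UHP -> C) (nu : nat) : (1 <= N)%nat ->
  strong_modular_form N rho Delta -> is_valuation Delta nu ->
  cusp_form N (rho + k) f -> leading f nu 0 ->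
  cusp_form N k (fun z => f z / Delta z).
Proof.
intros N1 (_ & DM & Dnz & Dcusp) Dv F L.
assert (DM' := DM); apply modular_form_iff in DM'; [|exact N1].
destruct DM' as (D1 & D2 & D3).
apply cusp_form_iff in F; [|exact N1]; destruct F as (F1 & F2 & F3).
assert (inv : Gamma0_inv N k (fun z => f z / Delta z)).
{ intros g Hg; rewrite (slash_div k rho) by exact Dnz.
  now rewrite F2, D2. }
apply cusp_form_iff; [exact N1|].
split; [now apply C11_div|split; [exact inv|]].
intros alpha; destruct (classic (cusp_equiv_infty N alpha)) as [EQ|NE].
- apply slash_cusp_infty with N; auto.
  destruct (leading_of_valuation _ _ Dv) as (d & d0 & Ld).
  replace (RtoC 0) with (0 / d) by (field; exact d0).
  apply (climit_ext Finf (fun z => (f z * qe (- (INR nu * freq 1)) z) /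
     (Delta z * qe (- (INR nu * freq 1)) z))); [ |].
  + intros z; field; split; [apply Dnz|apply qe_neq_0].
  + now apply climit_div; [typeclasses eauto| | |].
- rewrite (slash_div k rho) by exact Dnz.
  destruct (D3 alpha) as [d Hd].
  assert (d0 : d <> 0).
  { intros ->; apply (Dcusp alpha NE); now apply zero_at_cusp_iff. }
  replace (RtoC 0) with (0 / d) by (field; exact d0).
  now apply climit_div; [typeclasses eauto| | |].
Qed.

End ModularForms.

(** * Unordered sums over pairs of integers *)

Section LatticeSums.
Local Open Scope R_scope.
Local Open Scope C_scope.

Lemma climit_cauchy {J : Type} (F : (J -> Prop) -> Prop) {FF : ProperFilter F}
  (u : J -> C) :
  (forall eps, 0 < eps -> exists c, F (fun i => (Cmod (u i - c) < eps))) ->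
  exists l, climit F u l.
Proof.
intros H.
destruct (proj1 (filterlim_locally_cauchy (U := C_CompleteNormedModule) u)) as [l Hl].
- intros eps; assert (e2 : 0 < eps / 2) by (assert (P := cond_pos eps); lra).
  destruct (H _ e2) as [c Hc]; eexists; split; [exact Hc|].
  cbv beta; intros i j Hi Hj.
  apply C_NormedModule_mixin_compat1; change (Cmod (u j - u i) < eps).
  replace (u j - u i) with ((u j - c) - (u i - c)) by ring.
  unfold Cminus at 1; eapply Rle_lt_trans; [apply Cmod_triangle|].
  rewrite Cmod_opp; lra.
- exists l; apply climit_filterlim; [typeclasses eauto|exact Hl].
Qed.

Definition row : Type := (Z * Z)%type.

Lemma row_dec (p q : row) : {p = q} + {p <> q}.
Proof. decide equality; apply Z.eq_dec. Defined.

Fixpoint lsum (u : row -> C) (l : list row) : C :=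
  match l with nil => 0 | p :: l => u p + lsum u l end.

Fixpoint rsum {J : Type} (u : J -> R) (l : list J) : R :=
  match l with nil => 0%R | p :: l => (u p + rsum u l)%R end.

Lemma lsum_app (u : row -> C) (l m : list row) : lsum u (l ++ m) = lsum u l + lsum u m.
Proof. induction l as [|p l IH]; simpl; [|rewrite IH]; ring. Qed.

Lemma lsum_perm (u : row -> C) (l m : list row) : Permutation l m -> lsum u l = lsum u m.
Proof.
induction 1; simpl; try congruence; ring.
Qed.

Lemma lsum_map (u : row -> C) (s : row -> row) (l : list row) :
  lsum u (map s l) = lsum (fun p => u (s p)) l.
Proof. induction l as [|p l IH]; simpl; [|rewrite IH]; reflexivity. Qed.

Lemma lsum_mult (c : C) (u : row -> C) (l : list row) :
  lsum (fun p => c * u p) l = c * lsum u l.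
Proof. induction l as [|p l IH]; simpl; [|rewrite IH]; ring. Qed.

Lemma lsum_minus (u v : row -> C) (l : list row) :
  lsum (fun p => u p - v p) l = lsum u l - lsum v l.
Proof. induction l as [|p l IH]; simpl; [|rewrite IH]; ring. Qed.

Lemma lsum_ext (u v : row -> C) (l : list row) :
  (forall p, In p l -> u p = v p) -> lsum u l = lsum v l.
Proof.
intros H; induction l as [|p l IH]; simpl; [reflexivity|].
rewrite (H p), IH; simpl; auto; intros; apply H; simpl; auto.
Qed.

Lemma rsum_app {J : Type} (u : J -> R) (l m : list J) :
  rsum u (l ++ m) = (rsum u l + rsum u m)%R.
Proof. induction l as [|p l IH]; simpl; [|rewrite IH]; ring. Qed.

Lemma rsum_perm {J : Type} (u : J -> R) (l m : list J) :
  Permutation l m -> rsum u l = rsum u m.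
Proof. induction 1; simpl; try congruence; ring. Qed.

Lemma rsum_ge_0 {J : Type} (u : J -> R) (l : list J) :
  (forall p, 0 <= u p)%R -> 0 <= rsum u l.
Proof. intros H; induction l as [|p l IH]; simpl; [lra|specialize (H p); lra]. Qed.

Lemma Cmod_lsum (u : row -> C) (M : row -> R) (A : R) (l : list row) :
  (forall p, (Cmod (u p) <= A * M p)) -> Cmod (lsum u l) <= A * rsum M l.
Proof.
intros H; induction l as [|p l IH]; simpl; [rewrite Cmod_0; lra|].
eapply Rle_trans; [apply Cmod_triangle|]; specialize (H p); lra.
Qed.

Lemma incl_permutation {J : Type} (l m : list J) :
  NoDup l -> incl l m -> exists r, Permutation m (l ++ r).
Proof.
revert m; induction l as [|a l IH]; intros m ND I; [now exists m|].
inversion ND as [|? ? na ND']; subst.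
assert (Ia : In a m) by (apply I; simpl; auto).
apply in_split in Ia; destruct Ia as (m1 & m2 & ->).
destruct (IH (m1 ++ m2) ND') as [r Hr].
- intros x Hx; assert (Ix : In x (m1 ++ a :: m2)) by (apply I; simpl; auto).
  apply in_app_or in Ix; apply in_or_app; destruct Ix as [Ix|[->|Ix]]; auto; contradiction.
- exists r; simpl; rewrite <- Hr; symmetry; apply Permutation_middle.
Qed.

(** Convergence along finite sets of rows, coded as lists without repetition, does not depend on an
    order; the permutation of the rows by a matrix then preserves sums at once ([usum_bij]). *)
Definition finsets (P : list row -> Prop) : Prop :=
  exists l0, NoDup l0 /\ forall l, NoDup l -> incl l0 l -> P l.

Global Instance finsets_filter : ProperFilter finsets.
Proof.
split.
- intros P (l0 & ND & H); exists l0; apply H; auto using incl_refl.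
- split.
  + exists nil; split; [constructor|trivial].
  + intros P Q (l & _ & HP) (m & _ & HQ); exists (nodup row_dec (l ++ m)).
    split; [apply NoDup_nodup|]; intros k NDk I.
    split; [apply HP|apply HQ]; auto; intros x Hx; apply I, nodup_In, in_or_app; auto.
  + intros P Q PQ (l & ND & HP); exists l; auto.
Qed.

Lemma finsets_nodup (P : list row -> Prop) : (forall l, NoDup l -> P l) -> finsets P.
Proof. intros H; exists nil; split; [constructor|auto]. Qed.

(** Up to a constant, [wt] is a majorant of |c z + d|^-4 that factors, so that its sums over boxes
    are products of sums over Z. *)
Definition wt1 (c : Z) : R := (/ (1 + IZR c ^ 2))%R.
Definition wt (p : row) : R := (wt1 (fst p) * wt1 (snd p))%R.

Lemma wt1_pos (c : Z) : (0 < wt1 c).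
Proof. apply Rinv_0_lt_compat; assert (P := pow2_ge_0 (IZR c)); lra. Qed.

Lemma wt_pos (p : row) : (0 < wt p).
Proof. apply Rmult_lt_0_compat; apply wt1_pos. Qed.

Fixpoint ball_Z (n : nat) : list Z :=
  match n with
  | O => 0%Z :: nil
  | S m => Z.of_nat n :: (- Z.of_nat n)%Z :: ball_Z m
  end.

Lemma in_ball_Z (n : nat) (z : Z) : (Z.abs z <= Z.of_nat n)%Z -> In z (ball_Z n).
Proof.
induction n as [|n IH]; intros H; simpl; [left; lia|].
destruct (Z.eq_dec (Z.abs z) (Z.of_nat (S n))) as [E|E]; [lia|].
right; right; apply IH; lia.
Qed.

(** The bound telescopes: 2 / (1 + m^2) <= 4 / m - 4 / (m + 1). It makes 5 a bound for the sums over
    Z and 25 = 5^2 one for the sums of [wt]. *)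
Lemma rsum_wt1 (n : nat) : (rsum wt1 (ball_Z n) <= 5 - 4 / (INR n + 1)).
Proof.
induction n as [|n IH].
- apply Req_le; simpl; unfold wt1; simpl; field.
- simpl ball_Z; cbn [rsum].
  assert (E : wt1 (- Z.of_nat (S n)) = wt1 (Z.of_nat (S n)))
    by (unfold wt1; rewrite opp_IZR; do 2 f_equal; ring).
  change (Z.neg (Pos.of_succ_nat n)) with (- Z.of_nat (S n))%Z.
  change (Z.pos (Pos.of_succ_nat n)) with (Z.of_nat (S n)).
  rewrite E, S_INR; set (m := (INR n + 1)%R) in *.
  assert (W : wt1 (Z.of_nat (S n)) = (/ (1 + m ^ 2))%R)
    by (unfold wt1; rewrite <- INR_IZR_INZ, S_INR; reflexivity).
  rewrite W.
  assert (m1 : 1 <= m) by (assert (P := pos_INR n); unfold m; lra).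
  assert (K : 2 * / (1 + m ^ 2) <= 4 / m - 4 / (m + 1)); [|lra].
  replace (4 / m - 4 / (m + 1))%R with (4 * / (m * (m + 1)))%R by (field; lra).
  assert (0 < m * (m + 1)) by nra.
  apply Rmult_le_reg_r with ((1 + m ^ 2) * (m * (m + 1)))%R; [nra|].
  replace (2 * / (1 + m ^ 2) * ((1 + m ^ 2) * (m * (m + 1))))%R
    with (2 * (m * (m + 1)))%R by (field; nra).
  replace (4 * / (m * (m + 1)) * ((1 + m ^ 2) * (m * (m + 1))))%R
    with (4 * (1 + m ^ 2))%R by (field; lra).
  nra.
Qed.

Lemma rsum_map_wt (c : Z) (m : list Z) :
  rsum wt (map (fun y => (c, y)) m) = (wt1 c * rsum wt1 m)%R.
Proof.
induction m as [|d m IH]; simpl; [ring|].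
rewrite IH; unfold wt; simpl; ring.
Qed.

Lemma rsum_list_prod (l m : list Z) :
  rsum wt (list_prod l m) = (rsum wt1 l * rsum wt1 m)%R.
Proof.
induction l as [|c l IH]; simpl; [ring|].
rewrite rsum_app, rsum_map_wt, IH; ring.
Qed.

Lemma rsum_wt_bound (l : list row) : NoDup l -> rsum wt l <= 25.
Proof.
intros ND.
assert (B : exists n, forall p, In p l ->
  (Z.abs (fst p) <= Z.of_nat n)%Z /\ (Z.abs (snd p) <= Z.of_nat n)%Z).
{ clear ND; induction l as [|p l [n IH]]; [exists O; simpl; tauto|].
  exists (n + Z.abs_nat (fst p) + Z.abs_nat (snd p))%nat; intros q [<-|H]; [lia|].
  specialize (IH q H); lia. }
destruct B as [n B].
destruct (incl_permutation l (list_prod (ball_Z n) (ball_Z n)) ND) as [r Hr].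
{ intros [c d] H; apply in_prod; apply in_ball_Z; apply (B _ H). }
assert (E := rsum_perm wt _ _ Hr).
rewrite rsum_list_prod, rsum_app in E.
assert (0 <= rsum wt r) by (apply rsum_ge_0; intros; left; apply wt_pos).
assert (X := rsum_wt1 n).
assert (X0 : 0 <= rsum wt1 (ball_Z n)) by (apply rsum_ge_0; intros; left; apply wt1_pos).
assert (0 < 4 / (INR n + 1)) by (apply Rdiv_lt_0_compat; [lra|assert (P := pos_INR n); lra]).
nra.
Qed.

Lemma usum_ex (u : row -> C) (A : R) :
  0 <= A -> (forall p, (Cmod (u p) <= A * wt p)) ->
  exists s, climit finsets (lsum u) s.
Proof.
intros A0 H; apply climit_cauchy; [typeclasses eauto|]; intros eps e0.
(* The finite sums of weights have a supremum [B]; beyond a finite set whose weight is close to [B]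
   only little weight remains, which is the Cauchy criterion. *)
destruct (completeness (fun x => exists l, NoDup l /\ x = rsum wt l)) as [B [UB LUB]].
- exists 25%R; intros x (l & ND & ->); now apply rsum_wt_bound.
- exists 0%R, nil; split; [constructor|reflexivity].
- assert (d0 : 0 < eps / (A + 1)) by (apply Rdiv_lt_0_compat; lra).
  assert (EX : exists l, NoDup l /\ (B - eps / (A + 1) < rsum wt l)).
  { apply NNPP; intros NE.
    assert (X : B <= B - eps / (A + 1)); [|lra].
    apply LUB; intros x (l & ND & ->); apply Rnot_lt_le; intros L; apply NE; eauto. }
  destruct EX as (l0 & ND0 & H0).
  exists (lsum u l0), l0; split; [exact ND0|]; intros l ND I.
  destruct (incl_permutation l0 l ND0 I) as [r Hr].
  rewrite (lsum_perm u _ _ Hr), lsum_app.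
  replace (lsum u l0 + lsum u r - lsum u l0) with (lsum u r) by ring.
  eapply Rle_lt_trans; [apply Cmod_lsum with (1 := H)|].
  assert (E := rsum_perm wt _ _ Hr); rewrite rsum_app in E.
  assert (L : rsum wt l <= B) by (apply UB; eauto).
  assert (R0 : 0 <= rsum wt r) by (apply rsum_ge_0; intros; left; apply wt_pos).
  apply Rle_lt_trans with ((A + 1) * rsum wt r)%R; [nra|].
  replace eps with ((A + 1) * (eps / (A + 1)))%R by (field; lra).
  apply Rmult_lt_compat_l; lra.
Qed.

Lemma usum_bound (u : row -> C) (A : R) (s : C) :
  0 <= A -> (forall p, (Cmod (u p) <= A * wt p)) ->
  climit finsets (lsum u) s -> Cmod s <= A * 25.
Proof.
intros A0 H L; replace s with (s - 0) by ring.
apply (climit_le finsets _ _ _ _ L), finsets_nodup; intros l ND.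
replace (lsum u l - 0) with (lsum u l) by ring.
eapply Rle_trans; [apply Cmod_lsum with (1 := H)|].
apply Rmult_le_compat_l; [exact A0|now apply rsum_wt_bound].
Qed.

Lemma usum_bij (u : row -> C) (sg sg' : row -> row) (s : C) :
  (forall p, sg (sg' p) = p) -> (forall p, sg' (sg p) = p) ->
  climit finsets (lsum u) s -> climit finsets (lsum (fun p => u (sg p))) s.
Proof.
intros E E' L eps e0; destruct (L eps e0) as (l0 & ND0 & H).
assert (INJ : forall f g : row -> row, (forall p, g (f p) = p) ->
  forall l, NoDup l -> NoDup (map f l)).
{ intros f g fg l ND; induction ND as [|a l na ND IH]; simpl; constructor; auto.
  intros I; apply in_map_iff in I; destruct I as (b & Eb & Ib).
  apply na; rewrite <- (fg a), <- Eb, fg; exact Ib. }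
exists (map sg' l0); split; [now apply INJ with sg|].
intros l ND I; rewrite <- lsum_map; apply H; [now apply INJ with sg'|].
intros p Hp; rewrite <- (E p); apply in_map, I, in_map, Hp.
Qed.

Lemma usum_finite (u : row -> C) (l0 : list row) :
  NoDup l0 -> (forall p, ~ In p l0 -> u p = 0) -> climit finsets (lsum u) (lsum u l0).
Proof.
intros ND0 H eps e0; exists l0; split; [exact ND0|]; intros l ND I.
destruct (incl_permutation l0 l ND0 I) as [r Hr].
assert (Z : lsum u r = 0).
{ assert (NDr := Permutation_NoDup Hr ND).
  rewrite (lsum_ext u (fun _ => 0)).
  - clear; induction r as [|p r IH]; simpl; [reflexivity|rewrite IH; ring].
  - intros p Ip; apply H; intros Ip0.
    apply in_split in Ip; destruct Ip as (r1 & r2 & ->).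
    rewrite app_assoc in NDr; apply NoDup_remove_2 in NDr.
    apply NDr, in_or_app; left; apply in_or_app; auto. }
rewrite (lsum_perm u _ _ Hr), lsum_app, Z.
replace (lsum u l0 + 0 - lsum u l0) with (RtoC 0) by ring; rewrite Cmod_0; exact e0.
Qed.

Lemma taylor1_lsum (S : UHP -> Prop) (A : R) (u u' : row -> UHP -> C) (l : list row) :
  0 <= A -> NoDup l -> (forall p, taylor1 S (A * wt p) (u p) (u' p)) ->
  taylor1 S (A * 25) (fun z => lsum (fun p => u p z) l) (fun z => lsum (fun p => u' p z) l).
Proof.
intros A0 ND H.
apply (taylor1_mono S S (A * rsum wt l)); auto.
{ apply Rmult_le_compat_l; [exact A0|now apply rsum_wt_bound]. }
clear ND; induction l as [|p l IH]; simpl.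
- apply (taylor1_mono S S (Cmod 0)); auto; [rewrite Cmod_0; lra|apply taylor1_const].
- rewrite Rmult_plus_distr_l; now apply taylor1_plus.
Qed.

End LatticeSums.

(** * Terms of the Poincare series and their majorants *)

Section Poincare.
Local Open Scope R_scope.
Local Open Scope C_scope.

Definition qpole (m : nat) (z : UHP) : C := qe (- (INR m * freq 1)) z.

(** The bottom row determines g up to a translation T^b on the left, to which q^-m is blind; this is
    why rows index the terms. *)
Definition bottom (g : SL2Z) : row := (sl_c g, sl_d g).

Definition row_act (p : row) (g : SL2Z) : row :=
  (fst p * sl_a g + snd p * sl_c g, fst p * sl_b g + snd p * sl_d g)%Z.

Lemma bottom_mul (g h : SL2Z) : bottom (sl_mul g h) = row_act (bottom g) h.
Proof. reflexivity. Qed.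

Lemma row_act_inv (p : row) (g : SL2Z) : row_act (row_act p g) (sl_inv g) = p.
Proof.
destruct p as [c d]; unfold row_act; simpl; assert (D := sl_det g).
f_equal.
- transitivity (c * (sl_a g * sl_d g - sl_b g * sl_c g))%Z; [ring|rewrite D; ring].
- transitivity (d * (sl_a g * sl_d g - sl_b g * sl_c g))%Z; [ring|rewrite D; ring].
Qed.

Lemma row_act_inv' (p : row) (g : SL2Z) : row_act (row_act p (sl_inv g)) g = p.
Proof.
destruct p as [c d]; unfold row_act; simpl; assert (D := sl_det g).
f_equal.
- transitivity (c * (sl_a g * sl_d g - sl_b g * sl_c g))%Z; [ring|rewrite D; ring].
- transitivity (d * (sl_a g * sl_d g - sl_b g * sl_c g))%Z; [ring|rewrite D; ring].
Qed.

Lemma qe_int (m : nat) (b : Z) : qe (- (INR m * freq 1)) (ZtoC b) = 1.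
Proof.
unfold ZtoC; rewrite qe_real.
destruct (Z_le_gt_dec 0 b) as [H|H].
- rewrite <- (Z2Nat.id b H), <- INR_IZR_INZ.
  replace (- (INR m * freq 1) * INR (Z.to_nat b))%R
    with (- (0 + 2 * INR (m * Z.to_nat b) * PI))%R
    by (rewrite mult_INR; unfold freq; simpl; field).
  rewrite cos_neg, sin_neg, cos_period, sin_period, cos_0, sin_0, Ropp_0; reflexivity.
- replace b with (- Z.of_nat (Z.to_nat (- b)))%Z by lia.
  rewrite opp_IZR, <- INR_IZR_INZ.
  replace (- (INR m * freq 1) * - INR (Z.to_nat (- b)))%R
    with (0 + 2 * INR (m * Z.to_nat (- b)) * PI)%R
    by (rewrite mult_INR; unfold freq; simpl; field).
  rewrite cos_period, sin_period, cos_0, sin_0; reflexivity.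
Qed.

Lemma slash_qpole_bottom (m k : nat) (g h : SL2Z) :
  bottom g = bottom h -> slash k g (qpole m) = slash k h (qpole m).
Proof.
intros E; injection E as Ec Ed.
(* The upper right entry of h g^-1, so that h = T^b g. *)
set (b := (sl_b h * sl_a g - sl_a h * sl_b g)%Z).
assert (Dg := sl_det g); assert (Dh := sl_det h).
assert (H : h = sl_mul (sl_T b) g).
{ apply SL2Z_ext; cbn [sl_mul sl_T sl_a sl_b sl_c sl_d]; unfold b; try (rewrite <- ?Ec, <- ?Ed; ring).
  - transitivity (sl_a h * (sl_a g * sl_d g - sl_b g * sl_c g) + sl_a g
      - sl_a g * (sl_a h * sl_d h - sl_b h * sl_c h))%Z; [rewrite Dg, Dh; ring|].
    rewrite <- Ec, <- Ed; ring.
  - transitivity (sl_b h * (sl_a g * sl_d g - sl_b g * sl_c g) + sl_b g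
      - sl_b g * (sl_a h * sl_d h - sl_b h * sl_c h))%Z; [rewrite Dg, Dh; ring|].
    rewrite <- Ec, <- Ed; ring. }
rewrite H, <- slash_mul; f_equal.
apply functional_extensionality; intros z; rewrite slash_T; unfold qpole.
rewrite moebius_T, qe_add, qe_int; ring.
Qed.

(** [T] is arbitrary so that a term and its derivative are built on the same choice of a matrix. The
    condition [chi] is arbitrary because slashing by alpha moves it along the rows: the series seen
    from any cusp is of the same kind. *)
Definition pick_row {T : Type} (chi : row -> Prop) (u : SL2Z -> T) (t0 : T) (p : row) : T :=
  match excluded_middle_informative (chi p /\ exists g, bottom g = p) with
  | left H => u (proj1_sig (constructive_indefinite_description _ (proj2 H)))
  | right _ => t0
  end.

Lemma pick_row_cases {T : Type} (chi : row -> Prop) (u : SL2Z -> T) (t0 : T) (p : row) :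
  (exists g, chi p /\ bottom g = p /\ pick_row chi u t0 p = u g) \/
  (~ (chi p /\ exists g, bottom g = p) /\ pick_row chi u t0 p = t0).
Proof.
unfold pick_row; destruct (excluded_middle_informative _) as [H|H]; [left|right; auto].
destruct (constructive_indefinite_description _ _) as [g Hg]; exists g; simpl; tauto.
Qed.

(* Terms of sum_(c,d) (c tau + d)^-4 e(-m gamma tau), gamma having bottom row
   (c, d), over the coprime rows satisfying chi. *)
Definition pterm (m : nat) (chi : row -> Prop) (p : row) : UHP -> C :=
  pick_row chi (fun g => slash 4 g (qpole m)) fzero p.

Lemma pterm_bottom (m : nat) (chi : row -> Prop) (g : SL2Z) :
  chi (bottom g) -> pterm m chi (bottom g) = slash 4 g (qpole m).
Proof.
intros H; unfold pterm.
destruct (pick_row_cases chi (fun g => slash 4 g (qpole m)) fzero (bottom g))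
  as [(h & _ & E & ->)|[N _]].
- now apply slash_qpole_bottom.
- exfalso; apply N; split; [exact H|now exists g].
Qed.

Lemma pterm_none (m : nat) (chi : row -> Prop) (p : row) :
  (forall g, bottom g = p -> ~ chi p) -> pterm m chi p = fzero.
Proof.
intros H; unfold pterm.
destruct (pick_row_cases chi (fun g => slash 4 g (qpole m)) fzero p)
  as [(h & X & E & _)|[_ E]]; [|exact E].
exfalso; exact (H h E X).
Qed.

Lemma slash_pterm (m : nat) (chi : row -> Prop) (al : SL2Z) (p : row) :
  slash 4 al (pterm m chi p) = pterm m (fun q => chi (row_act q (sl_inv al))) (row_act p al).
Proof.
destruct (classic (exists g, bottom g = p /\ chi p)) as [(g & <- & H)|N].
- rewrite pterm_bottom by exact H; rewrite slash_mul, <- bottom_mul, pterm_bottom;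
    [reflexivity|].
  now rewrite bottom_mul, row_act_inv.
- rewrite (pterm_none m chi p) by (intros g E X; apply N; eauto).
  rewrite pterm_none.
  + apply functional_extensionality; intros z; unfold slash, fzero, Cdiv; ring.
  + intros g E X; apply N; exists (sl_mul g (sl_inv al)).
    rewrite bottom_mul, E, row_act_inv; split; [reflexivity|].
    now rewrite row_act_inv in X.
Qed.

(** From gamma w - gamma z = (w - z) / (j(z) j(w)) and j(w) - j(z) = c (w - z), where j is the
    denominator of gamma; the remainder is exact. *)
Lemma moebius_taylor (g : SL2Z) (z w : UHP) :
  moebius g w - moebius g z - (w - z) * / (moebius_den g z * moebius_den g z) =
  - ((w - z) * (w - z) * ZtoC (sl_c g) * / moebius_den g z * / moebius_den g z
     * / moebius_den g w).
Proof.
assert (E := SL2Z_det_C g); set (c := ZtoC (sl_c g)) in *.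
assert (Jz := moebius_den_neq_0 g z); assert (Jw := moebius_den_neq_0 g w).
rewrite !moebius_val; symmetry; apply Ceq_minus.
replace (- ((w - z) * (w - z) * c * / moebius_den g z * / moebius_den g z * / moebius_den g w)
  - (moebius_num g w / moebius_den g w - moebius_num g z / moebius_den g z -
     (w - z) * / (moebius_den g z * moebius_den g z)))
with ((- ((w - z) * (w - z) * c) - (moebius_num g w * moebius_den g z * moebius_den g z
    - moebius_num g z * moebius_den g w * moebius_den g z - (w - z) * moebius_den g w))
    / (moebius_den g z * moebius_den g z * moebius_den g w)) by (field; auto).
replace (- ((w - z) * (w - z) * c) - (moebius_num g w * moebius_den g z * moebius_den g z
    - moebius_num g z * moebius_den g w * moebius_den g z - (w - z) * moebius_den g w))
  with ((w - z) * (1 - (ZtoC (sl_a g) * ZtoC (sl_d g) - ZtoC (sl_b g) * c)) * moebius_den g z)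
  by (unfold moebius_num, moebius_den; fold c; ring).
rewrite E; unfold Cdiv; ring.
Qed.

Lemma Im_moebius (g : SL2Z) (tau : UHP) :
  Im (moebius g tau) = (Im tau / Cmod (moebius_den g tau) ^ 2)%R.
Proof.
assert (P := moebius_den_norm_pos g tau); rewrite Cmod2_alt, moebius_val.
destruct g as [a b c d e]; destruct tau as [[x y] h].
unfold moebius_num, moebius_den, ZtoC, Re, Im in *; simpl in *.
assert (E : (IZR a * IZR d - IZR b * IZR c = 1)%R)
  by (rewrite <- !mult_IZR, <- minus_IZR, e; reflexivity).
match type of P with (0 < ?X) => set (n := X) in * end.
match goal with |- ?X = _ => replace X with (y * (IZR a * IZR d - IZR b * IZR c) / n)%R end.
- rewrite E, Rmult_1_r; reflexivity.
- unfold n in *; field; lra.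
Qed.

Lemma Cmod2_den (g : SL2Z) (z : UHP) :
  (Cmod (moebius_den g z) ^ 2 =
   (IZR (sl_c g) * Re z + IZR (sl_d g)) ^ 2 + (IZR (sl_c g) * Im z) ^ 2)%R.
Proof.
rewrite Cmod2_alt; destruct z as [[x y] h].
unfold moebius_den, ZtoC, Re, Im; simpl; ring.
Qed.

Lemma den_lower (g : SL2Z) (z : UHP) :
  Rabs (IZR (sl_c g)) * Im z <= Cmod (moebius_den g z).
Proof.
assert (p := uhp_pos z).
replace (Rabs (IZR (sl_c g)) * Im z)%R with (Rabs (Im (moebius_den g z))).
- apply Im_le_Cmod.
- rewrite <- (Rabs_pos_eq (Im z)) by lra; rewrite <- Rabs_mult; f_equal.
  destruct z as [[x y] h]; unfold moebius_den, ZtoC, Re, Im; simpl; ring.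
Qed.

Lemma IZR_sq_ge_1 (c : Z) : c <> 0%Z -> 1 <= IZR c ^ 2.
Proof.
intros nz; replace (IZR c ^ 2)%R with (IZR (c * c)) by (rewrite mult_IZR; ring).
apply IZR_le; nia.
Qed.

Lemma sl_c0_d (g : SL2Z) : sl_c g = 0%Z -> (IZR (sl_d g) ^ 2 = 1)%R.
Proof.
intros c0; assert (D := sl_det g); rewrite c0, Z.mul_0_r, Z.sub_0_r in D.
replace (IZR (sl_d g) ^ 2)%R with (IZR (sl_d g * sl_d g)) by (rewrite mult_IZR; ring).
destruct (Z.mul_eq_1 _ _ D) as [A|A]; rewrite A in D.
- replace (sl_d g) with 1%Z by lia; reflexivity.
- replace (sl_d g) with (-1)%Z by lia; reflexivity.
Qed.

(** Put D = c x + d and S = |c z + d|^2 = D^2 + (c y)^2. As d^2 <= 2 D^2 + 2 c^2 x^2 and 1 <= c^2,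
    the product (1 + c^2) (1 + d^2) is at most 4 c^2 D^2 + (2 + 4 x^2) c^4, where 4 D^2 (c y)^2 <=
    S^2 and (c y)^4 <= S^2. The constant is O(y^-2) in vertical strips, whence the decay at oo of
    the terms with c <> 0. *)
Lemma lattice_bound_c (g : SL2Z) (z : UHP) : sl_c g <> 0%Z ->
  / Cmod (moebius_den g z) ^ 4 <=
   (Im z ^ 2 + 2 + 4 * Re z ^ 2) / Im z ^ 4 * wt (bottom g).
Proof.
intros nz; assert (y0 := uhp_pos z).
set (x := Re z); set (y := Im z) in *.
set (c := IZR (sl_c g)); set (d := IZR (sl_d g)).
assert (c1 : 1 <= c ^ 2) by now apply IZR_sq_ge_1.
replace (Cmod (moebius_den g z) ^ 4)%R with ((Cmod (moebius_den g z) ^ 2) ^ 2)%R by ring.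
rewrite Cmod2_den; fold x y c d.
set (D := (c * x + d)%R).
set (S := (D ^ 2 + (c * y) ^ 2)%R).
assert (D2 : 0 <= D ^ 2) by apply pow2_ge_0.
assert (y2 : 0 < y ^ 2) by (apply pow_lt; exact y0).
assert (cy2 : y ^ 2 <= (c * y) ^ 2) by (rewrite Rpow_mult_distr; nra).
assert (S0 : 0 < S) by (unfold S; lra).
assert (x2 : 0 <= x ^ 2) by apply pow2_ge_0.
assert (d2 : d ^ 2 <= 2 * D ^ 2 + 2 * c ^ 2 * x ^ 2).
{ assert (H := pow2_ge_0 (D + c * x)); replace d with (D - c * x)%R by (unfold D; ring); nra. }
assert (B1 : (1 + c ^ 2) * (1 + d ^ 2) <= 4 * (c ^ 2 * D ^ 2) + (2 + 4 * x ^ 2) * (c ^ 2) ^ 2).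
{ apply Rle_trans with ((2 * c ^ 2) * (c ^ 2 + 2 * D ^ 2 + 2 * c ^ 2 * x ^ 2))%R; [|apply Req_le; ring].
  assert (0 <= d ^ 2) by apply pow2_ge_0.
  apply Rmult_le_compat; lra. }
assert (B2 : 4 * (c ^ 2 * D ^ 2) * y ^ 2 <= S ^ 2).
{ assert (H := pow2_ge_0 (D ^ 2 - (c * y) ^ 2)).
  replace (4 * (c ^ 2 * D ^ 2) * y ^ 2)%R with (4 * (D ^ 2 * (c * y) ^ 2))%R by ring.
  unfold S; nra. }
assert (B3 : (c ^ 2) ^ 2 * y ^ 4 <= S ^ 2).
{ replace ((c ^ 2) ^ 2 * y ^ 4)%R with (((c * y) ^ 2) ^ 2)%R by ring.
  apply pow_incr; split; [apply pow2_ge_0|unfold S; lra]. }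
assert (P : y ^ 4 * ((1 + c ^ 2) * (1 + d ^ 2)) <= S ^ 2 * (y ^ 2 + 2 + 4 * x ^ 2)).
{ assert (y4 : 0 < y ^ 4) by (apply pow_lt; exact y0).
  apply Rle_trans with (y ^ 4 * (4 * (c ^ 2 * D ^ 2) + (2 + 4 * x ^ 2) * (c ^ 2) ^ 2))%R.
  { apply Rmult_le_compat_l; lra. }
  assert (y ^ 2 * (4 * (c ^ 2 * D ^ 2) * y ^ 2) <= y ^ 2 * S ^ 2)
    by (apply Rmult_le_compat_l; lra).
  assert ((2 + 4 * x ^ 2) * ((c ^ 2) ^ 2 * y ^ 4) <= (2 + 4 * x ^ 2) * S ^ 2)
    by (apply Rmult_le_compat_l; lra).
  replace (y ^ 4 * (4 * (c ^ 2 * D ^ 2) + (2 + 4 * x ^ 2) * (c ^ 2) ^ 2))%R with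
    (y ^ 2 * (4 * (c ^ 2 * D ^ 2) * y ^ 2) + (2 + 4 * x ^ 2) * ((c ^ 2) ^ 2 * y ^ 4))%R by ring.
  lra. }
unfold wt, wt1; simpl fst; simpl snd; fold c d.
assert (y4 : 0 < y ^ 4) by (apply pow_lt; exact y0).
assert (S2 : 0 < S ^ 2) by (apply pow_lt; exact S0).
assert (d20 : 0 <= d ^ 2) by apply pow2_ge_0.
apply Rmult_le_reg_r with (S ^ 2 * (y ^ 4 * ((1 + c ^ 2) * (1 + d ^ 2))))%R.
{ repeat apply Rmult_lt_0_compat; lra. }
replace (/ S ^ 2 * (S ^ 2 * (y ^ 4 * ((1 + c ^ 2) * (1 + d ^ 2)))))%R
  with (y ^ 4 * ((1 + c ^ 2) * (1 + d ^ 2)))%R by (field; lra).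
replace ((y ^ 2 + 2 + 4 * x ^ 2) / y ^ 4 * (/ (1 + c ^ 2) * / (1 + d ^ 2)) *
  (S ^ 2 * (y ^ 4 * ((1 + c ^ 2) * (1 + d ^ 2)))))%R
  with (S ^ 2 * (y ^ 2 + 2 + 4 * x ^ 2))%R by (field; lra).
exact P.
Qed.

(** The additional 2 is for c = 0, where the left side is 1 and the weight of the row is 1/2. *)
Lemma lattice_bound (g : SL2Z) (z : UHP) :
  / Cmod (moebius_den g z) ^ 4 <=
   (2 + (Im z ^ 2 + 2 + 4 * Re z ^ 2) / Im z ^ 4) * wt (bottom g).
Proof.
assert (y0 := uhp_pos z); assert (W := wt_pos (bottom g)).
assert (Q : 0 <= (Im z ^ 2 + 2 + 4 * Re z ^ 2) / Im z ^ 4).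
{ apply Rmult_le_pos.
  - assert (A := pow2_ge_0 (Im z)); assert (B := pow2_ge_0 (Re z)); lra.
  - left; apply Rinv_0_lt_compat, pow_lt, y0. }
destruct (Z.eq_dec (sl_c g) 0) as [c0|nz].
- assert (d1 := sl_c0_d g c0).
  replace (Cmod (moebius_den g z) ^ 4)%R with ((Cmod (moebius_den g z) ^ 2) ^ 2)%R by ring.
  rewrite Cmod2_den, c0, !Rmult_0_l, Rplus_0_l, d1.
  assert (E : wt (bottom g) = (/ 2)%R).
  { unfold wt, wt1, bottom; cbn [fst snd]; rewrite c0, d1; field. }
  rewrite E; replace (/ (1 + 0 ^ 2) ^ 2)%R with 1%R by field; nra.
- eapply Rle_trans; [now apply lattice_bound_c|nra].
Qed.

Lemma den_inv_bound (g : SL2Z) (z : UHP) :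
  / Cmod (moebius_den g z) <= 1 + / Im z.
Proof.
assert (y0 := uhp_pos z); assert (i0 := Rinv_0_lt_compat _ y0).
destruct (Z.eq_dec (sl_c g) 0) as [c0|nz].
- assert (d1 := sl_c0_d g c0).
  assert (E := Cmod2_den g z); rewrite c0, !Rmult_0_l, Rplus_0_l, d1 in E.
  assert (P := Cmod_ge_0 (moebius_den g z)).
  assert (Cmod (moebius_den g z) = 1%R) as -> by nra.
  rewrite Rinv_1; lra.
- assert (L := den_lower g z).
  assert (c1 : 1 <= Rabs (IZR (sl_c g))).
  { rewrite <- abs_IZR; apply IZR_le; lia. }
  apply Rle_trans with (/ Im z)%R; [|lra].
  apply Rinv_le_contravar; [exact y0|nra].
Qed.

(** The derivative of q^-m(gamma z) j(z)^-4, in the very shape that [taylor1_comp] and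
    [taylor1_mult] give when j^-4 is formed as ((1/j)^2)^2. *)
Definition dterm (m : nat) (g : SL2Z) (z : UHP) : C :=
  let j := moebius_den g z in
  let i := / j in
  let i' := - ZtoC (sl_c g) * (/ j * / j) in
  (RtoC (- (INR m * freq 1)) * Ci * qpole m (moebius g z)) * / (j * j) * (i * i * (i * i))
  + qpole m (moebius g z) * ((i' * i + i * i') * (i * i) + i * i * (i' * i + i * i')).

(** The radius and [A] do not depend on g: this is the Weierstrass majorant for the series and its
    derivative at once. The decay in g comes from the factor j^-4 alone; q^-m(gamma z) is merely
    bounded, because Im gamma z is bounded uniformly in gamma. *)
Lemma taylor1_term (m : nat) (z0 : UHP) :
  exists r A, 0 < r /\ 0 <= A /\ forall g,
    taylor1 (near z0 r) (A * wt (bottom g)) (slash 4 g (qpole m)) (dterm m g).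
Proof.
assert (y0 := uhp_pos z0); set (y := Im z0) in *.
(* Diameter at most 1 for [taylor1_mult], and heights between y/2 and 2y. On this disc [i] will
   bound |c / j|, [k] will bound |1 / j|, [L] the derivative and remainder of gamma, and [Y] the
   height of gamma z. *)
set (r := Rmin (1/2) (y / 2)).
assert (r1 := Rmin_l (1/2) (y / 2)); assert (r2 := Rmin_r (1/2) (y / 2)); fold r in r1, r2.
assert (r0 : 0 < r) by (apply Rmin_glb_lt; lra).
set (s := (INR m * freq 1)%R).
assert (s0 : 0 <= s)
  by (apply Rmult_le_pos; [apply pos_INR|left; apply freq_pos; lia]).
set (i := (/ (y / 2))%R); assert (i0 : 0 < i) by (apply Rinv_0_lt_compat; lra).
assert (iy : (i * (y / 2) = 1)%R) by (unfold i; field; lra).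
set (k := (1 + i)%R).
set (L := (k * k * (1 + i))%R).
assert (L0 : 0 <= L) by (unfold L, k; repeat apply Rmult_le_pos; lra).
set (Y := (2 * y * (k * k))%R).
assert (kk : 0 <= k * k) by (apply Rmult_le_pos; unfold k; lra).
set (KE := ((1 + Rabs (- s) + 4 * (- s) ^ 2) * exp (2 * s * Y))%R).
assert (KE0 : 0 <= KE).
{ apply Rmult_le_pos; [|left; apply exp_pos].
  assert (P1 := Rabs_pos (- s)); assert (P2 := pow2_ge_0 (- s)); lra. }
set (B := (1 + i + i * i)%R).
assert (ii : 0 <= i * i) by (apply Rmult_le_pos; lra).
set (C0 := (2 + (Im z0 ^ 2 + 2 + 4 * Re z0 ^ 2) / Im z0 ^ 4)%R).
assert (C00 : 0 <= C0).
{ assert (0 <= (Im z0 ^ 2 + 2 + 4 * Re z0 ^ 2) / Im z0 ^ 4); [|unfold C0; lra].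
  apply Rmult_le_pos.
  - assert (P1 := pow2_ge_0 (Im z0)); assert (P2 := pow2_ge_0 (Re z0)); lra.
  - left; apply Rinv_0_lt_compat, pow_lt, y0. }
set (KC := (KE * (1 + L + 4 * L ^ 2))%R).
assert (KC0 : 0 <= KC).
{ apply Rmult_le_pos; [exact KE0|]; assert (P := pow2_ge_0 L); lra. }
(* The 64 collects the factors 4 of the two successive squarings that form j^-4, the 16 is 2^4 from
   [lam], and the outer 4 comes from the product with q^-m(gamma z). *)
exists r, (4 * (KC * (64 * (16 * B ^ 4) * C0)))%R.
assert (B4 : 0 <= B ^ 4) by (apply pow_le; unfold B; lra).
split; [exact r0|split].
{ apply Rmult_le_pos; [lra|]; apply Rmult_le_pos; [exact KC0|].
  apply Rmult_le_pos; [lra|exact C00]. }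
intros g; set (j := fun z : UHP => moebius_den g z).
assert (jn : forall z, j z <> 0) by (intros; apply moebius_den_neq_0).
set (c := ZtoC (sl_c g)).
assert (IMz : forall z, near z0 r z -> (y / 2 <= Im z <= 2 * y)).
{ intros z Hz; apply near_Im, Rabs_def2 in Hz; fold y in Hz; lra. }
assert (cj : forall z, near z0 r z -> (Cmod (c * / j z) <= i)).
{ intros z Hz; destruct (IMz z Hz) as [I1 _].
  rewrite Cmod_mult, Cmod_inv by auto.
  assert (D := den_lower g z); fold (j z) in D.
  assert (E : Cmod c = Rabs (IZR (sl_c g))) by apply Cmod_R.
  rewrite <- E in D; assert (P := proj1 (Cmod_gt_0 _) (jn z)).
  apply Rmult_le_reg_r with (1 := P); rewrite Rmult_assoc, Rinv_l, Rmult_1_r by lra.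
  assert (Q := Cmod_ge_0 c).
  assert (Cmod c * (y / 2) <= Cmod (j z)) by nra.
  replace (Cmod c) with (i * (Cmod c * (y / 2)))%R
    by (transitivity (i * (y / 2) * Cmod c)%R; [ring|rewrite iy; ring]).
  apply Rmult_le_compat_l; lra. }
(* The centre controls the disc: j(z0) = j(z) (1 + (c / j(z)) (z0 - z)), the bracket having modulus
   at most 1 + i y/2 = 2 with the real number [i]. The fourth power of [lam] is thus proportional to
   |j(z0)|^-4, which [lattice_bound] compares with the weight. *)
set (lam := (2 * / Cmod (j z0))%R).
assert (lam0 : 0 < lam).
{ apply Rmult_lt_0_compat; [lra|]; apply Rinv_0_lt_compat, Cmod_gt_0, jn. }
assert (jl : forall z, near z0 r z -> (Cmod (/ j z) <= lam)).
{ intros z Hz; rewrite Cmod_inv by auto.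
  assert (P := proj1 (Cmod_gt_0 _) (jn z)); assert (P0 := proj1 (Cmod_gt_0 _) (jn z0)).
  assert (H : Cmod (j z0) <= 2 * Cmod (j z)).
  { replace (j z0) with (j z * (1 + (c * / j z) * (z0 - z)))
      by (unfold j, moebius_den; fold c; field; apply jn).
    rewrite Cmod_mult, Rmult_comm; apply Rmult_le_compat_r; [lra|].
    eapply Rle_trans; [apply Cmod_triangle|]; rewrite Cmod_1, Cmod_mult.
    assert (Cz := cj z Hz).
    unfold near in Hz; rewrite Cmod_minus_sym in Hz.
    assert (Cmod (c * / j z) * Cmod (z0 - z) <= i * (y / 2)); [|lra].
    apply Rmult_le_compat; auto using Cmod_ge_0; lra. }
  unfold lam; apply Rmult_le_reg_r with (Cmod (j z) * Cmod (j z0))%R;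
    [now apply Rmult_lt_0_compat|].
  replace (/ Cmod (j z) * (Cmod (j z) * Cmod (j z0)))%R with (Cmod (j z0)) by (field; lra).
  replace (2 * / Cmod (j z0) * (Cmod (j z) * Cmod (j z0)))%R with (2 * Cmod (j z))%R
    by (field; lra).
  exact H. }
assert (jk : forall z, near z0 r z -> (Cmod (/ j z) <= k)).
{ intros z Hz; rewrite Cmod_inv by auto.
  eapply Rle_trans; [apply den_inv_bound|]; unfold k; apply Rplus_le_compat_l.
  destruct (IMz z Hz); unfold i; apply Rinv_le_contravar; lra. }
assert (diam : forall z w, near z0 r z -> near z0 r w -> (Cmod (w - z) <= 1))
  by (intros z w; apply near_diam; lra).
assert (T1 : taylor1 (near z0 r) (lam * B) (fun z => / j z)
   (fun z => - c * (/ j z * / j z))).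
{ assert (lB : forall x, 0 <= x <= B -> (lam * x <= lam * B))
    by (intros; apply Rmult_le_compat_l; lra).
  split; [apply Rmult_le_pos; unfold B; lra|]; intros z Hz.
  assert (Bz := jl z Hz); assert (Cz := cj z Hz).
  split; [apply Rle_trans with (1 := Bz); rewrite <- (Rmult_1_r lam) at 1;
          apply lB; unfold B; lra|split].
  - replace (- c * (/ j z * / j z)) with (- (/ j z * (c * / j z))) by ring.
    rewrite Cmod_opp, Cmod_mult.
    apply Rle_trans with (lam * i)%R; [|apply lB; unfold B; lra].
    apply Rmult_le_compat; auto using Cmod_ge_0.
  - intros w Hw.
    replace (/ j w - / j z - (w - z) * (- c * (/ j z * / j z))) with
      (/ j w * (c * / j z) * (c * / j z) * ((w - z) * (w - z)))
      by (unfold j, moebius_den; fold c; field; split; [apply (jn z)|apply (jn w)]).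
    rewrite !(Cmod_mult _ ((w - z) * (w - z))), (Cmod_mult (w - z)).
    replace (Cmod (w - z) * Cmod (w - z))%R with (Cmod (w - z) ^ 2)%R by ring.
    apply Rmult_le_compat_r; [apply pow2_ge_0|].
    rewrite (Cmod_mult _ (c * / j z)), (Cmod_mult _ (c * / j z)).
    apply Rle_trans with (lam * i * i)%R.
    + repeat apply Rmult_le_compat; auto using Cmod_ge_0, Rmult_le_pos.
    + rewrite Rmult_assoc; apply lB; unfold B; lra. }
assert (T2 := taylor1_mult _ _ _ _ _ _ _ diam T1 T1).
assert (T4 := taylor1_mult _ _ _ _ _ _ _ diam T2 T2).
assert (TE : taylor1 (near z0 r) KC (fun z => qpole m (moebius g z))
  (fun z => (RtoC (- s) * Ci * qpole m (moebius g z)) * / (j z * j z))).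
{ apply (taylor1_comp (near z0 r) (fun z => Im z <= Y)%R KE L (qpole m)
    (fun z => RtoC (- s) * Ci * qpole m z) (fun z => / (j z * j z)) (moebius g)); auto.
  - intros z Hz; rewrite Im_moebius; destruct (IMz z Hz) as [_ I2].
    assert (Kz := jk z Hz); rewrite Cmod_inv in Kz by auto; fold (j z).
    unfold Rdiv, Y; replace (/ Cmod (j z) ^ 2)%R with (/ Cmod (j z) * / Cmod (j z))%R
      by (field; apply Rgt_not_eq, Cmod_gt_0, jn).
    assert (P := Rinv_0_lt_compat _ (proj1 (Cmod_gt_0 _) (jn z))).
    assert (pz := uhp_pos z).
    apply Rmult_le_compat; try lra; [apply Rmult_le_pos; lra|].
    apply Rmult_le_compat; lra.
  - intros z w Hz Hw; assert (Kz := jk z Hz); split.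
    + replace (/ (j z * j z)) with (/ j z * / j z) by (field; apply jn).
      rewrite Cmod_mult.
      apply Rle_trans with (k * k * 1)%R; [|unfold L; apply Rmult_le_compat_l; lra].
      rewrite Rmult_1_r; apply Rmult_le_compat; auto using Cmod_ge_0.
    + unfold j; rewrite moebius_taylor; fold (j z) (j w) c.
      replace (- ((w - z) * (w - z) * c * / j z * / j z * / j w)) with
        (- (/ j z * / j z * (c * / j w) * ((w - z) * (w - z)))) by ring.
      rewrite Cmod_opp, !(Cmod_mult _ ((w - z) * (w - z))), (Cmod_mult (w - z)).
      replace (Cmod (w - z) * Cmod (w - z))%R with (Cmod (w - z) ^ 2)%R by ring.
      apply Rmult_le_compat_r; [apply pow2_ge_0|].
      rewrite (Cmod_mult _ (c * / j w)), Cmod_mult.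
      assert (Cw := cj w Hw).
      unfold L; apply Rmult_le_compat; auto using Cmod_ge_0, Rmult_le_pos; [|lra].
      apply Rmult_le_compat; auto using Cmod_ge_0.
  - unfold qpole; fold s; apply taylor1_qe.
    intros z w Hz Hw; assert (pz := uhp_pos z); assert (pw := uhp_pos w).
    replace (- (- s * Im z))%R with (s * Im z)%R by ring.
    rewrite Rabs_mult, Rabs_Ropp, (Rabs_pos_eq s) by exact s0.
    assert (D : Rabs (Im w - Im z) <= Y) by (apply Rabs_le; lra).
    assert (s * Im z <= s * Y) by (apply Rmult_le_compat_l; lra).
    assert (s * Rabs (Im w - Im z) <= s * Y) by (apply Rmult_le_compat_l; lra).
    lra. }
assert (TT := taylor1_mult _ _ _ _ _ _ _ diam TE T4).
assert (KK : 4 * (KC * (4 * (4 * (lam * B * (lam * B)) * (4 * (lam * B * (lam * B)))))) <=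
  4 * (KC * (64 * (16 * B ^ 4) * C0)) * wt (bottom g)).
{ assert (LB := lattice_bound g z0); fold C0 in LB; fold (j z0) in LB.
  assert (E : (lam ^ 4 = 16 * / Cmod (j z0) ^ 4)%R)
    by (unfold lam; field; apply Rgt_not_eq, Cmod_gt_0, jn).
  replace (4 * (KC * (4 * (4 * (lam * B * (lam * B)) * (4 * (lam * B * (lam * B)))))))%R
    with (4 * KC * (64 * B ^ 4) * lam ^ 4)%R by ring.
  rewrite E.
  replace (4 * (KC * (64 * (16 * B ^ 4) * C0)) * wt (bottom g))%R with
    (4 * KC * (64 * B ^ 4) * (16 * (C0 * wt (bottom g))))%R by ring.
  apply Rmult_le_compat_l; [|lra].
  apply Rmult_le_pos; [lra|lra]. }
apply (taylor1_mono _ (near z0 r) _ _ _ _ (fun z H => H) KK) in TT.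
revert TT; apply taylor1_ext.
- intros z; unfold slash; fold (j z).
  simpl; field; apply jn.
- intros z _; unfold dterm; fold s c (j z); reflexivity.
Qed.

End Poincare.

(** * The Poincare series of weight 4 and its behaviour at the cusps *)

Section PoincareSeries.
Local Open Scope R_scope.
Local Open Scope C_scope.

Definition pterm' (m : nat) (chi : row -> Prop) (p : row) : UHP -> C :=
  pick_row chi (dterm m) fzero p.

Lemma taylor1_pterm (m : nat) (chi : row -> Prop) (z0 : UHP) :
  exists r A, 0 < r /\ 0 <= A /\ forall p,
    taylor1 (near z0 r) (A * wt p) (pterm m chi p) (pterm' m chi p).
Proof.
destruct (taylor1_term m z0) as (r & A & r0 & A0 & T); exists r, A.
split; [exact r0|split; [exact A0|]]; intros p.
unfold pterm, pterm', pick_row; destruct (excluded_middle_informative _) as [H|H].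
- destruct (constructive_indefinite_description _ _) as [g <-]; apply T.
- apply (taylor1_mono (near z0 r) (near z0 r) (Cmod 0)); auto.
  + rewrite Cmod_0; apply Rmult_le_pos; [exact A0|left; apply wt_pos].
  + apply (taylor1_const (near z0 r) 0).
Qed.

Lemma pterm_summable (m : nat) (chi : row -> Prop) (z : UHP) :
  exists s, climit finsets (lsum (fun p => pterm m chi p z)) s.
Proof.
destruct (taylor1_pterm m chi z) as (r & A & r0 & A0 & T).
apply usum_ex with A; [exact A0|]; intros p; now apply (T p), near_refl.
Qed.

Lemma pterm'_summable (m : nat) (chi : row -> Prop) (z : UHP) :
  exists s, climit finsets (lsum (fun p => pterm' m chi p z)) s.
Proof.
destruct (taylor1_pterm m chi z) as (r & A & r0 & A0 & T).
apply usum_ex with A; [exact A0|]; intros p; now apply (T p), near_refl.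
Qed.

Definition poincare (m : nat) (chi : row -> Prop) (z : UHP) : C :=
  proj1_sig (constructive_indefinite_description _ (pterm_summable m chi z)).

Lemma poincare_sum (m : nat) (chi : row -> Prop) (z : UHP) :
  climit finsets (lsum (fun p => pterm m chi p z)) (poincare m chi z).
Proof. apply (proj2_sig (constructive_indefinite_description _ _)). Qed.

Lemma C11_poincare (m : nat) (chi : row -> Prop) : C11 (poincare m chi).
Proof.
exists (fun z => proj1_sig (constructive_indefinite_description _ (pterm'_summable m chi z))).
intros z0; destruct (taylor1_pterm m chi z0) as (r & A & r0 & A0 & T).
exists r, (A * 25)%R; split; [exact r0|].
apply (taylor1_limit finsets) with
  (u := fun l z => lsum (fun p => pterm m chi p z) l)
  (u' := fun l z => lsum (fun p => pterm' m chi p z) l).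
- lra.
- apply finsets_nodup; intros l ND; now apply taylor1_lsum.
- intros z _; apply poincare_sum.
- intros z _; apply (proj2_sig (constructive_indefinite_description _ (pterm'_summable m chi z))).
Qed.

(** Slashing by alpha sends the term of the row p to that of the row p alpha. This is a bijection of
    the rows, so the unordered sum is only relabelled. *)
Lemma slash_poincare (m : nat) (chi : row -> Prop) (al : SL2Z) :
  slash 4 al (poincare m chi) = poincare m (fun q => chi (row_act q (sl_inv al))).
Proof.
apply functional_extensionality; intros z.
apply (climit_unique finsets (lsum (fun p => slash 4 al (pterm m chi p) z))).
- apply climit_ext with (fun l => / moebius_den al z ^ 4 *
    lsum (fun p => pterm m chi p (moebius al z)) l); [typeclasses eauto| |].
  + intros l; rewrite <- lsum_mult; apply lsum_ext; intros p _; unfold slash, Cdiv; ring.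
  + unfold slash, Cdiv; rewrite (Cmult_comm (poincare m chi _)).
    apply climit_scal; [typeclasses eauto|apply poincare_sum].
- apply climit_ext with
    (lsum (fun p => pterm m (fun q => chi (row_act q (sl_inv al))) (row_act p al) z));
    [typeclasses eauto| |].
  + intros l; apply lsum_ext; intros p _; now rewrite slash_pterm.
  + apply (usum_bij (fun p => pterm m (fun q => chi (row_act q (sl_inv al))) p z)
      (fun p => row_act p al) (fun p => row_act p (sl_inv al))).
    * intros p; apply row_act_inv'.
    * intros p; apply row_act_inv.
    * apply poincare_sum.
Qed.

Lemma poincare_ext (m : nat) (chi psi : row -> Prop) :
  (forall g, chi (bottom g) <-> psi (bottom g)) -> poincare m chi = poincare m psi.
Proof.
intros H; apply functional_extensionality; intros z.
apply (climit_unique finsets (lsum (fun p => pterm m chi p z))); [apply poincare_sum|].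
apply climit_ext with (lsum (fun p => pterm m psi p z));
  [typeclasses eauto| |apply poincare_sum].
intros l; apply lsum_ext; intros p _.
destruct (classic (exists g, bottom g = p /\ chi p)) as [(g & <- & X)|NE].
- rewrite !pterm_bottom; auto; now apply H.
- rewrite !pterm_none; auto.
  + intros g <- X; apply NE; eauto.
  + intros g <- X; apply NE; exists g; split; [reflexivity|now apply H].
Qed.

Definition level_row (N : nat) (p : row) : Prop := (Z.of_nat N | fst p)%Z.

Lemma poincare_invariant (N m : nat) : Gamma0_inv N 4 (poincare m (level_row N)).
Proof.
intros g Hg; rewrite slash_poincare; apply poincare_ext; intros h.
assert (A : forall p (k : SL2Z), in_Gamma0 N k -> level_row N p -> level_row N (row_act p k)).
{ intros p k Hk Hp; unfold level_row, row_act; simpl.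
  apply Z.divide_add_r; [now apply Z.divide_mul_l|now apply Z.divide_mul_r]. }
split; intros H.
- rewrite <- (row_act_inv' (bottom h) g); now apply A.
- apply A; [|exact H]; unfold in_Gamma0; simpl; now apply Z.divide_opp_r.
Qed.

(** For c <> 0 and y = Im tau > 1 one has |c tau + d| >= y, so Im gamma tau <= 1 and |q^-m(gamma
    tau)| <= exp s. The remaining sum of |c tau + d|^-4 is O(y^-2) by [lattice_bound_c]. *)
Lemma poincare_decay (m : nat) (chi : row -> Prop) :
  (forall g, chi (bottom g) -> sl_c g <> 0%Z) -> climit Finf (poincare m chi) 0.
Proof.
intros H eps e0 X.
set (s := (INR m * freq 1)%R).
assert (s0 : 0 <= s)
  by (apply Rmult_le_pos; [apply pos_INR|left; apply freq_pos; lia]).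
set (K := (exp s * (3 + 4 * X ^ 2))%R).
assert (X2 : 0 <= X ^ 2) by apply pow2_ge_0.
assert (K0 : 0 < K) by (apply Rmult_lt_0_compat; [apply exp_pos|lra]).
exists (1 + K * 25 / eps)%R; intros tau h1 h2.
assert (Q : 0 < K * 25 / eps) by (apply Rdiv_lt_0_compat; lra).
set (y := Im tau) in *; assert (y1 : 1 < y) by lra.
assert (x2 : Re tau ^ 2 <= X ^ 2).
{ rewrite <- (pow2_abs (Re tau)); apply pow_incr; split; [apply Rabs_pos|exact h1]. }
replace (poincare m chi tau - 0) with (poincare m chi tau) by ring.
assert (y2 : 0 < y ^ 2) by (apply pow_lt; lra).
apply Rle_lt_trans with (K / y ^ 2 * 25)%R.
- apply usum_bound with (fun p => pterm m chi p tau); [|intros p|apply poincare_sum].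
  { left; now apply Rdiv_lt_0_compat. }
  destruct (classic (exists g, bottom g = p /\ chi p)) as [(g & <- & Hg)|NE].
  + specialize (H g Hg); rewrite pterm_bottom by exact Hg.
    assert (LB := lattice_bound_c g tau H); fold y in LB.
    assert (D := den_lower g tau); fold y in D.
    assert (c1 : 1 <= Rabs (IZR (sl_c g)))
      by (rewrite <- abs_IZR; apply IZR_le; lia).
    assert (D' : y <= Cmod (moebius_den g tau)) by nra.
    assert (N := Cpow_neq_0 _ 4 (moebius_den_neq_0 g tau)).
    unfold slash; rewrite Cmod_div, Cmod_pow by exact N.
    unfold qpole; rewrite Cmod_qe; fold s.
    assert (IB : Im (moebius g tau) <= 1).
    { rewrite Im_moebius; fold y; set (j := Cmod (moebius_den g tau)) in *.
      apply Rmult_le_reg_r with (j ^ 2)%R; [apply pow_lt; lra|].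
      unfold Rdiv; rewrite Rmult_assoc, Rinv_l by (apply pow_nonzero; lra); nra. }
    assert (EB : exp (- (- s * Im (moebius g tau))) <= exp s)
      by (apply exp_le; nra).
    apply Rle_trans with (exp s * ((3 + 4 * X ^ 2) / y ^ 2 * wt (bottom g)))%R;
      [|unfold K; apply Req_le; field; lra].
    apply Rmult_le_compat; auto.
    * left; apply exp_pos.
    * left; apply Rinv_0_lt_compat, pow_lt; lra.
    * eapply Rle_trans; [exact LB|].
      apply Rmult_le_compat_r; [left; apply wt_pos|].
      replace ((3 + 4 * X ^ 2) / y ^ 2)%R with ((3 + 4 * X ^ 2) * y ^ 2 / y ^ 4)%R by (field; lra).
      apply Rmult_le_compat_r; [left; apply Rinv_0_lt_compat, pow_lt; lra|].
      assert (1 <= y ^ 2) by nra. nra.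
  + rewrite pterm_none by (intros g E Hp; apply NE; eauto).
    unfold fzero; rewrite Cmod_0; apply Rmult_le_pos; [|left; apply wt_pos].
    left; now apply Rdiv_lt_0_compat.
- apply Rmult_lt_reg_r with (y ^ 2)%R; [exact y2|].
  replace (K / y ^ 2 * 25 * y ^ 2)%R with (K * 25)%R by (field; lra).
  replace (K * 25)%R with (eps * (K * 25 / eps))%R by (field; lra).
  apply Rmult_lt_compat_l; [exact e0|]; nra.
Qed.

(** A row with c = 0 in the slashed series would be the bottom row of some g with g alpha^-1 in
    Gamma0(N) and g(oo) = oo; then g alpha^-1 would take alpha(oo) to oo. *)
Lemma poincare_cusps (N m : nat) (al : SL2Z) :
  ~ cusp_equiv_infty N al -> climit Finf (slash 4 al (poincare m (level_row N))) 0.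
Proof.
intros NE; rewrite slash_poincare; apply poincare_decay.
intros g Hg c0; apply NE; exists (sl_mul g (sl_inv al)); split; [exact Hg|].
assert (E := row_act_inv' (bottom g) al); rewrite <- bottom_mul in E.
apply (f_equal fst) in E; simpl fst in E.
etransitivity; [exact E|exact c0].
Qed.

(* The rows (0, 1) and (0, -1) each contribute e(-m tau). *)
Lemma poincare_principal (N m : nat) (z : UHP) :
  poincare m (level_row N) z =
  2 * qpole m z + poincare m (fun p => level_row N p /\ fst p <> 0%Z) z.
Proof.
set (psi := fun p : row => level_row N p /\ fst p <> 0%Z).
(* The two series differ only on [l0], since c = 0 forces d = 1 or d = -1 by the determinant. *)
set (u := fun p => pterm m (level_row N) p z - pterm m psi p z).
set (l0 := (0, 1)%Z :: (0, -1)%Z :: nil).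
assert (U1 : u (0, 1)%Z = qpole m z).
{ unfold u; change (0, 1)%Z with (bottom (sl_T 0)) at 1.
  rewrite pterm_bottom, slash_1 by apply Z.divide_0_r.
  rewrite pterm_none by (intros g E [_ X]; now apply X).
  unfold fzero; ring. }
assert (U2 : u (0, -1)%Z = qpole m z).
{ unfold u; change (0, -1)%Z with (bottom sl_neg1) at 1.
  rewrite pterm_bottom by apply Z.divide_0_r.
  rewrite pterm_none by (intros g E [_ X]; now apply X).
  unfold slash; rewrite moebius_den_neg1, moebius_neg1; unfold fzero; simpl; field. }
assert (L := usum_finite u l0).
assert (S0 : climit finsets (lsum u) (lsum u l0)).
{ apply L.
  - unfold l0; repeat constructor; simpl; [intros [E|[]]; discriminate E|tauto].
  - intros [c d] NI; unfold u.
    destruct (classic (exists g, bottom g = (c, d) /\ level_row N (c, d))) as [(g & E & X)|NE].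
    + rewrite <- E in *; rewrite pterm_bottom by exact X.
      destruct (Z.eq_dec c 0) as [c0|c1].
      * exfalso; apply NI; unfold bottom in E; injection E as Ec Ed.
        assert (Dg := sl_det g); rewrite Ec, c0, Z.mul_0_r, Z.sub_0_r in Dg.
        unfold bottom; rewrite Ec, c0.
        destruct (Z.mul_eq_1 _ _ Dg) as [A|A]; rewrite A in Dg; simpl.
        -- left; f_equal; lia.
        -- right; left; f_equal; lia.
      * rewrite pterm_bottom; [ring|].
        split; [exact X|]; rewrite E; exact c1.
    + rewrite !pterm_none.
      * ring.
      * intros g E [X _]; apply NE; eauto.
      * intros g E X; apply NE; eauto. }
simpl in S0; rewrite U1, U2 in S0.
assert (S1 : climit finsets (lsum u)
  (poincare m (level_row N) z - poincare m psi z)).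
{ apply climit_ext with (fun l => lsum (fun p => pterm m (level_row N) p z) l
    - lsum (fun p => pterm m psi p z) l); [typeclasses eauto| |].
  - intros l; unfold u; now rewrite lsum_minus.
  - apply climit_minus; [typeclasses eauto| |]; apply poincare_sum. }
assert (E := climit_unique finsets _ _ _ S0 S1).
replace (poincare m (level_row N) z) with
  (poincare m (level_row N) z - poincare m psi z + poincare m psi z) by ring.
rewrite <- E; ring.
Qed.

Lemma poincare_infinity (N m : nat) :
  climit Finf (fun z => poincare m (level_row N) z * qe (INR m * freq 1) z) 2.
Proof.
assert (Q : exists c, climit Finf (fun z => qe (INR m * freq 1) z) c).
{ destruct m as [|m].
  - exists 1; apply climit_ext with (fun _ => RtoC 1); [typeclasses eauto| |].
    + intros z; simpl; rewrite Rmult_0_l, qe_0; reflexivity.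
    + apply climit_const; typeclasses eauto.
  - exists 0; apply tends_qe, Rmult_lt_0_compat; [apply lt_0_INR; lia|apply freq_pos; lia]. }
destruct Q as [c Hc].
apply climit_ext with (fun z => 2 +
  poincare m (fun p => level_row N p /\ fst p <> 0%Z) z * qe (INR m * freq 1) z);
  [typeclasses eauto| |].
- intros z; rewrite poincare_principal; unfold qpole.
  assert (E := qe_opp (INR m * freq 1) z).
  rewrite Cmult_plus_distr_r, <- Cmult_assoc, E; ring.
- eapply eq_ind with (x := 2 + 0 * c); [|ring].
  apply climit_plus; [typeclasses eauto|apply climit_const; typeclasses eauto|].
  apply climit_mult; [typeclasses eauto| |exact Hc].
  apply poincare_decay; intros g [_ X]; exact X.
Qed.

End PoincareSeries.

(** * Valuations of bases and direct sums *)

Section Decomposition.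
Local Open Scope R_scope.
Local Open Scope C_scope.

Lemma lincomb_0 (c : nat -> C) (F : nat -> UHP -> C) : lincomb c F 0 = fzero.
Proof.
apply functional_extensionality; intros z; unfold lincomb, fzero.
apply (sum_n_m_zero (G := C_AbelianMonoid)); lia.
Qed.

Lemma lincomb_S (c : nat -> C) (F : nat -> UHP -> C) (d : nat) :
  lincomb c F (S d) = fadd (lincomb c F d) (fun z => c (S d) * F (S d) z).
Proof.
apply functional_extensionality; intros z; unfold lincomb, fadd.
rewrite sum_n_Sm by lia; reflexivity.
Qed.

Lemma lincomb_ext (c c' : nat -> C) (F : nat -> UHP -> C) (d : nat) :
  (forall s, (1 <= s <= d)%nat -> c s = c' s) -> lincomb c F d = lincomb c' F d.
Proof.
intros H; induction d as [|d IH]; [now rewrite !lincomb_0|].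
rewrite !lincomb_S, IH, (H (S d)); auto; try lia; intros; apply H; lia.
Qed.

Lemma lincomb_minus (c c' : nat -> C) (F : nat -> UHP -> C) (d : nat) (z : UHP) :
  lincomb (fun s => c s - c' s) F d z = lincomb c F d z - lincomb c' F d z.
Proof.
induction d as [|d IH]; [rewrite !lincomb_0; unfold fzero; ring|].
rewrite !lincomb_S; unfold fadd; rewrite IH; ring.
Qed.

Lemma cusp_form_lincomb (N k : nat) (c : nat -> C) (F : nat -> UHP -> C) (d : nat) :
  (1 <= N)%nat -> (forall s, (1 <= s <= d)%nat -> cusp_form N k (F s)) ->
  cusp_form N k (lincomb c F d).
Proof.
intros N1 H; induction d as [|d IH]; [rewrite lincomb_0; now apply cusp_form_zero|].
rewrite lincomb_S; apply cusp_form_fadd; auto.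
- apply IH; intros; apply H; lia.
- apply cusp_form_scal; auto; apply H; lia.
Qed.

(** Terms before s have zero coefficients, terms after s have higher order. As [c s] may be 0, this
    serves both to find the valuation of a combination and to show that coefficients vanish one
    after the other. *)
Lemma leading_lincomb (c d : nat -> C) (F : nat -> UHP -> C) (v : nat -> nat) (n s : nat) :
  (forall i, (1 <= i <= n)%nat -> leading (F i) (v i) (d i)) ->
  (forall i, (s < i <= n)%nat -> (v s < v i)%nat) ->
  (1 <= s <= n)%nat -> (forall i, (1 <= i < s)%nat -> c i = 0) ->
  leading (lincomb c F n) (v s) (c s * d s).
Proof.
intros L inc sn Z.
assert (K : forall m, (m <= n)%nat ->
  leading (lincomb c F m) (v s) (if le_lt_dec s m then c s * d s else 0)).
{ induction m as [|m IH]; intros mn.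
  - destruct (le_lt_dec s 0); [lia|]; rewrite lincomb_0.
    unfold leading, fzero; apply climit_ext with (fun _ => RtoC 0);
      [typeclasses eauto|intros; ring|apply climit_const; typeclasses eauto].
  - rewrite lincomb_S; specialize (IH ltac:(lia)).
    assert (LS := L (S m) ltac:(lia)).
    destruct (le_lt_dec s (S m)) as [sm|sm].
    + destruct (Nat.eq_dec s (S m)) as [E|ne].
      * destruct (le_lt_dec s m); [lia|].
        replace (c s * d s) with (0 + c s * d s) by ring.
        apply leading_plus; [exact IH|]; rewrite <- E in LS |- *.
        now apply leading_scal.
      * destruct (le_lt_dec s m); [|lia].
        replace (c s * d s) with (c s * d s + c (S m) * 0) by ring.
        apply leading_plus; [exact IH|]; apply leading_scal.
        apply leading_lt with (v (S m)) (d (S m)); [apply inc; lia|exact LS].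
    + destruct (le_lt_dec s m); [lia|].
      replace (RtoC 0) with (0 + c (S m) * d (S m)) by (rewrite Z by lia; ring).
      rewrite (Z (S m)) by lia.
      apply leading_plus; [exact IH|].
      apply (climit_ext Finf (fun _ => RtoC 0)); [intros; ring|].
      replace (0 * d (S m)) with (RtoC 0) by ring; apply climit_const; typeclasses eauto. }
specialize (K n (le_n n)); destruct (le_lt_dec s n); [exact K|lia].
Qed.

(** Gaussian elimination along the orders 1, ..., n. The cusp condition starts it at order 0; once
    order n vanishes, [leading_step] supplies the next coefficient e, which e / d_(n+1) times
    G_(n+1) cancels. *)
Lemma eliminate_valuations (N k : nat) (G : nat -> UHP -> C) (d : nat -> C) (n : nat)
  (f : UHP -> C) : (1 <= N)%nat -> cusp_form N k f ->
  (forall s, (1 <= s <= n)%nat -> cusp_form N k (G s) /\ leading (G s) s (d s) /\ d s <> 0) ->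
  exists c, leading (fadd f (fun z => - (1) * lincomb c G n z)) n 0.
Proof.
intros N1 Hf; induction n as [|n IH]; intros H.
- exists (fun _ => 0); rewrite lincomb_0.
  assert (L := cusp_form_leading0 N k f N1 Hf).
  revert L; apply (climit_ext Finf); intros z; unfold fadd, fzero; ring.
- destruct IH as [c Hc]; [intros; apply H; lia|].
  set (h := fadd f (fun z => - (1) * lincomb c G n z)) in *.
  assert (Hh : cusp_form N k h).
  { apply cusp_form_fadd; auto; apply cusp_form_scal; auto.
    apply cusp_form_lincomb; auto; intros; apply H; lia. }
  destruct (leading_step N k h n N1 (proj1 Hh) Hc) as [e He].
  destruct (H (S n) ltac:(lia)) as (G1 & G2 & G3).
  exists (fun s => if Nat.eq_dec s (S n) then e / d (S n) else c s).
  rewrite lincomb_S; destruct (Nat.eq_dec (S n) (S n)) as [_|X]; [|lia].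
  rewrite (lincomb_ext _ c); [|intros s sn; destruct (Nat.eq_dec s (S n)); [lia|reflexivity]].
  assert (L := leading_plus _ _ _ _ _ He (leading_scal _ _ _ (- (e / d (S n))) G2)).
  replace (e + - (e / d (S n)) * d (S n)) with (RtoC 0) in L by (field; exact G3).
  revert L; apply (climit_ext Finf); intros z; unfold h, fadd; ring.
Qed.

(** The matrix -1 lies in Gamma0(N) and gives f = (-1)^k f. It makes rho / 2 an exact quotient. *)
Lemma even_weight (N k : nat) (f : UHP -> C) : modular_form N k f ->
  (forall z, f z <> 0) -> k = (2 * (k / 2))%nat.
Proof.
intros (_ & inv & _) nz.
assert (z := upt 0 1 Rlt_0_1).
assert (E := f_equal (fun g => g z) (inv sl_neg1 (Z.divide_0_r _))); cbv beta in E.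
unfold slash in E; rewrite moebius_den_neg1, moebius_neg1 in E.
assert (P2 : forall n, (- RtoC 1) ^ (2 * n) = 1).
{ intros n; induction n as [|n IH]; [reflexivity|].
  replace (2 * S n)%nat with (S (S (2 * n))) by lia; rewrite !Cpow_S, IH; ring. }
rewrite (Nat.div_mod_eq k 2) at 1.
destruct (k mod 2)%nat as [|[|r]] eqn:M; [lia| |].
- exfalso; rewrite (Nat.div_mod_eq k 2), M, Nat.add_1_r, Cpow_S, P2 in E.
  apply (nz z).
  assert (E2 : f z = - f z) by (rewrite <- E at 1; field).
  replace (f z) with ((f z - - f z) / 2) by (field; intros Z; apply RtoC_inj in Z; lra).
  rewrite <- E2; field; intros Z; apply RtoC_inj in Z; lra.
- assert (B := Nat.mod_upper_bound k 2); lia.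
Qed.

Lemma cusp_form_of_valuation (N rho nu j : nat) (Delta : UHP -> C) : (1 <= N)%nat ->
  strong_modular_form N rho Delta -> is_valuation Delta nu -> (1 <= j <= nu)%nat ->
  exists G c, cusp_form N (rho + 4) G /\ leading G j c /\ c <> 0.
Proof.
intros N1 (_ & DM & _ & _) Dv jn.
apply modular_form_iff in DM; [|exact N1]; destruct DM as (D1 & D2 & D3).
destruct (leading_of_valuation _ _ Dv) as (d & d0 & Ld).
set (P := poincare (nu - j) (level_row N)).
assert (L : leading (fmul Delta P) j (d * 2)).
{ apply (climit_ext Finf (fun z => (Delta z * qe (- (INR nu * freq 1)) z) *
    (P z * qe (INR (nu - j) * freq 1) z))).
  - intros z; unfold fmul.
    replace (- (INR j * freq 1))%R with (- (INR nu * freq 1) + INR (nu - j) * freq 1)%R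
      by (rewrite minus_INR by lia; ring).
    rewrite qe_plus; ring.
  - apply climit_mult; [typeclasses eauto|exact Ld|apply poincare_infinity]. }
exists (fmul Delta P), (d * 2).
assert (inv : Gamma0_inv N (rho + 4) (fmul Delta P)).
{ intros g Hg; assert (EP : slash 4 g P = P) by (unfold P; now apply poincare_invariant).
  now rewrite slash_fmul, D2, EP. }
split; [|split; [exact L|]].
- apply cusp_form_iff; [exact N1|].
  split; [apply C11_mult; [exact D1|apply C11_poincare]|split; [exact inv|]].
  intros al; destruct (classic (cusp_equiv_infty N al)) as [EQ|NE].
  + apply slash_cusp_infty with N; auto.
    apply leading_climit0 with j (d * 2); [lia|exact L].
  + rewrite slash_fmul; destruct (D3 al) as [e He].
    replace (RtoC 0) with (e * 0) by ring.
    apply climit_mult; [typeclasses eauto|exact He|now apply poincare_cusps].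
- apply Cmult_neq_0; [exact d0|]; intros Z; apply RtoC_inj in Z; lra.
Qed.

Lemma leading_eq (f : UHP -> C) (m n : nat) (c d : C) :
  leading f m c -> leading f n d -> c <> 0 -> d <> 0 -> m = n.
Proof.
intros Lc Ld c0 d0; destruct (Nat.lt_total m n) as [L|[E|L]]; [|exact E|].
- exfalso; apply c0, (leading_unique f m); [exact Lc|now apply leading_lt with n d].
- exfalso; apply d0, (leading_unique f n); [exact Ld|now apply leading_lt with m c].
Qed.

Lemma leading_fzero (n : nat) : leading fzero n 0.
Proof.
apply (climit_ext Finf (fun _ => RtoC 0)); [intros; unfold fzero; ring|].
apply climit_const; typeclasses eauto.
Qed.

(** Strictly increasing valuations of cusp forms satisfy v_s >= s, and every j with 1 <= j <= nu
    occurs among them because some form of the space has valuation j. Strong induction concludes: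
    v_s = j has s <= j, and s < j would give v_s = s. *)
Lemma basis_valuations (N rho nu delta : nat) (Delta : UHP -> C) (F : nat -> UHP -> C) :
  (1 <= N)%nat -> strong_modular_form N rho Delta -> is_valuation Delta nu ->
  is_basis (cusp_form N (rho + 4)) F delta -> unitary_upper_triangular F delta ->
  forall j, (1 <= j <= nu)%nat -> (j <= delta)%nat /\ is_valuation (F j) j.
Proof.
intros N1 HD Dv (B1 & B2 & _) (U & T).
(* The choice below needs a total function of s, whence the default 0 outside of 1, ..., delta. *)
assert (V : forall s, exists v, (1 <= s <= delta)%nat -> is_valuation (F s) v).
{ intros s; destruct (le_lt_dec 1 s), (le_lt_dec s delta); try (exists O; lia).
  destruct (unitary_valuation (F s)) as [v Hv]; [apply U; lia|exists v; auto]. }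
set (v := fun s => proj1_sig (constructive_indefinite_description _ (V s))).
assert (Hv : forall s, (1 <= s <= delta)%nat -> is_valuation (F s) (v s))
  by (intros s; apply (proj2_sig (constructive_indefinite_description _ (V s)))).
assert (inc : forall s t, (1 <= s < t)%nat -> (t <= delta)%nat -> (v s < v t)%nat).
{ intros s t st td; apply (T s t); auto; try lia; apply Hv; lia. }
assert (ge : forall s, (1 <= s <= delta)%nat -> (s <= v s)%nat).
{ intros s; induction s as [|s IH]; intros Hs; [lia|].
  destruct (Nat.eq_dec s 0) as [->|s0].
  - destruct (v 1%nat) eqn:E; [|lia]; exfalso.
    destruct (leading_of_valuation _ _ (Hv 1%nat Hs)) as (c & c0 & L); rewrite E in L.
    apply c0, (leading_unique (F 1%nat) 0); [exact L|].
    apply cusp_form_leading0 with N (rho + 4)%nat; [exact N1|now apply B1].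
  - specialize (IH ltac:(lia)); specialize (inc s (S s) ltac:(lia) ltac:(lia)); lia. }
assert (LE : exists d : nat -> C, forall s, (1 <= s <= delta)%nat ->
   leading (F s) (v s) (d s) /\ d s <> 0).
{ assert (X : forall s, exists e : C, (1 <= s <= delta)%nat -> leading (F s) (v s) e /\ e <> 0).
  { intros s; destruct (le_lt_dec 1 s), (le_lt_dec s delta);
      try (exists (RtoC 0); lia).
    destruct (leading_of_valuation _ _ (Hv s ltac:(lia))) as (e & e0 & L); exists e; auto. }
  exists (fun s => proj1_sig (constructive_indefinite_description _ (X s))).
  intros s; apply (proj2_sig (constructive_indefinite_description _ (X s))). }
destruct LE as [d Hd].
assert (HIT : forall j, (1 <= j <= nu)%nat -> exists s, (1 <= s <= delta)%nat /\ v s = j).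
{ intros j jn.
  destruct (cusp_form_of_valuation N rho nu j Delta N1 HD Dv jn) as (G & e & HG & L & e0).
  destruct (B2 G HG) as [c Hc].
  destruct (classic (exists s, (1 <= s <= delta)%nat /\ c s <> 0)) as [EX|NE].
  (* As the valuations increase, the least index with a nonzero coefficient carries the valuation of
     [G]. *)
  - assert (MIN : exists s, ((1 <= s <= delta)%nat /\ c s <> 0) /\
      forall i, (1 <= i < s)%nat -> c i = 0).
    { destruct EX as [s Hs]; induction s as [s IH] using lt_wf_ind.
      destruct (classic (exists i, (1 <= i < s)%nat /\ c i <> 0)) as [(i & Hi & ci)|NE].
      - apply (IH i); [lia|]; split; [lia|exact ci].
      - exists s; split; [exact Hs|]; intros i Hi; apply NNPP; intros ci; apply NE; eauto. }
    destruct MIN as (s & (Hs & cs) & Z); exists s; split; [exact Hs|].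
    apply (leading_eq G _ _ (c s * d s) e); auto.
    + rewrite Hc; apply leading_lincomb; auto.
      * intros i Hi; now apply Hd.
      * intros i Hi; apply inc; lia.
    + apply Cmult_neq_0; [exact cs|now apply Hd].
  - exfalso; apply e0, (leading_unique G j); [exact L|].
    rewrite Hc, (lincomb_ext c (fun _ => 0)).
    + assert (E : lincomb (fun _ => RtoC 0) F delta = fzero).
      { clear; induction delta as [|n IH]; [apply lincomb_0|].
        rewrite lincomb_S, IH; apply functional_extensionality; intros z.
        unfold fadd, fzero; ring. }
      rewrite E; apply leading_fzero.
    + intros s Hs; apply NNPP; intros cs; apply NE; eauto. }
assert (K : forall j, (1 <= j <= nu)%nat -> (j <= delta)%nat /\ v j = j).
{ intros j; induction j as [j IH] using lt_wf_ind; intros jn.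
  destruct (HIT j jn) as (s & Hs & vs).
  destruct (Nat.eq_dec s j) as [->|ne]; [split; [lia|exact vs]|].
  assert (G := ge s Hs).
  destruct (IH s ltac:(lia) ltac:(lia)) as [_ E]; lia. }
intros j jn; destruct (K j jn) as [jd E]; split; [exact jd|].
rewrite <- E at 2; apply Hv; lia.
Qed.

(** Existence: eliminate the orders 1, ..., nu, then divide by Delta. Uniqueness: the difference of
    the components lies both in Delta times cusp forms, of order above nu, and in the span, whose
    nonzero elements have order at most nu. *)
Lemma direct_sum_step (N rho nu k : nat) (Delta : UHP -> C) (G : nat -> UHP -> C)
  (d : nat -> C) : (1 <= N)%nat ->
  strong_modular_form N rho Delta -> is_valuation Delta nu -> (rho <= k)%nat ->
  (forall s, (1 <= s <= nu)%nat -> cusp_form N k (G s) /\ leading (G s) s (d s) /\ d s <> 0) ->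
  is_direct_sum (cusp_form N k)
    (mul_space Delta (cusp_form N (k - rho)) :: Vect G nu :: nil).
Proof.
intros N1 HD Dv rk HG.
assert (W : (rho + (k - rho) = k)%nat) by lia.
assert (nz : forall z, Delta z <> 0) by apply HD.
assert (DM : modular_form N rho Delta) by apply HD.
split.
- intros f Hf.
  destruct (eliminate_valuations N k G d nu f N1 Hf HG) as [c Hc].
  set (h := fadd f (fun z => - (1) * lincomb c G nu z)) in *.
  assert (HL : cusp_form N k (lincomb c G nu))
    by (apply cusp_form_lincomb; auto; intros; now apply HG).
  assert (Hh : cusp_form N k h) by (apply cusp_form_fadd; auto; now apply cusp_form_scal).
  set (g := fun z => h z / Delta z).
  assert (Hg : cusp_form N (k - rho) g).
  { apply cusp_form_div with rho nu; auto; now rewrite W. }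
  assert (Eh : h = fmul Delta g).
  { apply functional_extensionality; intros z; unfold fmul, g; field; apply nz. }
  exists (h :: lincomb c G nu :: nil); split.
  + split.
    * constructor; [exists g; auto|]; constructor; [exists c; reflexivity|constructor].
    * apply functional_extensionality; intros z; simpl; unfold h, fadd, fzero; ring.
  + intros ws [HF Ef]; assert (E := fun z => f_equal (fun u => u z) Ef); clear Ef.
    inversion HF as [|? w1 ? ws1 H1 HF1]; subst; clear HF.
    inversion HF1 as [|? w2 ? ws2 H2 HF2]; subst; clear HF1.
    inversion HF2; subst; clear HF2.
    destruct H1 as (g' & Hg' & ->), H2 as (c' & ->).
    assert (Ez : forall z, f z = Delta z * g' z + lincomb c' G nu z).
    { intros z; rewrite (E z); simpl; unfold fadd, fmul, fzero; ring. }
    set (D := lincomb (fun s => c' s - c s) G nu).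
    assert (ED : D = fmul Delta (fadd g (fun z => - (1) * g' z))).
    { apply functional_extensionality; intros z; unfold D; rewrite lincomb_minus.
      unfold fmul, fadd; rewrite Cmult_plus_distr_l.
      change (Delta z * g z) with (fmul Delta g z); rewrite <- Eh; unfold h, fadd.
      rewrite Ez; ring. }
    (* Delta has order nu and the other factor, a cusp form, vanishes at oo. *)
    assert (LD : leading D nu 0).
    { destruct (leading_of_valuation _ _ Dv) as (e & e0 & Le).
      rewrite ED; rewrite <- (Nat.add_0_r nu); replace (RtoC 0) with (e * 0) by ring.
      apply leading_fmul; [exact Le|].
      apply (cusp_form_leading0 N (k - rho)); [exact N1|].
      apply cusp_form_fadd; auto; now apply cusp_form_scal. }
    (* Once the previous differences vanish, the coefficient of order s in [D] is the s-th
       difference times [d s]; but [D] vanishes to all orders up to nu. *)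
    assert (CC : forall s, (1 <= s <= nu)%nat -> c' s - c s = 0).
    { intros s; induction s as [s IH] using lt_wf_ind; intros Hs.
      assert (X : leading D s ((c' s - c s) * d s)).
      { apply (leading_lincomb (fun s => c' s - c s) d G (fun s => s) nu s); auto.
        - intros i Hi; now apply HG.
        - intros i Hi; lia.
        - intros i Hi; apply IH; lia. }
      assert (Y : leading D s 0).
      { destruct (Nat.eq_dec s nu) as [->|ne]; [exact LD|].
        apply leading_lt with nu (RtoC 0); [lia|exact LD]. }
      assert (Q := leading_unique _ _ _ _ X Y).
      destruct (HG s Hs) as (_ & _ & ds).
      replace (c' s - c s) with ((c' s - c s) * d s / d s) by (field; exact ds).
      rewrite Q; field; exact ds. }
    assert (LL : lincomb c' G nu = lincomb c G nu).
    { apply lincomb_ext; intros s Hs; now apply Ceq_minus, CC. }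
    rewrite LL in *; f_equal.
    apply functional_extensionality; intros z; unfold h, fadd, fmul; rewrite Ez; ring.
- intros f ws [HF ->].
  inversion HF as [|? w1 ? ws1 H1 HF1]; subst; clear HF.
  inversion HF1 as [|? w2 ? ws2 H2 HF2]; subst; clear HF1.
  inversion HF2; subst; clear HF2.
  destruct H1 as (g & Hg & ->), H2 as (c & ->); simpl.
  apply cusp_form_fadd; auto.
  + rewrite <- W.
    replace (fmul Delta g) with (fmul g Delta)
      by (apply functional_extensionality; intros; unfold fmul; ring).
    rewrite Nat.add_comm; now apply cusp_form_fmul.
  + apply cusp_form_fadd; auto; [|now apply cusp_form_zero].
    apply cusp_form_lincomb; auto; intros; now apply HG.
Qed.

Lemma fold_fmul (f : UHP -> C) (ws : list (UHP -> C)) :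
  fold_right fadd fzero (map (fmul f) ws) = fmul f (fold_right fadd fzero ws).
Proof.
induction ws as [|w ws IH]; simpl; [|rewrite IH];
  apply functional_extensionality; intros z; unfold fmul, fadd, fzero; ring.
Qed.

Lemma fmul_inj (f g h : UHP -> C) :
  (forall z, f z <> 0) -> fmul f g = fmul f h -> g = h.
Proof.
intros nz E; apply functional_extensionality; intros z.
apply (f_equal (fun u => u z)) in E; unfold fmul in E.
replace (g z) with (f z * g z / f z) by (field; apply nz).
rewrite E; field; apply nz.
Qed.

Lemma Forall2_mul_space (f : UHP -> C) (Bs : list ((UHP -> C) -> Prop)) (ws : list (UHP -> C)) :
  Forall2 (fun W w => W w) (map (mul_space f) Bs) ws <->
  exists bs, Forall2 (fun W w => W w) Bs bs /\ ws = map (fmul f) bs.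
Proof.
split.
- revert ws; induction Bs as [|B Bs IH]; intros ws H; inversion H; subst.
  + exists nil; split; constructor.
  + destruct (IH _ H4) as (bs & Hb & ->); destruct H2 as (b & Bb & ->).
    exists (b :: bs); split; [now constructor|reflexivity].
- intros (bs & H & ->); induction H; simpl; constructor; auto; now exists y.
Qed.

(** Multiplication by f is injective as f has no zeros, so a decomposition of W is carried over to f
    W. The image of A comes first and V0 next, so that iteration keeps the highest power of Delta at
    the head and lists the spans by increasing n. *)
Lemma direct_sum_compose (V W A V0 : (UHP -> C) -> Prop) (Bs : list ((UHP -> C) -> Prop))
  (f : UHP -> C) : (forall z, f z <> 0) ->
  is_direct_sum V (mul_space f W :: V0 :: nil) -> is_direct_sum W (A :: Bs) ->
  is_direct_sum V (mul_space f A :: V0 :: map (mul_space f) Bs).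
Proof.
intros nz [V1 V2] [W1 W2].
assert (SUM : forall (a v0 : UHP -> C) bs,
  fold_right fadd fzero (fmul f a :: v0 :: map (fmul f) bs) =
  fold_right fadd fzero (fmul f (fold_right fadd fzero (a :: bs)) :: v0 :: nil)).
{ intros a v0 bs; simpl; rewrite fold_fmul.
  apply functional_extensionality; intros z; unfold fadd, fmul, fzero; ring. }
assert (DEC : forall u a v0 bs, A a -> V0 v0 -> Forall2 (fun W w => W w) Bs bs ->
  u = fold_right fadd fzero (fmul f a :: v0 :: map (fmul f) bs) ->
  decomposition (mul_space f W :: V0 :: nil) u
    (fmul f (fold_right fadd fzero (a :: bs)) :: v0 :: nil)).
{ intros u a v0 bs Ha H0 Hb ->; split; [|apply SUM].
  constructor; [|repeat constructor; exact H0].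
  eexists; split; [|reflexivity].
  apply (W2 _ (a :: bs)); split; [now constructor|reflexivity]. }
split.
- intros u Hu; destruct (V1 u Hu) as (ws & [HF E] & UN).
  inversion HF as [|? w1 ? ws1 H1 HF1]; subst; clear HF.
  inversion HF1 as [|? v0 ? ws2 H2 HF2]; subst; clear HF1.
  inversion HF2; subst; clear HF2.
  destruct H1 as (g & Hg & ->).
  destruct (W1 g Hg) as (as_ & [HA EA] & UA).
  inversion HA as [|? a ? bs Ha Hb]; subst; clear HA.
  exists (fmul f a :: v0 :: map (fmul f) bs); split.
  + split; [|rewrite SUM; reflexivity].
    constructor; [now exists a|constructor; [exact H2|]].
    apply Forall2_mul_space; eauto.
  + intros ws [HF' E'].
    inversion HF' as [|? w1' ? ws1' H1' HF1']; subst; clear HF'.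
    inversion HF1' as [|? v0' ? ws2' H2' HF2']; subst; clear HF1'.
    destruct H1' as (a' & Ha' & ->).
    apply Forall2_mul_space in HF2'; destruct HF2' as (bs' & Hb' & ->).
    assert (Q := UN _ (DEC _ a' v0' bs' Ha' H2' Hb' E')).
    injection Q as Q1 Q2; subst v0'.
    apply fmul_inj in Q1; [|exact nz].
    assert (Q3 : a :: bs = a' :: bs').
    { apply UA; split; [now constructor|exact Q1]. }
    injection Q3 as -> ->; reflexivity.
- intros u ws [HF E].
  inversion HF as [|? w1 ? ws1 H1 HF1]; subst; clear HF.
  inversion HF1 as [|? v0 ? ws2 H2 HF2]; subst; clear HF1.
  destruct H1 as (a & Ha & ->).
  apply Forall2_mul_space in HF2; destruct HF2 as (bs & Hb & ->).
  eapply V2, DEC; eauto.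
Qed.

(** Spaces that are equal as predicates can be rewritten inside a list of summands. *)
Lemma space_ext (V W : (UHP -> C) -> Prop) : (forall f, V f <-> W f) -> V = W.
Proof.
intros H; apply functional_extensionality; intros f; apply propositional_extensionality, H.
Qed.

Lemma mul_space_fpow0 (f : UHP -> C) (V : (UHP -> C) -> Prop) : mul_space (fpow f 0) V = V.
Proof.
assert (E : forall v, fmul (fpow f 0) v = v).
{ intros v; apply functional_extensionality; intros z; unfold fmul, fpow; simpl; ring. }
apply space_ext; intros u; split.
- intros (v & Hv & ->); now rewrite E.
- intros Hu; exists u; now rewrite E.
Qed.

Lemma mul_space_fpowS (f : UHP -> C) (n : nat) (V : (UHP -> C) -> Prop) :
  mul_space f (mul_space (fpow f n) V) = mul_space (fpow f (S n)) V.
Proof.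
assert (E : forall v, fmul f (fmul (fpow f n) v) = fmul (fpow f (S n)) v).
{ intros v; apply functional_extensionality; intros z; unfold fmul, fpow.
  rewrite Cpow_S; ring. }
apply space_ext; intros u; split.
- intros (w & (v & Hv & ->) & ->); rewrite E; now exists v.
- intros (v & Hv & ->); rewrite <- E; eexists; split; [|reflexivity]; now exists v.
Qed.

Lemma direct_sum_singleton (V : (UHP -> C) -> Prop) : is_direct_sum V (V :: nil).
Proof.
assert (S0 : forall w, fadd w fzero = w).
{ intros w; apply functional_extensionality; intros z; unfold fadd, fzero; ring. }
split.
- intros f Hf; exists (f :: nil); split.
  + split; [constructor; [exact Hf|constructor]|simpl; now rewrite S0].
  + intros ws [HF ->]; inversion HF as [|? w ? ws1 H1 HF1]; subst.
    inversion HF1; subst; simpl; now rewrite S0.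
- intros f ws [HF ->]; inversion HF as [|? w ? ws1 H1 HF1]; subst.
  inversion HF1; subst; simpl; now rewrite S0.
Qed.

End Decomposition.

Theorem mainTheorem1 (N : nat) (hN : (1 <= N)%nat)
    (rho : nat) (Delta : UHP -> C) (hDelta : is_Delta N rho Delta)
    (nu : nat) (hnu : is_valuation Delta nu)
    (delta : nat) (F : nat -> UHP -> C)
    (hF : is_basis (cusp_form N (rho + 4)) F delta)
    (hFtri : unitary_upper_triangular F delta)
    (E : UHP -> C) (hE : modular_form N 2 E) (hEu : unitary E)
    (hEv : is_valuation E 0) :
  (forall k : nat, (rho / 2 + 2 <= k)%nat ->
     is_direct_sum (cusp_form N (2 * k))
       (mul_space Delta (cusp_form N (2 * k - rho))
        :: Vect (fun s => fmul (F s) (fpow E (k - rho / 2 - 2))) nu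
        :: nil))
  /\
  (forall k q r : nat, (2 <= k)%nat -> (k = q * (rho / 2) + r)%nat ->
     (2 <= r <= rho / 2 + 1)%nat ->
     is_direct_sum (cusp_form N (2 * k))
       (mul_space (fpow Delta q) (cusp_form N (2 * r))
        :: map (fun n : nat =>
             mul_space (fpow Delta n)
               (Vect (fun s =>
                  fmul (F s) (fpow E (k - (n + 1) * (rho / 2) - 2))) nu))
             (seq 0 q))).
Proof.
destruct hDelta as [HD _].
assert (nz : forall z, Delta z <> 0) by apply HD.
assert (ev : rho = (2 * (rho / 2))%nat) by (apply even_weight with N Delta; [apply HD|exact nz]).
set (h := (rho / 2)%nat) in *.
assert (P1 : forall k : nat, (h + 2 <= k)%nat ->
     is_direct_sum (cusp_form N (2 * k))
       (mul_space Delta (cusp_form N (2 * k - rho))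
        :: Vect (fun s => fmul (F s) (fpow E (k - h - 2))) nu :: nil)).
{ intros k hk.
  assert (BV := basis_valuations N rho nu delta Delta F hN HD hnu hF hFtri).
  destruct (leading_of_valuation _ _ hEv) as (e & e0 & Le).
  assert (X : forall s, exists d : C, (1 <= s <= nu)%nat -> leading (F s) s d /\ d <> RtoC 0).
  { intros s; destruct (le_lt_dec 1 s), (le_lt_dec s nu); try (exists (RtoC 0); lia).
    destruct (BV s ltac:(lia)) as [_ v].
    destruct (leading_of_valuation _ _ v) as (d & d0 & L); exists d; auto. }
  set (d := fun s => proj1_sig (constructive_indefinite_description _ (X s))).
  assert (Hd : forall s, (1 <= s <= nu)%nat -> leading (F s) s (d s) /\ d s <> RtoC 0)
    by (intros s; apply (proj2_sig (constructive_indefinite_description _ (X s)))).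
  (* E has valuation 0 with leading coefficient e <> 0, so its powers multiply the leading
     coefficient of F_s by a power of e and leave its order unchanged. *)
  apply direct_sum_step with (fun s => Cmult (d s) (Cpow e (k - h - 2))); auto; [lia|].
  intros s Hs; destruct (Hd s Hs) as [L d0]; split; [|split].
  (* The natural subtraction is exact because h + 2 <= k, and rho = 2 h by the parity of the
     weight. *)
  - replace (2 * k)%nat with (rho + 4 + (k - h - 2) * 2)%nat by lia.
    apply cusp_form_fmul; auto.
    + apply hF; destruct (BV s Hs); lia.
    + now apply modular_form_fpow.
  - rewrite <- (Nat.add_0_r s) at 2; apply leading_fmul; [exact L|now apply leading_fpow0].
  - apply Cmult_neq_0; [exact d0|now apply Cpow_neq_0]. }
split; [exact P1|].
(* k varies in the induction: splitting off one factor Delta replaces k by k - h and leaves r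
   fixed. *)
intros k q; revert k; induction q as [|q IH]; intros k r hk Ek hr.
- cbn [seq map]; rewrite mul_space_fpow0; replace k with r by lia.
  apply direct_sum_singleton.
- assert (hk' : (h + 2 <= k)%nat) by lia.
  specialize (IH (k - h)%nat r ltac:(lia) ltac:(lia) hr).
  assert (Q := P1 k hk').
  replace (2 * k - rho)%nat with (2 * (k - h))%nat in Q by lia.
  assert (R := direct_sum_compose _ _ _ _ _ _ nz Q IH).
  rewrite mul_space_fpowS, map_map in R.
  cbn [seq map]; rewrite mul_space_fpow0.
  replace (k - (0 + 1) * h - 2)%nat with (k - h - 2)%nat by lia.
  (* The summand n = 0 is the span just split off; those of the induction hypothesis, multiplied by
     Delta, move from n to n + 1. *)
  rewrite <- seq_shift, map_map.
  revert R; match goal with |- is_direct_sum _ (_ :: _ :: ?l) -> is_direct_sum _ (_ :: _ :: ?l') =>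
    replace l' with l; [trivial|] end.
  apply map_ext; intros n; rewrite mul_space_fpowS.
  replace (k - (S n + 1) * h - 2)%nat with (k - h - (n + 1) * h - 2)%nat by lia.
  reflexivity.
Qed.
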